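(* Let $\mathcal F=\emptyset$, $\kappa=5$, and let $\gamma(H)=0$ for every graph $H$ of order 5 except $\gamma(\mathrm Y)=1$, where $\mathrm Y$ is the graph on $\{1,2,3,4,5\}$ with edge set $\{12,23,34,35\}$. Let $B=C_5$. Then the corresponding problem (the inducibility of $\mathrm Y$) is perfectly $B$-stable; moreover $\lim_{n\to\infty}\lambda(n,\mathcal G)=24/125$ and the unique maximiser of $\lambda(B(\mathbf a))$ over $\mathbf a\in\mathbb S_5$ is the vector with each entry $1/5$.
   Context: All graphs are finite and simple; ''subgraph'' means induced subgraph. $P(F,G)$ is the number of $v(F)$-subsets of $V(G)$ inducing a copy of $F$, $p(F,G)=P(F,G)/\binom{v(G)}{v(F)}$. Admissible graphs are those containing no member of $\mathcal F$ as induced subgraph (here all graphs); $\mathcal G$ is the class of admissible graphs. $\Lambda(G)=\sum_H\gamma(H)P(H,G)$ over isomorphism classes $H$ of order-$\kappa$ graphs, $\lambda(G)=\Lambda(G)/\binom{v(G)}\kappa$, $\lambda(n,\mathcal G)=\max\{\lambda(G):G\in\mathcal G,v(G)=n\}$. For a graph $B$ on $[m]$ and disjoint sets $V_1,\dots,V_m$, the blow-up $B(V_1,\dots,V_m)$ has vertex set $\bigcup V_i$, with $u\in V_i,w\in V_j$ adjacent iff $ij\in E(B)$; $B()$ is the family of all blow-ups. $\mathbb S_m$ is the simplex of probability vectors in $\mathbb R^m$; $\lambda(B(\mathbf a))=\lim_{n}\lambda(B(V_{1,n},\dots,V_{m,n}))$ with $|V_{i,n}|=a_in+O(1)$. $\delta_{\mathrm{edit}}(G,B())$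 is the minimal number of adjacency changes turning $G$ (order $n$) into a blow-up of $B$, divided by $\binom n2$. Perfectly $B$-stable: there is $C>0$ with $\delta_{\mathrm{edit}}(G,B())\le C(\lambda(n,\mathcal G)-\lambda(G))$ for all admissible $G$ of order $n\ge C$. *)

(* Defs.v *)
From HB Require Import structures.
From mathcomp Require Import all_boot all_order all_algebra.
From mathcomp Require Import all_classical all_reals all_analysis.

Set Implicit Arguments.
Unset Strict Implicit.
Unset Printing Implicit Defensive.

Import Order.TTheory GRing.Theory Num.Theory.
Import numFieldNormedType.Exports.
Local Open Scope ring_scope.

(* A finite simple graph on the vertex set T is its set of edges, each edge
   being a 2-element subset of T. *)
Record sgraph (T : finType) := SGraph {
  edges :> {set {set T}};
  edges_card2 : edges \subset [set e : {set T} | #|e| == 2%N]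
}.

HB.instance Definition _ (T : finType) := [isSub for @edges T].
HB.instance Definition _ (T : finType) := [Finite of sgraph T by <:].

Definition adj (T : finType) (G : sgraph T) (u v : T) : bool :=
  [set u; v] \in edges G.

Lemma mkgraph_subproof (T : finType) (r : rel T) :
  [set [set p.1; p.2] | p : T * T & (p.1 != p.2) && r p.1 p.2]
    \subset [set e : {set T} | #|e| == 2%N].
Proof.
apply/fintype.subsetP => e /imsetP[p pr ->]; move: pr.
by rewrite !inE => /andP[pD _]; rewrite finset.cards2 pD.
Qed.

(* r need not be symmetric: {u, v} is an edge as soon as u != v and r u v or
   r v u holds (see mkgraphE). *)
Definition mkgraph (T : finType) (r : rel T) : sgraph T :=
  SGraph (mkgraph_subproof r).

Lemma mkgraphE (T : finType) (r : rel T) (u v : T) :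
  adj (mkgraph r) u v = (u != v) && (r u v || r v u).
Proof.
apply/imsetP/idP => [[[x y]] | /andP[uv /orP[ruv|rvu]]]; first last.
- by exists (v, u); rewrite ?inE /= ?rvu ?andbT 1?eq_sym // finset.setUC.
- by exists (u, v); rewrite ?inE /= ?uv.
rewrite inE /= => /andP[xy rxy] E.
have : x \in [set u; v] by rewrite E !inE eqxx.
have : y \in [set u; v] by rewrite E !inE eqxx orbT.
by rewrite !inE => /orP[] /eqP ? /orP[] /eqP ?; subst;
  rewrite ?eqxx // in xy *; rewrite ?xy ?rxy ?orbT // eq_sym xy.
Qed.

Section Counting.
Variables U T : finType.

Definition induces_copy (F : sgraph U) (G : sgraph T) (X : {set T}) : bool :=
  [exists f : {ffun U -> T},
    [&& injectiveb f, f @: [set: U] == X &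
        [forall u, forall v, adj G (f u) (f v) == adj F u v]]].

Definition ncopies (F : sgraph U) (G : sgraph T) : nat :=
  #|[set X : {set T} | induces_copy F G X]|.

Definition giso (F : sgraph U) (G : sgraph T) : bool :=
  induces_copy F G [set: T].

End Counting.

(* One graph from each isomorphism class of graphs of order k. *)
Definition iso_reps (k : nat) : {set sgraph 'I_k} :=
  transversal
    (equivalence_partition (fun F G : sgraph 'I_k => giso F G)
                           [set: sgraph 'I_k])
    [set: sgraph 'I_k].

Record problem (R : realType) := Problem {
  forbidden : forall k : nat, set (sgraph 'I_k);
  kappa : nat;
  gamma : sgraph 'I_kappa -> R (* meant to be isomorphism-invariant *)
}.

Section Problem.
Variables (R : realType) (p : problem R).

Definition admissible (T : finType) (G : sgraph T) : Prop :=
  forall (k : nat) (F : sgraph 'I_k), forbidden p F -> ncopies F G = 0%N.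

Definition Lambda (T : finType) (G : sgraph T) : R :=
  \sum_(H in iso_reps (kappa p)) gamma H * (ncopies H G)%:R.

Definition lambda (T : finType) (G : sgraph T) : R :=
  Lambda G / 'C(#|T|, kappa p)%:R.

(* The value 0 is a placeholder used only if no graph of order n is
   admissible. *)
Definition lambda_max (n : nat) : R :=
  if [pick G : sgraph 'I_n | `[< admissible G >]] is Some G0
  then lambda [arg max_(G > G0 | `[< admissible G >]) lambda G]%O
  else 0.

End Problem.

(* Here V_i is the fibre of f over i, so that T is their union; the
   parts V_i may be empty. *)
Definition blowup (m : nat) (B : sgraph 'I_m) (T : finType) (f : T -> 'I_m) :
  sgraph T := mkgraph (fun u w => adj B (f u) (f w)).

Definition is_blowup (m : nat) (B : sgraph 'I_m) (T : finType)
  (G : sgraph T) : bool :=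
  [exists f : {ffun T -> 'I_m}, G == blowup B f].

Definition edit_changes (T : finType) (G H : sgraph T) : nat :=
  #|(edges G :\: edges H) :|: (edges H :\: edges G)|.

(* 'C(#|T|, 2) bounds edit_changes, so this is the genuine minimum as soon as
   some blow-up of B with vertex set T exists. *)
Definition min_changes (m : nat) (B : sgraph 'I_m) (T : finType)
  (G : sgraph T) : nat :=
  \big[minn/'C(#|T|, 2)]_(H : sgraph T | is_blowup B H) edit_changes G H.

Definition delta_edit (R : realType) (m : nat) (B : sgraph 'I_m)
  (T : finType) (G : sgraph T) : R :=
  (min_changes B G)%:R / 'C(#|T|, 2)%:R.

Definition perfectly_stable (R : realType) (p : problem R) (m : nat)
  (B : sgraph 'I_m) : Prop :=
  exists2 C : R, 0 < C &
    forall (n : nat) (G : sgraph 'I_n), C <= n%:R -> admissible p G ->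
      delta_edit R B G <= C * (lambda_max p n - lambda p G).

Definition simplex (R : realType) (m : nat) : set 'rV[R]_m :=
  [set a | (forall i, 0 <= a 0 i) /\ \sum_(i < m) a 0 i = 1]%classic.

(* The blow-up of B whose i-th part has s i vertices. *)
Definition sized_blowup (m : nat) (B : sgraph 'I_m) (s : 'I_m -> nat) :
  sgraph {i : 'I_m & 'I_(s i)} := blowup B (@tag 'I_m (fun i => 'I_(s i))).

(* l is the common limit of lambda(B(V_{1,n}, ..., V_{m,n})) over all choices
   of part sizes s n i = a_i n + O(1). *)
Definition is_lambda_blowup (R : realType) (p : problem R) (m : nat)
  (B : sgraph 'I_m) (a : 'rV[R]_m) (l : R) : Prop :=
  forall s : nat -> 'I_m -> nat,
    (exists K : R, forall n i, `|(s n i)%:R - a 0 i * n%:R| <= K) ->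
    (lambda p (sized_blowup B (s n)) @[n --> \oo] --> l)%classic.

Definition lambda_blowup (R : realType) (p : problem R) (m : nat)
  (B : sgraph 'I_m) (a : 'rV[R]_m) : R :=
  xget 0 [set l | is_lambda_blowup p B a l]%classic.

Definition maximisers (R : realType) (p : problem R) (m : nat)
  (B : sgraph 'I_m) : set 'rV[R]_m :=
  [set a | simplex a /\
    forall b, simplex b -> lambda_blowup p B b <= lambda_blowup p B a]%classic.

(* The vertex i : 'I_5 stands for the label i.+1. *)
Definition graphY : sgraph 'I_5 :=
  mkgraph (fun i j : 'I_5 =>
    (i.+1, j.+1) \in [:: (1, 2); (2, 3); (3, 4); (3, 5)]%N).

Definition C5 : sgraph 'I_5 := mkgraph (fun i j : 'I_5 => j == ordS i).

Definition inducibilityY (R : realType) : problem R :=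
  @Problem R (fun k => set0) 5 (fun H => (giso H graphY)%:R).

(* Main.v *)
(* Idea.  Count embeddings of Y with weights on the vertices.  A sum-of-squares
   (flag algebra) certificate on six vertices shows that every weighted graph of
   total weight 1 has embedding density at most 2/625, with a slack controlling
   - "bad" sextuples: an induced path a-b-c-d splits the other vertices into five
     parts by adjacency to the path, as in a C5 blow-up, and a pair x, y is bad
     if its adjacency is not the one prescribed by the blow-up of C5;
   - the deviation of the weighted degrees from 2/5.
   Applying this to the weights 1 + t at one vertex bounds the bad pairs at every
   single vertex of a near-extremal graph, not only on average.  Hence a large
   graph which is not a blow-up of C5 can be improved: replace it by the balanced
   blow-up if it has few copies of Y; clone a good vertex over one of low degree;
   otherwise some partition has small mismatch at every vertex, and correcting a
   single mismatched pair gains of order n^3 copies.  Each step gains at least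
   a constant times n^3 copies per edit, so iterating ends at a blow-up and
   yields perfect stability. *)
From Stdlib Require Import ZArith.
Require Import Defs.
From HB Require Import structures.
From mathcomp Require Import all_boot all_order all_fingroup all_algebra.
From mathcomp Require Import reals zify ssrZ ring lra.

Set Implicit Arguments.
Unset Strict Implicit.
Unset Printing Implicit Defensive.

Import Order.TTheory GRing.Theory Num.Theory.
(* The library binds %Z to [int]. *)
Local Delimit Scope Z_scope with ZZ.

(** * The certificate *)

(** The certificate is applied to all six-tuples, repetitions included: equal entries act as
    non-adjacent twins, so the pulled-back relation is again a graph on six vertices. Hence the
    weighted inequality is exact, with no lower-order error, for every nonnegative weight. On the
    five vertices of [C5] it bounds the blow-up polynomial; on a large graph it bounds the
    embeddings of Y.

    No blow-up of [C5], however unbalanced, has bad sextuples; balance comes from the degree term.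
    That term carries the fourth power of the weight of its vertex, so parts must first be bounded
    below.

    Raising one weight by t times the order works because, when the embedding count and the count at
    that vertex are extremal, both sides agree to first order in t. What remains is of order t^2,
    while the mismatches at the vertex enter with a factor t.

    A single path base is good only on average over the vertices, as it places each vertex by
    looking at four others. A misplaced vertex is placed again by comparison with a second base,
    chosen to be good at that vertex. *)

(* Found by semidefinite programming and rounding.  Each [mat_X] is the positive
   definite matrix of a quadratic form in the linear functionals [basis_X],
   which are indexed by the adjacency bits (see [bits]) of a vertex to four
   roots inducing an empty graph (T0), a single edge (T1) or a path of length
   two plus a vertex (T3), or of two vertices to an edge (E1).  The letters a
   and b mark blocks antisymmetric under automorphisms of the rooted graph. *)
Definition basis_T0 : seq (seq Z) :=
  [:: [:: 0; (-1); (-1); 0; (-1); 0; 0; 1; (-1); 0; 0; 1; 0; 1; 1; 0];  [::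
   (-4); 2; 2; 1; 2; 1; 1; 0; 2; 1; 1; 0; 1; 0; 0; 6]]%ZZ.

Definition mat_T0 : seq (seq Z) :=
  [:: [:: 452; 120]; [:: 120; 95]]%ZZ.

Definition basis_T1 : seq (seq Z) :=
  [:: [:: 0; 0; 0; 0; 1; 0; 0; 0; 1; 0; 0; 0; 0; 0; 0; 0];  [:: 0; 0; 0; 0; 0;
   0; 0; 0; 0; 0; 0; 0; 1; 0; 0; 0];  [:: (-2); 1; 1; 0; 0; 0; 0; 0; 0; 0; 0;
   0; 0; 0; 0; 0];  [:: 0; 0; 0; 0; 0; 1; 1; 0; 0; 1; 1; 0; 0; 0; 0; 0];  [::
   (-2); 0; 0; 0; 0; 0; 0; 0; 0; 0; 0; 0; 0; 1; 1; 0];  [:: 0; 0; 0; 1; 0; 0;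
   0; 0; 0; 0; 0; 0; 0; 0; 0; 0];  [:: 0; 0; 0; 0; 0; 0; 0; 1; 0; 0; 0; 1; 0;
   0; 0; 0];  [:: 0; 0; 0; 0; 0; 0; 0; 0; 0; 0; 0; 0; 0; 0; 0; 1]]%ZZ.

Definition mat_T1 : seq (seq Z) :=
  [:: [:: 25996; 38148; (-22784); (-4688); 25604; (-19456); (-46156); 18868];
   [:: 38148; 58500; (-35764); (-7288); 38744; (-28552); (-67180); 25888]; [::
   (-22784); (-35764); 22256; 4500; (-23540); 17028; 39860; (-14768)]; [::
   (-4688); (-7288); 4500; 976; (-4812); 3504; 8220; (-3092)]; [:: 25604;
   38744; (-23540); (-4812); 25860; (-19180); (-45240); 17760]; [:: (-19456);
   (-28552); 17028; 3504; (-19180); 14660; 34648; (-14208)]; [:: (-46156);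
   (-67180); 39860; 8220; (-45240); 34648; 82424; (-34152)]; [:: 18868; 25888;
   (-14768); (-3092); 17760; (-14208); (-34152); 15288]]%ZZ.

Definition basis_T1a : seq (seq Z) :=
  [:: [:: 0; 1; (-1); 0; 0; 0; 0; 0; 0; 0; 0; 0; 0; 0; 0; 0];  [:: 0; 0; 0; 0;
   0; 1; (-1); 0; 0; 1; (-1); 0; 0; 0; 0; 0];  [:: 0; 0; 0; 0; 0; 0; 0; 0; 0;
   0; 0; 0; 0; 1; (-1); 0]]%ZZ.

Definition mat_T1a : seq (seq Z) :=
  [:: [:: 288; 6976; 2384]; [:: 6976; 212316; 72576]; [:: 2384; 72576;
   24876]]%ZZ.

Definition basis_T1b : seq (seq Z) :=
  [:: [:: 0; 0; 0; 0; 1; 0; 0; 0; (-1); 0; 0; 0; 0; 0; 0; 0];  [:: 0; 0; 0; 0;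
   0; 1; 1; 0; 0; (-1); (-1); 0; 0; 0; 0; 0];  [:: 0; 0; 0; 0; 0; 0; 0; 1; 0;
   0; 0; (-1); 0; 0; 0; 0]]%ZZ.

Definition mat_T1b : seq (seq Z) :=
  [:: [:: 47260; 74544; 3212]; [:: 74544; 134056; 5072]; [:: 3212; 5072;
   280]]%ZZ.

Definition basis_T3 : seq (seq Z) :=
  [:: [:: 0; 0; 0; 0; 0; 0; 0; 0; 1; 0; 0; 0; 0; 0; 0; 0];  [:: 0; 0; 1; 0; 1;
   0; 0; 0; 0; 0; 0; 0; 0; 0; 0; 0];  [:: 0; 0; 0; 0; 0; 0; 0; 0; 0; 0; 1; 0;
   1; 0; 0; 0];  [:: (-1); 0; 0; 0; 0; 0; 1; 0; 0; 0; 0; 0; 0; 0; 0; 0];  [::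
   (-1); 0; 0; 0; 0; 0; 0; 0; 0; 0; 0; 0; 0; 0; 1; 0];  [:: (-1); 1; 0; 0; 0;
   0; 0; 0; 0; 0; 0; 0; 0; 0; 0; 0];  [:: (-1); 0; 0; 0; 0; 0; 0; 0; 0; 1; 0;
   0; 0; 0; 0; 0];  [:: 0; 0; 0; 1; 0; 1; 0; 0; 0; 0; 0; 0; 0; 0; 0; 0];  [::
   0; 0; 0; 0; 0; 0; 0; 0; 0; 0; 0; 1; 0; 1; 0; 0];  [:: 0; 0; 0; 0; 0; 0; 0;
   1; 0; 0; 0; 0; 0; 0; 0; 0];  [:: 0; 0; 0; 0; 0; 0; 0; 0; 0; 0; 0; 0; 0; 0;
   0; 1]]%ZZ.

Definition mat_T3 : seq (seq Z) :=
  [:: [:: 98112; 122432; (-78072); 62492; (-74180); (-111140); 35624;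
   (-53872); (-79148); (-63272); (-58656)]; [:: 122432; 240836; (-161436);
   93652; (-19240); (-150408); (-56948); (-111508); (-158004); (-41176);
   34532]; [:: (-78072); (-161436); 138672; 7444; (-37512); 76312; 9188;
   69648; 62756; 44112; (-32732)]; [:: 62492; 93652; 7444; 215688; (-168520);
   (-127836); (-45060); (-65560); (-161792); (-15936); (-17624)]; [::
   (-74180); (-19240); (-37512); (-168520); 259008; 121228; (-134184); 36032;
   76480; 118088; 129212]; [:: (-111140); (-150408); 76312; (-127836); 121228;
   145504; (-18068); 75916; 128180; 66984; 51508]; [:: 35624; (-56948); 9188;
   (-45060); (-134184); (-18068); 244888; 15036; 88716; (-157868); (-138176)];
   [:: (-53872); (-111508); 69648; (-65560); 36032; 75916; 15036; 60408;
   82204; 33192; (-23860)]; [:: (-79148); (-158004); 62756; (-161792); 76480;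
   128180; 88716; 82204; 166656; (-2120); (-24012)]; [:: (-63272); (-41176);
   44112; (-15936); 118088; 66984; (-157868); 33192; (-2120); 132936; 77716];
   [:: (-58656); 34532; (-32732); (-17624); 129212; 51508; (-138176);
   (-23860); (-24012); 77716; 167860]]%ZZ.

Definition basis_E1 : seq (seq Z) :=
  [:: [:: 0; 0; 0; 0; 0; 0; 0; 0; 0; 0; 0; 0; 0; 0; 0; 0; 1; 0; 0; 0; 0; 0; 0;
   0; 0; 0; 0; 0; 0; 0; 0; 0];  [:: (-4); 1; 1; 0; 1; 0; 0; 0; 1; 0; 0; 0; 0;
   0; 0; 0; 0; 0; 0; 0; 0; 0; 0; 0; 0; 0; 0; 0; 0; 0; 0; 0];  [:: (-4); 0; 0;
   0; 0; 0; 0; 0; 0; 0; 0; 0; 0; 0; 0; 0; 0; 1; 1; 0; 1; 0; 0; 0; 1; 0; 0; 0;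
   0; 0; 0; 0];  [:: 0; 0; 0; 1; 0; 0; 0; 0; 0; 0; 0; 0; 1; 0; 0; 0; 0; 0; 0;
   0; 0; 0; 0; 0; 0; 0; 0; 0; 0; 0; 0; 0];  [:: 0; 0; 0; 0; 0; 0; 0; 0; 0; 0;
   0; 0; 0; 0; 0; 0; 0; 0; 0; 1; 0; 0; 0; 0; 0; 0; 0; 0; 1; 0; 0; 0];  [::
   (-8); 0; 0; 0; 0; 1; 0; 0; 0; 0; 1; 0; 0; 0; 0; 0; 0; 0; 0; 0; 0; 0; 0; 0;
   0; 0; 0; 0; 0; 0; 0; 0];  [:: 0; 0; 0; 0; 0; 0; 0; 0; 0; 0; 0; 0; 0; 0; 0;
   0; 0; 0; 0; 0; 0; 1; 0; 0; 0; 0; 1; 0; 0; 0; 0; 0];  [:: (-2); 0; 0; 0; 0;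
   0; 1; 0; 0; 1; 0; 0; 0; 0; 0; 0; 0; 0; 0; 0; 0; 0; 0; 0; 0; 0; 0; 0; 0; 0;
   0; 0];  [:: (-6); 0; 0; 0; 0; 0; 0; 0; 0; 0; 0; 0; 0; 0; 0; 0; 0; 0; 0; 0;
   0; 0; 1; 0; 0; 1; 0; 0; 0; 0; 0; 0];  [:: 0; 0; 0; 0; 0; 0; 0; 1; 0; 0; 0;
   1; 0; 1; 1; 0; 0; 0; 0; 0; 0; 0; 0; 0; 0; 0; 0; 0; 0; 0; 0; 0];  [:: 0; 0;
   0; 0; 0; 0; 0; 0; 0; 0; 0; 0; 0; 0; 0; 0; 0; 0; 0; 0; 0; 0; 0; 1; 0; 0; 0;
   1; 0; 1; 1; 0];  [:: 0; 0; 0; 0; 0; 0; 0; 0; 0; 0; 0; 0; 0; 0; 0; 1; 0; 0;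
   0; 0; 0; 0; 0; 0; 0; 0; 0; 0; 0; 0; 0; 0];  [:: 0; 0; 0; 0; 0; 0; 0; 0; 0;
   0; 0; 0; 0; 0; 0; 0; 0; 0; 0; 0; 0; 0; 0; 0; 0; 0; 0; 0; 0; 0; 0; 1]]%ZZ.

Definition mat_E1 : seq (seq Z) :=
  [:: [:: 26008; 2524; (-21392); 3824; (-4204); 5100; 15232; (-20044); 12128;
   1956; 6932; (-2392); (-5968)]; [:: 2524; 4040; (-7496); 2388; 3260; 1384;
   2036; 200; 1076; 512; (-1732); (-2320); (-1100)]; [:: (-21392); (-7496);
   28092; (-7212); (-4244); (-5772); (-9712); 13968; (-10656); (-2700);
   (-1904); 10320; 5920]; [:: 3824; 2388; (-7212); 2220; 2428; 1356; 916;
   (-2048); 2092; 740; (-420); (-3856); (-1272)]; [:: (-4204); 3260; (-4244);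
   2428; 6588; 308; (-5344); 4828; (-1308); 584; (-3792); (-6656); 228]; [::
   5100; 1384; (-5772); 1356; 308; 1304; 2724; (-3491); 2448; 528; 756;
   (-1552); (-1324)]; [:: 15232; 2036; (-9712); 916; (-5344); 2724; 14324;
   (-10628); 5940; 300; 4172; 5924; (-3232)]; [:: (-20044); 200; 13968;
   (-2048); 4828; (-3491); (-10628); 16908; (-9612); (-1464); (-6672); 1836;
   4364]; [:: 12128; 1076; (-10656); 2092; (-1308); 2448; 5940; (-9612); 5992;
   1104; 3208; (-2756); (-2852)]; [:: 1956; 512; (-2700); 740; 584; 528; 300;
   (-1464); 1104; 388; 236; (-1664); (-556)]; [:: 6932; (-1732); (-1904);
   (-420); (-3792); 756; 4172; (-6672); 3208; 236; 3504; 1380; (-1228)]; [::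
   (-2392); (-2320); 10320; (-3856); (-6656); (-1552); 5924; 1836; (-2756);
   (-1664); 1380; 12584; 1352]; [:: (-5968); (-1100); 5920; (-1272); 228;
   (-1324); (-3232); 4364; (-2852); (-556); (-1228); 1352; 1528]]%ZZ.

Definition basis_E1a : seq (seq Z) :=
  [:: [:: 0; 1; (-1); 0; 1; 0; 0; 0; (-1); 0; 0; 0; 0; 0; 0; 0; 0; 0; 0; 0; 0;
   0; 0; 0; 0; 0; 0; 0; 0; 0; 0; 0];  [:: 0; 0; 0; 0; 0; 0; 0; 0; 0; 0; 0; 0;
   0; 0; 0; 0; 0; 1; (-1); 0; 1; 0; 0; 0; (-1); 0; 0; 0; 0; 0; 0; 0];  [:: 0;
   0; 0; 0; 0; 1; 0; 0; 0; 0; (-1); 0; 0; 0; 0; 0; 0; 0; 0; 0; 0; 0; 0; 0; 0;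
   0; 0; 0; 0; 0; 0; 0];  [:: 0; 0; 0; 0; 0; 0; 0; 0; 0; 0; 0; 0; 0; 0; 0; 0;
   0; 0; 0; 0; 0; 1; 0; 0; 0; 0; (-1); 0; 0; 0; 0; 0];  [:: 0; 0; 0; 0; 0; 0;
   0; 1; 0; 0; 0; (-1); 0; 1; (-1); 0; 0; 0; 0; 0; 0; 0; 0; 0; 0; 0; 0; 0; 0;
   0; 0; 0];  [:: 0; 0; 0; 0; 0; 0; 0; 0; 0; 0; 0; 0; 0; 0; 0; 0; 0; 0; 0; 0;
   0; 0; 0; 1; 0; 0; 0; (-1); 0; 1; (-1); 0]]%ZZ.

Definition mat_E1a : seq (seq Z) :=
  [:: [:: 33400; (-6060); (-12756); (-22208); 2724; (-896)]; [:: (-6060);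
   1880; 1872; 4696; (-532); 80]; [:: (-12756); 1872; 5608; 8156; (-168);
   108]; [:: (-22208); 4696; 8156; 15468; (-1696); 472]; [:: 2724; (-532);
   (-168); (-1696); 2140; (-696)]; [:: (-896); 80; 108; 472; (-696); 304]]%ZZ.

(* The 34 graphs on five vertices, as adjacency bits along [pairs5]. *)
Definition reps5 : seq (seq bool) :=
  [seq [seq (d == 1)%N | d <- s] | s <- [:: [:: 0; 0; 0; 0; 0; 0; 0; 0; 0; 0];
   [:: 1; 0; 0; 0; 0; 0; 0; 0; 0; 0]; [:: 1; 1; 0; 0; 0; 0; 0; 0; 0; 0]; [::
   1; 1; 1; 0; 0; 0; 0; 0; 0; 0]; [:: 1; 1; 1; 1; 0; 0; 0; 0; 0; 0]; [:: 1; 1;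
   0; 0; 1; 0; 0; 0; 0; 0]; [:: 0; 0; 1; 0; 1; 0; 0; 0; 0; 0]; [:: 1; 0; 1; 0;
   1; 0; 0; 0; 0; 0]; [:: 1; 1; 1; 0; 1; 0; 0; 0; 0; 0]; [:: 0; 0; 1; 1; 1; 0;
   0; 0; 0; 0]; [:: 1; 0; 1; 1; 1; 0; 0; 0; 0; 0]; [:: 1; 1; 1; 1; 1; 0; 0; 0;
   0; 0]; [:: 0; 1; 1; 0; 1; 1; 0; 0; 0; 0]; [:: 1; 1; 1; 0; 1; 1; 0; 0; 0;
   0]; [:: 0; 1; 0; 1; 1; 1; 0; 0; 0; 0]; [:: 1; 1; 0; 1; 1; 1; 0; 0; 0; 0];
   [:: 0; 1; 1; 1; 1; 1; 0; 0; 0; 0]; [:: 1; 1; 1; 1; 1; 1; 0; 0; 0; 0]; [::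
   0; 1; 1; 1; 1; 1; 1; 0; 0; 0]; [:: 1; 1; 1; 1; 1; 1; 1; 0; 0; 0]; [:: 1; 1;
   1; 0; 1; 1; 0; 1; 0; 0]; [:: 0; 0; 0; 1; 1; 1; 0; 1; 0; 0]; [:: 1; 0; 0; 1;
   1; 1; 0; 1; 0; 0]; [:: 1; 1; 0; 1; 1; 1; 0; 1; 0; 0]; [:: 1; 1; 1; 1; 1; 1;
   0; 1; 0; 0]; [:: 1; 1; 1; 1; 0; 0; 1; 1; 0; 0]; [:: 0; 0; 1; 1; 1; 0; 1; 1;
   0; 0]; [:: 1; 0; 1; 1; 1; 0; 1; 1; 0; 0]; [:: 1; 1; 1; 1; 1; 0; 1; 1; 0;
   0]; [:: 0; 1; 1; 1; 1; 1; 1; 1; 0; 0]; [:: 1; 1; 1; 1; 1; 1; 1; 1; 0; 0];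
   [:: 1; 1; 1; 1; 0; 1; 1; 1; 1; 0]; [:: 1; 1; 1; 1; 1; 1; 1; 1; 1; 0]; [::
   1; 1; 1; 1; 1; 1; 1; 1; 1; 1]]]%N.

Definition zsum (s : seq Z) : Z := foldr Z.add 0%ZZ s.

(** Entry [(f, g)] of the transpose of [B] times [Q] times [B]: the quadratic form seen as a
    function of two flags. *)
Definition gform (B Q : seq (seq Z)) (f g : nat) : Z :=
  zsum [seq (zsum [seq (qb.1 * nth 0 qb.2 g)%ZZ | qb <- zip rb.1 B] *
             nth 0 rb.2 f)%ZZ | rb <- zip Q B].

(** Little-endian: position [2 ^ k] of a basis vector belongs to the flag whose only true bit is the
    one with index [k]. *)
Fixpoint bits (s : seq bool) : nat := if s is b :: s' then b + (bits s').*2 else 0.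

(* Precomputed lookup tables, which make the evaluation of [slack] on all
   six-vertex graphs feasible. *)
Fixpoint tree (n : nat) : Type := if n is n'.+1 then (tree n' * tree n')%type else Z.

Fixpoint grow (n : nat) : (seq bool -> Z) -> tree n :=
  match n with
  | 0 => fun F => F [::]
  | n'.+1 => fun F => (grow n' (fun s => F (false :: s)), grow n' (fun s => F (true :: s)))
  end.

Fixpoint look (n : nat) (t : tree n) (s : seq bool) {struct s} : Z :=
  match s, n return tree n -> Z with
  | b :: s', n'.+1 => fun t => if b then look t.2 s' else look t.1 s'
  | _, 0 => fun t => t
  | _, _ => fun=> 0%ZZ
  end t.

(* The second basis vector appears once more as a separate square: at four
   coinciding roots it evaluates the deviation of a weighted degree. *)
Definition form0 (f g : nat) : Z := (gform basis_T0 mat_T0 f g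
  + nth 0 (nth [::] basis_T0 1) f * nth 0 (nth [::] basis_T0 1) g)%ZZ.
Definition form1 (f g : nat) : Z := (gform basis_T1 mat_T1 f g
  + gform basis_T1a mat_T1a f g + gform basis_T1b mat_T1b f g)%ZZ.
Definition form3 : nat -> nat -> Z := gform basis_T3 mat_T3.
Definition formE (f g : nat) : Z :=
  (gform basis_E1 mat_E1 f g + gform basis_E1a mat_E1a f g)%ZZ.

Definition table (n : nat) (F : nat -> nat -> Z) : tree (n + n) :=
  grow (n + n) (fun s => F (bits (take n s)) (bits (drop n s))).

Definition table0 := table 4 form0.
Definition table1 := table 4 form1.
Definition table3 := table 4 form3.
Definition tableE := table 5 formE.

Section Patterns.
Variables (T : Type) (e : T -> T -> bool).

Definition fork (a b c d f : T) : bool :=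
  [&& e a b, e b c, e c d, e c f, ~~ e a c, ~~ e a d, ~~ e a f, ~~ e b d,
      ~~ e b f & ~~ e d f].

Definition path4 (a b c d : T) : bool :=
  [&& e a b, e b c, e c d, ~~ e a c, ~~ e a d & ~~ e b d].

Definition ind4 (a b c d : T) : bool :=
  ~~ [|| e a b, e a c, e a d, e b c, e b d | e c d].
Definition edge4 (a b c d : T) : bool :=
  e a b && ~~ [|| e a c, e a d, e b c, e b d | e c d].
Definition cherry4 (a b c d : T) : bool :=
  [&& e a b, e a c & ~~ [|| e a d, e b c, e b d | e c d]].

Definition flag4 (a b c d x : T) : seq bool := [:: e a x; e b x; e c x; e d x].
Definition flag2 (a b x y : T) : seq bool :=
  [:: e a x; e b x; e a y; e b y; e x y].

(* The path a b c d occupies the parts 0, 1, 2, 3 of C5.  A vertex whose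
   adjacency to the path is impossible in a blow-up falls into part 0. *)
Definition part4 (a b c d x : T) : nat :=
  match flag4 a b c d x with
  | [:: true; false; true; false] => 1
  | [:: false; true; false; true] => 2
  | [:: false; false; true; false] => 3
  | [:: true; false; false; true] => 4
  | _ => 0
  end.

Definition adj5 (i j : nat) : bool :=
  match i, j with
  | 0, 1 | 1, 0 | 1, 2 | 2, 1 | 2, 3 | 3, 2 | 3, 4 | 4, 3 | 4, 0 | 0, 4 => true
  | _, _ => false
  end.

Definition bad (a b c d x y : T) : bool :=
  path4 a b c d && (e x y != adj5 (part4 a b c d x) (part4 a b c d y)).

(** The constants match the extremal density: 480000 * 2 / 625 = 1536. Nonnegativity is established
    only for the sum over all orderings of the six vertices. *)
Definition slack (a b c d x y : T) : Z :=
  (1536 - (if fork a b c d x then 480000 else 0)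
   - (if ind4 a b c d then
        form0 (bits (flag4 a b c d x)) (bits (flag4 a b c d y)) else 0)
   - (if edge4 a b c d then
        form1 (bits (flag4 a b c d x)) (bits (flag4 a b c d y)) else 0)
   - (if cherry4 a b c d then
        form3 (bits (flag4 a b c d x)) (bits (flag4 a b c d y)) else 0)
   - (if e a b then formE (bits (flag2 a b c d)) (bits (flag2 a b x y)) else 0)
   - (if bad a b c d x y then 1 else 0))%ZZ.

Definition slack_fast (a b c d x y : T) : Z :=
  if e a b then
    let u := look tableE [:: e a c, e b c, e a d, e b d, e c d & flag2 a b x y] in
    if e b d then (1536 - u)%ZZ else
    if e a d then (1536 - u)%ZZ else
    if e a c then
      if e b c then (1536 - u)%ZZ else if e c d then (1536 - u)%ZZ else
      (1536 - look table3 [:: e a x, e b x, e c x, e d x & flag4 a b c d y] - u)%ZZ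
    else if e b c then
      if e c d then
        let v := if bad a b c d x y then 1%ZZ else 0%ZZ in
        if fork a b c d x then (1536 - 480000 - u - v)%ZZ else (1536 - u - v)%ZZ
      else (1536 - u)%ZZ
    else if e c d then (1536 - u)%ZZ
    else (1536 - look table1 [:: e a x, e b x, e c x, e d x & flag4 a b c d y] - u)%ZZ
  else if ind4 a b c d then
    (1536 - look table0 [:: e a x, e b x, e c x, e d x & flag4 a b c d y])%ZZ
  else 1536%ZZ.

End Patterns.

Definition on6 (S T : Type) (F : T -> T -> T -> T -> T -> T -> S) (z : S) (s : seq T) : S :=
  if s is [:: a; b; c; d; x; y] then F a b c d x y else z.

(* The index 15 is out of range, so that the diagonal reads as [false]. *)
Definition edge_index (i j : nat) : nat :=
  nth 0 (nth [::] [:: [:: 15; 0; 1; 2; 3]; [:: 0; 15; 4; 5; 6];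
     [:: 1; 4; 15; 7; 8]; [:: 2; 5; 7; 15; 9]; [:: 3; 6; 8; 9; 15]] i) j.

(** With [q] of length five, the last diagonal entry is out of range and reads as [false]. *)
Definition ext_matrix (r q : seq bool) : seq (seq bool) :=
  rcons (mkseq (fun i => rcons (mkseq (fun j => nth false r (edge_index i j)) 5)
                         (nth false q i)) 5) q.

Definition pairs5 : seq (nat * nat) :=
  [:: (0, 1); (0, 2); (0, 3); (0, 4); (1, 2); (1, 3); (1, 4); (2, 3); (2, 4);
      (3, 4)].

Definition rel_of (M : seq (seq bool)) (i j : nat) : bool :=
  nth false (nth [::] M i) j.

Fixpoint bitseqs (n : nat) : seq (seq bool) :=
  if n is n'.+1 then [seq b :: s | b <- [:: false; true], s <- bitseqs n'] else [:: [::]].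

Lemma lookE (n : nat) (F : seq bool -> Z) (s : seq bool) :
  size s = n -> look (grow n F) s = F s.
Proof. by elim: s n F => [|b s IHs] [|n] F //= [/IHs E]; case: b; rewrite E. Qed.

Lemma tableP (n : nat) (F : nat -> nat -> Z) (s : seq bool) : size s = n + n ->
  look (table n F) s = F (bits (take n s)) (bits (drop n s)).
Proof. by move=> sn; rewrite lookE. Qed.

Lemma slack_fastE (T : Type) (e : T -> T -> bool) (a b c d x y : T) :
  slack_fast e a b c d x y = slack e a b c d x y.
Proof.
have E4 F : look (table 4 F) [:: e a x, e b x, e c x, e d x & flag4 e a b c d y]
   = F (bits (flag4 e a b c d x)) (bits (flag4 e a b c d y)) by rewrite tableP.
have E2 F : look (table 5 F)
    [:: e a c, e b c, e a d, e b d, e c d & flag2 e a b x y]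
   = F (bits (flag2 e a b c d)) (bits (flag2 e a b x y)) by rewrite tableP.
rewrite /slack_fast /slack !E4 !E2.
move: (formE _ _) (form3 _ _) (form1 _ _) (form0 _ _) => fE f3 f1 f0.
have : bad e a b c d x y ==> path4 e a b c d by apply/implyP => /andP[].
move: (bad _ _ _ _ _ _ _) 480000%ZZ 1536%ZZ => v k1 k0.
rewrite /fork /ind4 /edge4 /cherry4 /path4.
case: (e a b); case: (e a c); case: (e b c); case: (e a d); case: (e b d);
  case: (e c d); rewrite /= ?andbF ?implybF.
all: try (move=> /negbTE ->); rewrite ?Z.sub_0_r //.
by case: ifP; rewrite ?Z.sub_0_r.
Qed.

Definition slack_sum_fast (e : nat -> nat -> bool) : Z :=
  zsum [seq on6 (slack_fast e) 0%ZZ s | s <- permutations (iota 0 6)].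

(** A six-vertex graph is a five-vertex representative together with the adjacencies of one more
    vertex. This leaves 34 * 32 graphs, each with 720 orderings, and needs no list of the six-vertex
    graphs up to isomorphism. *)
Lemma slack_reps5 : all (fun r => all (fun q =>
    Z.leb 0 (slack_sum_fast (rel_of (ext_matrix r q)))) (bitseqs 5)) reps5.
Proof. by vm_cast_no_check (erefl true). Qed.

Definition relabel5 (m : seq bool) (l : seq nat) : seq bool :=
  [seq nth false m (edge_index (nth 0 l p.1) (nth 0 l p.2)) | p <- pairs5].

Lemma reps5_complete : all (fun m =>
  has (fun l => relabel5 m l \in reps5) (permutations (iota 0 5))) (bitseqs 10).
Proof. by vm_cast_no_check (erefl true). Qed.

Lemma mem_bitseqs (n : nat) (s : seq bool) : size s = n -> s \in bitseqs n.
Proof.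
elim: n s => [|n IHn] [|b s] // [/IHn sn].
by apply/allpairsPdep; exists b, s; split=> //; case: b.
Qed.

Lemma reps5P (m : seq bool) : size m = 10 ->
  exists2 l, l \in permutations (iota 0 5) & relabel5 m l \in reps5.
Proof. by move=> /mem_bitseqs mP; apply/hasP; apply: (allP reps5_complete). Qed.

Lemma slack_reps5P (r q : seq bool) : r \in reps5 -> size q = 5 ->
  Z.le 0 (slack_sum_fast (rel_of (ext_matrix r q))).
Proof.
move=> rP /mem_bitseqs qP; apply/Z.leb_le.
exact: (allP (allP slack_reps5 r rP) q qP).
Qed.

(** * Sums over the orderings of six vertices *)

Lemma perm_seqs_uniq (n : nat) :
  uniq [seq [seq val (p i) | i <- enum 'I_n] | p : 'S_n].
Proof.
rewrite map_inj_uniq ?enum_uniq // => p q /eq_in_map E.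
by apply/permP => i; apply: val_inj; rewrite /= E // mem_enum.
Qed.

Lemma perm_seqs (n : nat) (s : seq nat) :
  (s \in permutations (iota 0 n)) =
  (s \in [seq [seq val (p i) | i <- enum 'I_n] | p : 'S_n]).
Proof.
suff /(_ s)-> : permutations (iota 0 n)
    =i [seq [seq val (p i) | i <- enum 'I_n] | p : 'S_n] by [].
have U := perm_seqs_uniq n.
have S : {subset [seq [seq val (p i) | i <- enum 'I_n] | p : 'S_n]
    <= permutations (iota 0 n)}.
  move=> _ /mapP[p _ ->]; rewrite mem_permutations -val_enum_ord map_comp.
  apply: perm_map; apply: uniq_perm; rewrite ?enum_uniq //.
    by rewrite map_inj_uniq ?enum_uniq //; apply: perm_inj.
  move=> i; rewrite mem_enum; apply/mapP; exists (p^-1%g i).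
    by rewrite mem_enum.
  by rewrite permKV.
have [|_ E] := uniq_min_size U S.
  by rewrite size_map -cardT card_Sn size_permutations ?iota_uniq // size_iota.
by move=> x; rewrite E.
Qed.

Lemma sum_permutations (n : nat) (F : seq nat -> Z) :
  zsum [seq F s | s <- permutations (iota 0 n)] =
  (\sum_(p : 'S_n) F [seq val (p i) | i <- enum 'I_n])%R.
Proof.
have -> s : zsum s = (\sum_(x <- s) x)%R by elim: s => [|x s IHs];
  rewrite ?big_nil ?big_cons //= IHs.
rewrite big_map (perm_big [seq [seq val (p i) | i <- enum 'I_n] | p : 'S_n]).
  by rewrite /= big_map big_enum.
apply: uniq_perm; rewrite ?permutations_uniq ?perm_seqs_uniq //.
exact: perm_seqs.
Qed.

Definition slack_sym (T : Type) (e : T -> T -> bool) (x : 'I_6 -> T) : Z :=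
  (\sum_(p : 'S_6) on6 (slack e) 0%ZZ [seq x (p i) | i <- enum 'I_6])%R.

Lemma on6_map (S T U : Type) (F : T -> T -> T -> T -> T -> T -> S) (z : S)
    (h : U -> T) (s : seq U) :
  on6 F z (map h s) = on6 (fun a b c d x y => F (h a) (h b) (h c) (h d) (h x) (h y)) z s.
Proof. by case: s => [|? [|? [|? [|? [|? [|? [|? ?]]]]]]]. Qed.

Lemma eq_on6 (S T : Type) (F G : T -> T -> T -> T -> T -> T -> S) (z : S)
    (s : seq T) :
  (forall a b c d x y, F a b c d x y = G a b c d x y) -> on6 F z s = on6 G z s.
Proof. by case: s => [|? [|? [|? [|? [|? [|? [|? ?]]]]]]] // E; apply: E. Qed.

Lemma slack_sym_perm (T : Type) (e : T -> T -> bool) (x : 'I_6 -> T) (q : 'S_6) :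
  slack_sym e (x \o q) = slack_sym e x.
Proof.
rewrite /slack_sym [RHS](reindex_inj (mulIg q)) /=; apply: eq_bigr => p _.
by congr on6; apply: eq_map => i; rewrite /= permM.
Qed.

(** This replaces a tuple of vertices by its labels, even when some of the vertices coincide. *)
Lemma eq_slack (T U : Type) (e1 : T -> T -> bool) (e2 : U -> U -> bool)
   (x1 : 'I_6 -> T) (x2 : 'I_6 -> U) :
   (forall i j, e1 (x1 i) (x1 j) = e2 (x2 i) (x2 j)) ->
   slack_sym e1 x1 = slack_sym e2 x2.
Proof.
move=> E; apply: eq_bigr => p _.
rewrite -[LHS]/(on6 _ _ (map (x1 \o p) _)) -[RHS]/(on6 _ _ (map (x2 \o p) _)).
rewrite (map_comp x1 p) (map_comp x2 p) !on6_map.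
apply: eq_on6 => *.
rewrite /slack /fork /ind4 /edge4 /cherry4 /bad /path4 /part4 /flag4 /flag2.
by rewrite !E.
Qed.

Lemma slack_sum_sym (e : nat -> nat -> bool) :
  slack_sum_fast e = slack_sym e (fun i : 'I_6 => val i).
Proof.
rewrite /slack_sum_fast sum_permutations; apply: eq_bigr => p _.
by apply: eq_on6 => *; apply: slack_fastE.
Qed.

Lemma ext_matrixE (e : nat -> nat -> bool) (i j : 'I_6) :
  (forall i j, e i j = e j i) -> (forall i, e i i = false) ->
  rel_of (ext_matrix [seq e p.1 p.2 | p <- pairs5] [seq e k 5 | k <- iota 0 5]) i j
  = e i j.
Proof.
move=> sym irr; case: i j =>
  [[|[|[|[|[|[|i]]]]]] ilt] [[|[|[|[|[|[|j]]]]]] jlt] //;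
  by rewrite /rel_of /= ?irr // sym.
Qed.

Lemma slack_sym_ge0 (T : Type) (e : T -> T -> bool) (x : 'I_6 -> T) :
  (forall a b, e a b = e b a) -> (forall a, e a a = false) ->
  Z.le 0 (slack_sym e x).
Proof.
(* The graph on the labels: labels of the same vertex become non-adjacent twins, by
   irreflexivity. *)
move=> sym irr; pose f (i j : nat) := e (x (inord i)) (x (inord j)).
have fsym i j : f i j = f j i by apply: sym.
have firr i : f i i = false by apply: irr.
have [//|l lP rP] := @reps5P [seq f p.1 p.2 | p <- pairs5].
(* Keeping the sixth label last extends [l] to a permutation [q] of all six labels, and [slack_sym]
   does not change under [q]. *)
have : rcons l 5 \in permutations (iota 0 6).
  move: lP; rewrite !mem_permutations -cats1 => lP.
  by rewrite -[iota 0 6]/(iota 0 5 ++ [:: 5]) perm_cat2r.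
rewrite perm_seqs => /mapP[q _ lE].
have qE i : nth 0 (rcons l 5) i = if i < 6 then val (q (inord i)) else 0.
  rewrite lE; case: ifP => ilt; last first.
    by rewrite nth_default // size_map size_enum_ord leqNgt ilt.
  rewrite (nth_map (Ordinal ilt)) ?size_enum_ord //; congr (val (q _)).
  by apply: val_inj; rewrite /= nth_enum_ord // inordK.
pose g i j := f (nth 0 (rcons l 5) i) (nth 0 (rcons l 5) j).
have := @slack_reps5P _ [seq g k 5 | k <- iota 0 5] rP.
move=> /(_ erefl); rewrite slack_sum_sym.
have -> : relabel5 [seq f p.1 p.2 | p <- pairs5] l = [seq g p.1 p.2 | p <- pairs5].
  have lt5 i : i < 5 -> nth 0 (rcons l 5) i = nth 0 l i /\ nth 0 l i < 5.
    move=> i5; have lP' : perm_eq l (iota 0 5) by rewrite -mem_permutations.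
    have sl : size l = 5 by rewrite (perm_size lP').
    rewrite nth_rcons sl i5; split=> //.
    by have := @mem_nth _ 0 l i; rewrite sl (perm_mem lP') mem_iota => /(_ i5).
  have H a b : a < 5 -> b < 5 ->
    nth false [seq f p.1 p.2 | p <- pairs5] (edge_index a b) = f a b.
    by move: a b => [|[|[|[|[|a]]]]] [|[|[|[|[|b]]]]] //= _ _;
      rewrite ?firr // fsym.
  apply/eq_in_map => -[a b] abP /=; rewrite /g.
  have /andP[a5 b5] : (a < 5) && (b < 5).
    exact: (allP (isT : all (fun p => (p.1 < 5) && (p.2 < 5)) pairs5) _ abP).
  by rewrite (lt5 _ a5).1 (lt5 _ b5).1 H ?(lt5 _ a5).2 ?(lt5 _ b5).2.
rewrite -(slack_sym_perm e x q).
congr Z.le; apply: eq_slack => i j.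
rewrite ext_matrixE; last 2 first.
- by move=> *; apply: fsym.
- by move=> *; apply: firr.
by rewrite /g /f !qE !ltn_ord !inord_val.
Qed.

(** * The weighted inequality *)

Local Open Scope ring_scope.

Section ZR.
Variable R : realFieldType.

Definition zr (z : Z) : R := (int_of_Z z)%:~R.

Lemma zrD x y : zr (x + y)%ZZ = zr x + zr y.
Proof. by rewrite /zr -intrD -rmorphD. Qed.
Lemma zrM x y : zr (x * y)%ZZ = zr x * zr y.
Proof. by rewrite /zr -intrM -rmorphM. Qed.
Lemma zrB x y : zr (x - y)%ZZ = zr x - zr y.
Proof. by rewrite /zr -intrB -rmorphB. Qed.
Lemma zr0 : zr 0%ZZ = 0. Proof. by []. Qed.
Lemma zr_ge0 x : (0 <= x)%ZZ -> 0 <= zr x.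
Proof. by rewrite /zr ler0z; case: x. Qed.
Lemma zr_gt0 x : (0 < x)%ZZ -> 0 < zr x.
Proof. by rewrite /zr ltr0z; case: x => // p _; rewrite /= ltz_nat; lia. Qed.

Lemma zr_sum (I : finType) (F : I -> Z) : zr (\sum_i F i) = \sum_i zr (F i).
Proof. exact: (big_morph zr zrD zr0). Qed.

Definition dot (r : seq Z) (X : seq R) : R :=
  \sum_(p <- zip r X) zr p.1 * p.2.
Definition qf (M : seq (seq Z)) (X : seq R) : R :=
  \sum_(p <- zip M X) dot p.1 X * p.2.

(* Fraction-free elimination: the Schur complement of the pivot [a] is divided
   exactly by the previous pivot [p], so that all entries remain integral. *)
Definition schur_row (a p : Z) (r row : seq Z) : seq Z :=
  [seq ((a * q.1 - head 0 row * q.2) / p)%ZZ | q <- zip (behead row) r].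

Fixpoint psd (n : nat) (p : Z) (M : seq (seq Z)) : bool :=
  match n, M with
  | _, [::] => true
  | n'.+1, (a :: r) :: rows =>
    [&& Z.ltb 0 a, [seq head 0%ZZ row | row <- rows] == r,
        all (fun row => size row == (size rows).+1) rows,
        all (fun row => all (fun q => Z.eqb ((a * q.1 - head 0 row * q.2) mod p) 0)
           (zip (behead row) r)) rows &
        psd n' a [seq schur_row a p r row | row <- rows]]
  | _, _ => false
  end.

Lemma dot_cons a r x X : dot (a :: r) (x :: X) = zr a * x + dot r X.
Proof. by rewrite /dot /= big_cons. Qed.

Lemma dot_schur a p r row X : (0 < p)%ZZ -> size (behead row) = size r ->
  all (fun q => Z.eqb ((a * q.1 - head 0 row * q.2) mod p) 0)%ZZ
    (zip (behead row) r) ->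
  zr p * dot (schur_row a p r row) X =
  zr a * dot (behead row) X - zr (head 0%ZZ row) * dot r X.
Proof.
move=> p0; rewrite /schur_row; move: (head _ _) (behead row) => c {}row.
elim: row r X => [|x row IHrow] [|y r] X //=.
  by rewrite /dot; case: X => *; rewrite !big_nil !mulr0 subr0.
move=> [srow] /andP[/Z.eqb_eq xE rowE].
case: X => [|z X]; first by rewrite /dot !big_nil !mulr0 subr0.
rewrite !dot_cons mulrDr IHrow // mulrA -zrM.
have -> : (p * ((a * x - c * y) / p))%ZZ = (a * x - c * y)%ZZ.
  have := Z.div_mod (a * x - c * y)%ZZ p; rewrite xE; lia.
rewrite zrB !zrM; ring.
Qed.

Lemma sum_heads rows x X Y : all (fun row => 0 < size row)%N rows ->
  \sum_(q <- zip rows X) dot q.1 (x :: Y) * q.2 =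
  x * dot [seq head 0%ZZ row | row <- rows] X +
  \sum_(q <- zip rows X) dot (behead q.1) Y * q.2.
Proof.
elim: rows X => [|[|c row] rows IHrows] [|z X] //= rowsP;
  try by rewrite /dot !big_nil mulr0 addr0.
rewrite !big_cons IHrows // !dot_cons /=; ring.
Qed.

Lemma sum_schur a p r rows X Y : (0 < p)%ZZ ->
  all (fun row => size row == (size r).+1) rows ->
  all (fun row => all (fun q => Z.eqb ((a * q.1 - head 0 row * q.2) mod p) 0)%ZZ
           (zip (behead row) r)) rows ->
  zr p * (\sum_(q <- zip [seq schur_row a p r row | row <- rows] X)
             dot q.1 Y * q.2) =
  zr a * (\sum_(q <- zip rows X) dot (behead q.1) Y * q.2) -
  dot r Y * dot [seq head 0%ZZ row | row <- rows] X.
Proof.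
move=> p0; elim: rows X => [|row rows IHrows] [|z X] //=;
  try by rewrite /dot !big_nil !mulr0 subr0.
move=> /andP[/eqP srow rowsP] /andP[rowD rowsD].
rewrite !big_cons mulrDr IHrows // mulrA dot_schur ?size_behead ?srow //=.
rewrite dot_cons; ring.
Qed.

(** Completing the square in the first variable: the pivot [a] times the form is a square plus [p]
    times the form of the eliminated rows, whose previous pivot is now [a]. *)
Lemma psd_ge0 n p M X : (0 < p)%ZZ -> psd n p M -> 0 <= qf M X.
Proof.
elim: n p M X => [|n IHn] p [|[|a r] rows] X //= p0;
  try by rewrite /qf; case: X => *; rewrite big_nil.
case/and5P=> /Z.ltb_lt a0 /eqP rE sz dv /(IHn _ _ _ a0) psdM.
case: X => [|x X]; first by rewrite /qf big_nil.
have sr : size r = size rows by rewrite -rE size_map.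
rewrite -(pmulr_rge0 _ (zr_gt0 a0)).
have -> : qf ((a :: r) :: rows) (x :: X) = zr a * x ^+ 2 + dot r X * x *+ 2
    + \sum_(q <- zip rows X) dot (behead q.1) X * q.2.
  rewrite /qf /= big_cons dot_cons sum_heads; last first.
    by apply: sub_all sz => row /eqP->.
  rewrite rE /=; ring.
have /(_ p0) := @sum_schur a p r rows X X; rewrite sr rE => /(_ sz dv) E.
have -> : zr a * (zr a * x ^+ 2 + dot r X * x *+ 2 +
    \sum_(q <- zip rows X) dot (behead q.1) X * q.2) =
    (zr a * x + dot r X) ^+ 2 +
    zr p * qf [seq schur_row a p r row | row <- rows] X by rewrite /qf E; ring.
by rewrite addr_ge0 ?sqr_ge0 // mulr_ge0 ?psdM // ltW ?zr_gt0.
Qed.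

End ZR.

(** * Weighted sums over tuples *)

Section TupleSums.
Variables (R : realFieldType) (T : finType) (w : T -> R).

Definition weighted_sum (F : T -> R) : R := \sum_a w a * F a.

Local Notation wsum := weighted_sum.

Lemma eq_wsum F G : (forall a, F a = G a) -> wsum F = wsum G.
Proof. by move=> E; apply: eq_bigr => a _; rewrite E. Qed.

Lemma sum_tupleS (n : nat) (G : seq T -> R) :
  \sum_(t : n.+1.-tuple T) G t = \sum_a \sum_(t : n.-tuple T) G (a :: t).
Proof.
rewrite pair_big /= (reindex (fun p : T * n.-tuple T => cons_tuple p.1 p.2)) //=.
exists (fun t => (thead t, behead_tuple t)) => [[a t] _|t _] /=.
  by congr pair; apply: val_inj.
by case/tupleP: t => a t; apply: val_inj.
Qed.

Lemma sum_tuple0 (G : seq T -> R) : \sum_(t : 0.-tuple T) G t = G [::].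
Proof.
rewrite (big_pred1 [tuple]) // => t.
by rewrite (tuple0 t); apply/esym/eqP.
Qed.

Definition weighted_sum6 (F : T -> T -> T -> T -> T -> T -> R) : R :=
  wsum (fun a => wsum (fun b => wsum (fun c => wsum (fun d =>
  wsum (fun x => wsum (fun y => F a b c d x y)))))).

Definition wtuple (n : nat) (G : seq T -> R) : R :=
  \sum_(t : n.-tuple T) (\prod_(z <- t) w z) * G t.

Lemma wtupleS n G : wtuple n.+1 G = wsum (fun a => wtuple n (fun s => G (a :: s))).
Proof.
rewrite /wtuple (sum_tupleS _ (fun s => (\prod_(z <- s) w z) * G s)).
apply: eq_bigr => a _; rewrite mulr_sumr; apply: eq_bigr => t _.
by rewrite big_cons mulrA.
Qed.

Lemma wtuple0 G : wtuple 0 G = G [::].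
Proof.
rewrite /wtuple (sum_tuple0 (fun s => (\prod_(z <- s) w z) * G s)).
by rewrite big_nil mul1r.
Qed.

Lemma wtuple6 F : wtuple 6 (on6 F 0) = weighted_sum6 F.
Proof.
rewrite /weighted_sum6; do 6![rewrite wtupleS; apply: eq_wsum => ?].
exact: wtuple0.
Qed.

Lemma wtuple_perm (n : nat) (p : 'S_n) (G : seq T -> R) :
  \sum_(t : n.-tuple T)
     (\prod_(z <- t) w z) * G [seq tnth t (p i) | i <- enum 'I_n] = wtuple n G.
Proof.
pose f (t : n.-tuple T) := [tuple tnth t (p i) | i < n].
have f_inj : injective f.
  move=> t u E; apply: eq_from_tnth => i.
  by have := congr1 (fun v => tnth v (p^-1%g i)) E; rewrite !tnth_mktuple permKV.
rewrite /wtuple [RHS](reindex_inj f_inj) /=; apply: eq_bigr => t _.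
congr (_ * _); rewrite big_map big_enum /= big_tuple.
exact: (reindex_inj (@perm_inj _ p)).
Qed.

Variable e : T -> T -> bool.
Hypothesis esym : forall a b, e a b = e b a.
Hypothesis eirr : forall a, e a a = false.
Hypothesis w0 : forall a, 0 <= w a.

(** The product of the weights of a tuple ignores its order, so 6! times the sum equals the weighted
    sum of the symmetrised slack, which is nonnegative tuple by tuple. *)
Lemma wsum6_slack_ge0 : 0 <= weighted_sum6 (fun a b c d x y => zr R (slack e a b c d x y)).
Proof.
rewrite -wtuple6 -(pmulr_rge0 _ (ltr0n R 6`!)) mulr_natl -card_Sn.
set G := on6 _ _; rewrite -sumr_const.
under eq_bigr => p _ do rewrite -(wtuple_perm p G).
rewrite exchange_big /=; apply: sumr_ge0 => t _; rewrite -mulr_sumr.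
apply: mulr_ge0; first by apply: prodr_ge0 => *; apply: w0.
have := @slack_sym_ge0 _ e (tnth t) esym eirr => /(@zr_ge0 R).
rewrite /slack_sym zr_sum (eq_bigr (fun p : 'S_6 => G [seq tnth t (p i) | i <- enum 'I_6])) //.
move=> p _; rewrite /G; case: (map _ _) => [|? [|? [|? [|? [|? [|? [|? ?]]]]]]] //.
Qed.

End TupleSums.

Section Forms.
Variable R : realFieldType.
Local Notation zr := (zr R).

Lemma big_zip_mapr (S U V : Type) (s : seq S) (t : seq U) (h : U -> V)
    (F : S -> V -> R) :
  \sum_(p <- zip s (map h t)) F p.1 p.2 = \sum_(p <- zip s t) F p.1 (h p.2).
Proof.
elim: s t => [|x s IHs] [|y t] /=; rewrite ?big_nil //.
by rewrite !big_cons IHs.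
Qed.

Lemma zr_zsum (s : seq Z) : zr (zsum s) = \sum_(z <- s) zr z.
Proof. by elim: s => [|z s IHs]; rewrite ?big_nil // big_cons /= zrD IHs. Qed.

(** The double sum over flags factors through the weighted totals of the functionals in [B]; this is
    what makes positivity of [Q] applicable. *)
Lemma sum_form (I : finType) (u : I -> R) (f : I -> nat) (B Q : seq (seq Z)) :
  \sum_i u i * (\sum_j u j * zr (gform B Q (f i) (f j))) =
  qf Q [seq \sum_i u i * zr (nth 0%ZZ b (f i)) | b <- B].
Proof.
rewrite /qf (big_zip_mapr _ _ _ (fun r x => dot r _ * x)).
transitivity (\sum_i u i * \sum_(rb <- zip Q B)
    (\sum_(qb <- zip rb.1 B) zr qb.1 * \sum_j u j * zr (nth 0%ZZ qb.2 (f j))) *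
    zr (nth 0%ZZ rb.2 (f i))).
  apply: eq_bigr => i _; congr (_ * _).
  under eq_bigr do rewrite /gform zr_zsum big_map mulr_sumr.
  rewrite exchange_big /=; apply: eq_bigr => rb _.
  under eq_bigr do rewrite zrM zr_zsum big_map mulrA.
  rewrite -mulr_suml; congr (_ * _).
  under eq_bigr do rewrite mulr_sumr.
  rewrite exchange_big /=; apply: eq_bigr => qb _.
  by rewrite mulr_sumr; apply: eq_bigr => j _; rewrite zrM mulrCA.
under eq_bigr do rewrite mulr_sumr.
rewrite exchange_big /=; apply: eq_bigr => rb _.
rewrite /dot (big_zip_mapr _ _ _ (fun q x => zr q * x)) mulr_sumr.
by apply: eq_bigr => i _; rewrite mulrCA.
Qed.

Lemma sum_form_ge0 (I : finType) (u : I -> R) (f : I -> nat) (B Q : seq (seq Z)) :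
  psd (size Q) 1%ZZ Q ->
  0 <= \sum_i u i * (\sum_j u j * zr (gform B Q (f i) (f j))).
Proof. by rewrite sum_form; apply: psd_ge0. Qed.

End Forms.

(** * From the quadratic forms to the weighted inequality *)

Section MainInequality.
Variables (R : realFieldType) (T : finType) (w : T -> R).
Local Notation zr := (zr R).
Local Notation wsum := (weighted_sum w).
Local Notation wsum6 := (weighted_sum6 w).
Hypothesis w0 : forall a, 0 <= w a.

Lemma wsumD F G : wsum (fun a => F a + G a) = wsum F + wsum G.
Proof. by rewrite /weighted_sum -big_split; apply: eq_bigr => a _; rewrite mulrDr. Qed.

Lemma wsumB F G : wsum (fun a => F a - G a) = wsum F - wsum G.
Proof. by rewrite /weighted_sum -sumrB; apply: eq_bigr => a _; rewrite mulrBr. Qed.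

Lemma wsumZ k F : wsum (fun a => k * F a) = k * wsum F.
Proof. by rewrite /weighted_sum mulr_sumr; apply: eq_bigr => a _; rewrite mulrCA. Qed.

Lemma wsum_ge0 F : (forall a, 0 <= F a) -> 0 <= wsum F.
Proof. by move=> F0; apply: sumr_ge0 => a _; rewrite mulr_ge0. Qed.

Lemma wsum_cst k : wsum (fun=> k) = (\sum_a w a) * k.
Proof. by rewrite /weighted_sum mulr_suml. Qed.

Lemma wsum6B F G : wsum6 (fun a b c d x y => F a b c d x y - G a b c d x y) =
  wsum6 F - wsum6 G.
Proof. by rewrite /weighted_sum6; do 6![rewrite -wsumB; apply: eq_wsum => ?]. Qed.

Lemma eq_wsum6 F G : (forall a b c d x y, F a b c d x y = G a b c d x y) ->
  wsum6 F = wsum6 G.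
Proof. by move=> E; do 6![apply: eq_wsum => ?]; apply: E. Qed.

Lemma wsum2E F : wsum (fun c => wsum (fun d => F c d)) =
  \sum_p (w p.1 * w p.2) * F p.1 p.2.
Proof.
rewrite /weighted_sum; under eq_bigr do rewrite mulr_sumr.
by rewrite pair_big; apply: eq_bigr => -[c d] _; rewrite mulrA.
Qed.

Lemma wsum_form_ge0 (f : T -> nat) B Q : psd (size Q) 1%ZZ Q ->
  0 <= wsum (fun x => wsum (fun y => zr (gform B Q (f x) (f y)))).
Proof. exact: sum_form_ge0. Qed.

Lemma wsum2_form_ge0 (f : T -> T -> nat) B Q : psd (size Q) 1%ZZ Q ->
  0 <= wsum (fun c => wsum (fun d => wsum (fun x => wsum (fun y =>
    zr (gform B Q (f c d) (f x y)))))).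
Proof.
move=> psdQ; have := @sum_form_ge0 R (T * T)%type (fun p => w p.1 * w p.2)
  (fun p => f p.1 p.2) B Q psdQ; rewrite wsum2E.
by under [X in _ -> 0 <= X]eq_bigr do rewrite wsum2E.
Qed.

Variable e : T -> T -> bool.
Hypothesis esym : forall a b, e a b = e b a.
Hypothesis eirr : forall a, e a a = false.

Definition forks : R := wsum (fun a => wsum (fun b => wsum (fun c =>
  wsum (fun d => wsum (fun f => (fork e a b c d f)%:R))))).
Definition bads : R := wsum6 (fun a b c d x y => (bad e a b c d x y)%:R).
Definition wdeg (i : T) : R := \sum_(x | e i x) w x.

Lemma psdT0 : psd (size mat_T0) 1%ZZ mat_T0. Proof. by vm_compute. Qed.
Lemma psdT1 : psd (size mat_T1) 1%ZZ mat_T1. Proof. by vm_compute. Qed.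
Lemma psdT1a : psd (size mat_T1a) 1%ZZ mat_T1a. Proof. by vm_compute. Qed.
Lemma psdT1b : psd (size mat_T1b) 1%ZZ mat_T1b. Proof. by vm_compute. Qed.
Lemma psdT3 : psd (size mat_T3) 1%ZZ mat_T3. Proof. by vm_compute. Qed.
Lemma psdE1 : psd (size mat_E1) 1%ZZ mat_E1. Proof. by vm_compute. Qed.
Lemma psdE1a : psd (size mat_E1a) 1%ZZ mat_E1a. Proof. by vm_compute. Qed.

(** Over a rooted edge the flags have two further vertices, so for fixed [a], [b] the remaining sum
    is a quadratic form indexed by pairs of vertices. *)
Lemma edges_ge0 : 0 <= wsum6 (fun a b c d x y => zr
  (if e a b then formE (bits (flag2 e a b c d)) (bits (flag2 e a b x y)) else 0)).
Proof.
apply: wsum_ge0 => a; apply: wsum_ge0 => b; case: (e a b); last first.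
  by do 4![apply: wsum_ge0 => ?].
pose f c d := bits (flag2 e a b c d).
have -> : wsum (fun c => wsum (fun d => wsum (fun x => wsum (fun y => zr
    (formE (f c d) (f x y)))))) =
  wsum (fun c => wsum (fun d => wsum (fun x => wsum (fun y =>
    zr (gform basis_E1 mat_E1 (f c d) (f x y)))))) +
  wsum (fun c => wsum (fun d => wsum (fun x => wsum (fun y =>
    zr (gform basis_E1a mat_E1a (f c d) (f x y)))))).
  by do 4![rewrite -wsumD; apply: eq_wsum => ?]; rewrite zrD.
by rewrite addr_ge0 // wsum2_form_ge0 ?psdE1 ?psdE1a.
Qed.

Lemma edge4_ge0 : 0 <= wsum6 (fun a b c d x y => zr (if edge4 e a b c d then
  form1 (bits (flag4 e a b c d x)) (bits (flag4 e a b c d y)) else 0)).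
Proof.
do 4![apply: wsum_ge0 => ?]; case: edge4; last by do 2![apply: wsum_ge0 => ?].
have E f g : zr (form1 f g) = zr (gform basis_T1 mat_T1 f g) +
    zr (gform basis_T1a mat_T1a f g) + zr (gform basis_T1b mat_T1b f g).
  by rewrite /form1 zrD (zrD _ (gform basis_T1 _ _ _)).
under eq_wsum => x do under eq_wsum => y do rewrite E.
under eq_wsum do rewrite !wsumD.
rewrite !wsumD; apply: addr_ge0; first apply: addr_ge0.
- exact: wsum_form_ge0 psdT1.
- exact: wsum_form_ge0 psdT1a.
- exact: wsum_form_ge0 psdT1b.
Qed.

Lemma cherry4_ge0 : 0 <= wsum6 (fun a b c d x y => zr (if cherry4 e a b c d then
  form3 (bits (flag4 e a b c d x)) (bits (flag4 e a b c d y)) else 0)).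
Proof.
do 4![apply: wsum_ge0 => ?]; case: cherry4; last by do 2![apply: wsum_ge0 => ?].
exact: wsum_form_ge0 psdT3.
Qed.

Lemma wsum_ge_term F i : (forall a, 0 <= F a) -> w i * F i <= wsum F.
Proof.
move=> F0; rewrite /weighted_sum (bigD1 i) //= lerDl sumr_ge0 // => a _.
by rewrite mulr_ge0.
Qed.

(** All terms are nonnegative, and only the one with all four roots equal to [i] is kept. Every flag
    is then all [true] or all [false], where the second basis vector takes the values 6 and -4; its
    total is 6 times the degree minus 4 times the weight of the non-neighbours. *)
Lemma ind4_ge i : w i ^+ 4 * (10 * wdeg i - 4 * \sum_a w a) ^+ 2 <=
  wsum6 (fun a b c d x y => zr (if ind4 e a b c d then
    form0 (bits (flag4 e a b c d x)) (bits (flag4 e a b c d y)) else 0)).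
Proof.
pose v a b c d x := zr (nth 0 (nth [::] basis_T0 1) (bits (flag4 e a b c d x)))%ZZ.
have form0E a b c d : wsum (fun x => wsum (fun y => zr
    (form0 (bits (flag4 e a b c d x)) (bits (flag4 e a b c d y))))) =
  wsum (fun x => wsum (fun y => zr (gform basis_T0 mat_T0
    (bits (flag4 e a b c d x)) (bits (flag4 e a b c d y))))) +
  wsum (v a b c d) ^+ 2.
  rewrite expr2 {1}/weighted_sum mulr_suml -[X in _ + X]/(\sum_i _).
  rewrite -[X in _ + X](eq_bigr _ (fun x _ => mulrA _ _ _)) -/(weighted_sum w _) -wsumD.
  apply: eq_wsum => x; rewrite -wsumZ -wsumD; apply: eq_wsum => y.
  by rewrite /form0 zrD zrM.
have F0 a b c d : 0 <= wsum (fun x => wsum (fun y => zr (if ind4 e a b c d then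
    form0 (bits (flag4 e a b c d x)) (bits (flag4 e a b c d y)) else 0))).
  case: ind4; last by do 2![apply: wsum_ge0 => ?].
  by rewrite form0E addr_ge0 ?sqr_ge0 // wsum_form_ge0 ?psdT0.
set Q := (_ - _) ^+ 2.
have -> : w i ^+ 4 * Q = w i * (w i * (w i * (w i * Q))) by ring.
do 4![apply: le_trans (wsum_ge_term i _);
  [apply: ler_wpM2l => // | by move=> ?; do ?[apply: F0 | apply: wsum_ge0 => ?]]].
have -> : ind4 e i i i i by rewrite /ind4 !eirr.
rewrite form0E /Q; suff <- : wsum (v i i i i) = 10 * wdeg i - 4 * \sum_a w a.
  by rewrite lerDr; apply: wsum_form_ge0 psdT0.
rewrite /weighted_sum /wdeg (big_mkcond (e i)) /= !mulr_sumr -sumrB.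
apply: eq_bigr => x _.
have -> : v i i i i x = if e i x then 6%:R else - 4%:R.
  by rewrite /v /flag4; case: (e i x).
case: (e i x); ring.
Qed.

(** The factor in front of [forks] contains the total weight because a fork leaves the sixth vertex
    free. The forms for edges, rooted edges and rooted cherries are dropped as nonnegative; the form
    at independent roots yields the degree term. *)
Lemma main_inequality i :
  480%:R * 1000%:R * (\sum_a w a) * forks + bads +
    w i ^+ 4 * (10 * wdeg i - 4 * \sum_a w a) ^+ 2 <=
  1536%:R * (\sum_a w a) ^+ 6.
Proof.
have := @wsum6_slack_ge0 R T w e esym eirr w0; rewrite /slack.
under eq_wsum6 do rewrite !zrB.
rewrite !wsum6B => H.
have K1 : wsum6 (fun _ _ _ _ _ _ => zr 1536%ZZ) = 1536%:R * (\sum_a w a) ^+ 6.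
  rewrite /weighted_sum6 !wsum_cst; have -> : zr 1536%ZZ = 1536%:R by []; ring.
have K2 : wsum6 (fun a b c d x y => zr (if fork e a b c d x then 480000 else 0)%ZZ)
    = 480%:R * 1000%:R * (\sum_a w a) * forks.
  rewrite -mulrA -[X in _ = _ * X]/(_ * forks) /forks.
  rewrite -(wsumZ (\sum_a w a)) -wsumZ; apply: eq_wsum => a.
  do 4![rewrite -!wsumZ; apply: eq_wsum => ?].
  rewrite wsum_cst; case: fork; last by rewrite zr0 !mulr0.
  by rewrite -[480000%ZZ]/(480 * 1000)%ZZ zrM !mulr1 mulrC.
have K3 : wsum6 (fun a b c d x y => zr (if bad e a b c d x y then 1 else 0)%ZZ)
    = bads by apply: eq_wsum6 => *; case: bad.
have := ind4_ge i; have := edges_ge0; have := edge4_ge0; have := cherry4_ge0.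
move: H; rewrite K1 K2 K3.
lra.
Qed.

End MainInequality.

(** * Embeddings of Y *)

Definition adjY (i j : nat) : bool :=
  match i, j with
  | 0, 1 | 1, 0 | 1, 2 | 2, 1 | 2, 3 | 3, 2 | 2, 4 | 4, 2 => true
  | _, _ => false
  end%N.

Lemma graphYE (i j : 'I_5) : adj graphY i j = adjY i j.
Proof.
rewrite mkgraphE; case: i j => [[|[|[|[|[|i]]]]] ilt] [[|[|[|[|[|j]]]]] jlt] //.
Qed.

Lemma C5E (i j : 'I_5) : adj C5 i j = adj5 i j.
Proof.
rewrite mkgraphE; case: i j => [[|[|[|[|[|i]]]]] ilt] [[|[|[|[|[|j]]]]] jlt] //.
Qed.

Section Embeddings.
Variables (T : finType) (e : rel T).
Hypothesis esym : forall a b, e a b = e b a.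
Hypothesis eirr : forall a, e a a = false.

Definition patternY (x : {ffun 'I_5 -> T}) : bool :=
  [forall i, forall j, e (x i) (x j) == adjY (val i) (val j)].

Definition embY : {set {ffun 'I_5 -> T}} :=
  [set x : {ffun 'I_5 -> T} | injectiveb x && patternY x].

Lemma patternY_fork (x : {ffun 'I_5 -> T}) : patternY x =
  fork e (x (inord 0)) (x (inord 1)) (x (inord 2)) (x (inord 3)) (x (inord 4)).
Proof.
apply/'forall_forallP/idP => [H|].
  have {}H i j : (i < 5)%N -> (j < 5)%N ->
      e (x (inord i)) (x (inord j)) = adjY i j.
    by move=> i5 j5; rewrite (eqP (H _ _)) /= !inordK.
  by rewrite /fork !H.
rewrite /fork; do 9![case/andP=> ?]; move=> ? i j.
rewrite -(inord_val i) -(inord_val j).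
case: i j => [[|[|[|[|[|i]]]]] ilt] [[|[|[|[|[|j]]]]] jlt] //=; rewrite !inordK //.
all: rewrite ?eirr //.
all: first [by apply/eqP | by apply/eqP/negbTE | by rewrite esym; apply/eqP
           | by rewrite esym; apply/eqP/negbTE].
Qed.

(** The two leaves 3 and 4 are the only vertices of Y with the same neighbourhood, hence the only
    ones that such a map can identify. *)
Lemma patternY_inj (x : {ffun 'I_5 -> T}) : patternY x ->
  injectiveb x = (x (inord 3) != x (inord 4)).
Proof.
move=> H; apply/injectiveP/idP => [xI|x34].
  by apply/negP => /eqP/xI/(congr1 val); rewrite /= !inordK.
have {}H i j : e (x i) (x j) = adjY i j by move/'forall_forallP: H => /(_ i j)/eqP.
move=> i j xij.
have E k : (k < 5)%N -> adjY i k = adjY j k.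
  by move=> k5; rewrite -(inordK k5) -!H xij.
have : [|| val i == val j, (val i == 3) && (val j == 4) |
           (val i == 4) && (val j == 3)]%N.
  move: (E 0%N isT) (E 1%N isT) (E 3%N isT) (ltn_ord i) (ltn_ord j); rewrite /=.
  by case: (nat_of_ord i) (nat_of_ord j) => [|[|[|[|[|?]]]]] [|[|[|[|[|?]]]]].
have inE (k : 'I_5) m : val k = m -> inord m = k by move<-; apply: inord_val.
case/or3P=> [/eqP/val_inj//|/andP[/eqP/inE i3 /eqP/inE j4]|/andP[/eqP/inE i4 /eqP/inE j3]];
  by case/eqP: x34; rewrite ?i3 ?i4 ?j3 ?j4.
Qed.

End Embeddings.

Section WeightedEmbeddings.
Variables (R : realFieldType) (T : finType) (w : T -> R).
Local Notation wsum := (weighted_sum w).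

Lemma sum_ffun5 (H : T -> T -> T -> T -> T -> R) :
  \sum_(x : {ffun 'I_5 -> T}) (\prod_i w (x i)) *
    H (x (inord 0)) (x (inord 1)) (x (inord 2)) (x (inord 3)) (x (inord 4)) =
  wsum (fun a => wsum (fun b => wsum (fun c => wsum (fun d => wsum (fun f =>
    H a b c d f))))).
Proof.
pose G (s : seq T) := if s is [:: a; b; c; d; f] then H a b c d f else 0.
transitivity (wtuple w 5 G); last first.
  by do 5![rewrite wtupleS; apply: eq_wsum => ?]; rewrite wtuple0.
rewrite /wtuple (reindex (fun t : 5.-tuple T => [ffun i => tnth t i])) /=.
  apply: eq_bigr => t _; rewrite big_tuple; congr (_ * _).
    by apply: eq_bigr => i _; rewrite ffunE.
  rewrite !ffunE; case/tupleP: t => a t; case/tupleP: t => b t.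
  case/tupleP: t => c t; case/tupleP: t => d t; case/tupleP: t => f t.
  by rewrite (tuple0 t) !(tnth_nth a) /= !inordK.
exists (fun x : {ffun 'I_5 -> T} => [tuple x i | i < 5]) => [t _|x _].
  by apply: eq_from_tnth => i; rewrite tnth_mktuple ffunE.
by apply/ffunP => i; rewrite ffunE tnth_mktuple.
Qed.

Variable e : rel T.
Hypothesis esym : forall a b, e a b = e b a.
Hypothesis eirr : forall a, e a a = false.

Lemma forksE : forks w e =
  \sum_(x : {ffun 'I_5 -> T} | patternY e x) \prod_i w (x i).
Proof.
rewrite /forks -sum_ffun5 [RHS]big_mkcond; apply: eq_bigr => x _.
by rewrite patternY_fork //; case: fork; rewrite ?mulr1 ?mulr0.
Qed.

Lemma prodr_ge1 (I : finType) (P : pred I) (F : I -> R) :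
  (forall i, 1 <= F i) -> 1 <= \prod_(i | P i) F i.
Proof.
move=> F1; apply: (big_ind (fun x => 1 <= x)) => // x y; exact: mulr_ege1.
Qed.

(** An embedding through [v] has weight at least 1 + s and any other at least 1; patterns that are
    not injective only add to the sum. *)
Lemma forks_ge (s : R) (v : T) : 0 <= s -> (forall a, w a = 1 + s *+ (a == v)) ->
  #|embY e|%:R + s * #|[set x in embY e | v \in codom x]|%:R <= forks w e.
Proof.
move=> s0 wE; have w1 a : 1 <= w a by rewrite wE lerDl mulrn_wge0.
rewrite forksE.
apply: (@le_trans _ _ (\sum_(x in embY e) (1 + s *+ (v \in codom x)))).
  rewrite big_split /= sumr_const lerD2l -sum1_card natr_sum mulr_sumr.
  rewrite big_mkcond [leRHS]big_mkcond; apply: ler_sum => x _ /=.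
  rewrite inE; case: (x \in embY e) => //=.
  by case: (_ \in _); rewrite ?mulr1.
rewrite big_mkcond [leRHS]big_mkcond; apply: ler_sum => x _ /=.
rewrite inE; case: patternY => /=; rewrite ?andbF //; last first.
case: ifP => // _; last by apply: prodr_ge0 => i _; rewrite (le_trans ler01).
case: (boolP (v \in codom x)) => [/codomP[i vE]|_]; last first.
  by rewrite addr0; apply: prodr_ge1.
rewrite (bigD1 i) //= -vE wE eqxx ler_peMr ?addr_ge0 //.
by apply: prodr_ge1.
Qed.

(** The excess consists of the patterns that identify the two leaves, and such a pattern is
    determined by its first four values. *)
Lemma forks1_le : (forall a, w a = 1) ->
  (#|embY e|%:R <= forks w e) /\ (forks w e <= #|embY e|%:R + #|T|%:R ^+ 4).
Proof.
move=> w1; rewrite forksE.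
have E (P : pred {ffun 'I_5 -> T}) :
  \sum_(x : {ffun 'I_5 -> T} | P x) \prod_i w (x i) = #|[set x | P x]|%:R.
  rewrite -sum1_card natr_sum; apply: eq_big => x; rewrite ?inE // => _.
  by rewrite big1.
rewrite E -natrX -natrD !ler_nat; split.
  by apply: subset_leq_card; apply/subsetP => x; rewrite !inE => /andP[].
rewrite -leq_subLR -(cardsDS (B := embY e)); last first.
  by apply/subsetP => x; rewrite !inE => /andP[].
have -> : (#|T| ^ 4)%N = #|{ffun 'I_4 -> T}| by rewrite card_ffun card_ord.
pose h (x : {ffun 'I_5 -> T}) : {ffun 'I_4 -> T} :=
  [ffun i : 'I_4 => x (widen_ord (leqnSn 4) i)].
rewrite -(card_in_imset (f := h)); first exact: max_card.
move=> x y; rewrite !inE => /andP[+ xP] /andP[+ yP].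
rewrite xP yP !andbT => xI yI.
move: xI yI; rewrite (patternY_inj xP) (patternY_inj yP) !negbK => /eqP xI /eqP yI E4.
have Ek (k : 'I_5) : (k < 4)%N -> x k = y k.
  move=> k4; have := congr1 (fun g : {ffun 'I_4 -> T} => g (Ordinal k4)) E4.
  by rewrite !ffunE (_ : widen_ord _ _ = k) //; apply: val_inj.
apply/ffunP => k; case: (ltnP k 4) => [/Ek//|k4].
have -> : k = inord 4 by apply: val_inj; rewrite /= inordK //; apply/eqP;
  rewrite eqn_leq k4 -ltnS ltn_ord.
by rewrite -xI -yI Ek // inordK.
Qed.

End WeightedEmbeddings.

Lemma adj_sym (T : finType) (G : sgraph T) a b : adj G a b = adj G b a.
Proof. by rewrite /adj finset.setUC. Qed.

Lemma adj_irr (T : finType) (G : sgraph T) a : adj G a a = false.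
Proof.
apply/negP => aE; have /fintype.subsetP/(_ _ aE) := edges_card2 G.
by rewrite inE finset.setUid cards1.
Qed.

(** Exchanging the two leaves is the only nontrivial symmetry of Y, which gives the factor 2 between
    embeddings and induced copies. *)
Lemma automorphisms_Y : all (fun s => all (fun i => all (fun j =>
    adjY (nth 0 s i) (nth 0 s j) == adjY i j) (iota 0 5)) (iota 0 5) ==>
    (s \in [:: [:: 0; 1; 2; 3; 4]; [:: 0; 1; 2; 4; 3]]))%N
  (permutations (iota 0 5)).
Proof. by vm_compute. Qed.

Lemma perm_automorphism_Y (s : 'S_5) :
  (forall i j : 'I_5, adjY (s i) (s j) = adjY i j) ->
  (s == 1%g) || (s == tperm (inord 3) (inord 4)).
Proof.
move=> sY; set l := [seq val (s i) | i <- enum 'I_5].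
have lP : l \in permutations (iota 0 5).
  by rewrite perm_seqs; apply/mapP; exists s; rewrite ?mem_enum.
have nE (i : 'I_5) : nth 0%N l i = val (s i).
  by rewrite (nth_map i) ?size_enum_ord // nth_ord_enum.
have : all (fun i => all (fun j =>
    adjY (nth 0 l i) (nth 0 l j) == adjY i j) (iota 0 5)) (iota 0 5).
  apply/allP => i; rewrite mem_iota => i5; apply/allP => j; rewrite mem_iota => j5.
  have := sY (Ordinal i5) (Ordinal j5).
  by rewrite -[nat_of_ord (s _)]nE -[nat_of_ord (s (Ordinal j5))]nE => ->.
move=> /(implyP (allP automorphisms_Y l lP)).
rewrite !inE => /orP[] /eqP lE; apply/orP; [left|right]; apply/eqP/permP => i;
  apply: val_inj; rewrite -nE lE ?perm1; first by case: i => [[|[|[|[|[|i]]]]] ?].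
case: tpermP => [->|->|]; rewrite /= ?inordK //.
move/eqP; rewrite -val_eqE /= inordK // => i3 /eqP; rewrite -val_eqE /= inordK //.
by case: i i3 => [[|[|[|[|[|i]]]]] ?].
Qed.

(** * Embeddings versus induced copies *)

Section Copies.
Variables (T : finType) (G : sgraph T).

Lemma induces_copyP (U : finType) (F : sgraph U) (X : {set T}) :
  reflect (exists f : {ffun U -> T}, [/\ injective f, f @: [set: U] = X &
             forall u v, adj G (f u) (f v) = adj F u v])
    (induces_copy F G X).
Proof.
apply: (iffP existsP) => [] [f].
  case/and3P=> /injectiveP fI /eqP fX /'forall_forallP fA.
  by exists f; split=> // u v; apply/eqP.
case=> fI fX fA; exists f; apply/and3P; split; first exact/injectiveP.
  exact/eqP.
by apply/'forall_forallP => u v; apply/eqP.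
Qed.

Lemma card_embY : #|embY (adj G)| = (2 * ncopies graphY G)%N.
Proof.
pose f (x : {ffun 'I_5 -> T}) := x @: [set: 'I_5].
have embP (x : {ffun 'I_5 -> T}) : reflect (injective x /\
    forall i j, adj G (x i) (x j) = adj graphY i j) (x \in embY (adj G)).
  rewrite inE; apply: (iffP andP) => [[/injectiveP xI /'forall_forallP xA]|[xI xA]].
    by split=> // i j; rewrite (eqP (xA i j)) graphYE.
  split; first exact/injectiveP.
  by apply/'forall_forallP => i j; rewrite xA graphYE.
have -> : ncopies graphY G = #|f @: embY (adj G)|.
  apply: eq_card => X; rewrite inE; apply/induces_copyP/imsetP.
    by case=> x [xI xX xA]; exists x => //; apply/embP.
  by case=> x /embP[xI xA] ->; exists x.
rewrite -sum1_card (partition_big_imset f) /= mulnC -sum_nat_const.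
apply: eq_bigr => _ /imsetP[x /embP[xI xA] ->].
rewrite sum1_card; pose t : 'S_5 := tperm (inord 3) (inord 4).
pose y := [ffun i => x (t i)].
(* The embeddings with the image of [x] are [x] itself and [x] with its leaves exchanged. *)
transitivity #|[set x; y]|; last first.
  rewrite cards2; suff -> : x != y by [].
  apply/eqP => /(congr1 (fun g : {ffun 'I_5 -> T} => g (inord 3))).
  by rewrite ffunE tpermL => /xI/(congr1 val); rewrite /= !inordK.
apply: eq_card => z; rewrite [LHS]inE; apply/idP/idP.
  case/andP=> /embP[zI zA] /eqP zx.
  have /fin_all_exists[s sE] i : exists j, x j = z i.
    have : z i \in f x by rewrite -zx imset_f.
    by case/imsetP => j _ ->; exists j.
  have sI : injective s by move=> i j /(congr1 x); rewrite !sE => /zI.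
  have zs : z = [ffun i => x (perm sI i)] by apply/ffunP => i; rewrite ffunE permE sE.
  have /orP[/eqP s1|/eqP st] : (perm sI == 1%g) || (perm sI == t).
  - apply: perm_automorphism_Y => i j; rewrite !permE -!graphYE.
    by rewrite -xA -zA !sE.
  - by rewrite !inE zs s1; apply/orP; left; apply/eqP/ffunP => i; rewrite ffunE perm1.
  - by rewrite !inE zs st; apply/orP; right; apply/eqP/ffunP => i; rewrite !ffunE.
rewrite in_set2 => /orP[] /eqP->; first by rewrite eqxx andbT; apply/embP.
apply/andP; split.
  apply/embP; split=> [i j|i j]; rewrite !ffunE; first by move/xI/perm_inj.
  rewrite xA !graphYE.
  have tE (k : 'I_5) : t k = nth 0%N [:: 0; 1; 2; 4; 3] k :> nat.
    rewrite /t; case: tpermP => [->|->|]; rewrite /= ?inordK //.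
    move/eqP; rewrite -val_eqE /= inordK // => k3 /eqP; rewrite -val_eqE /= inordK //.
    by case: k k3 => [[|[|[|[|[|k]]]]] ?].
  by rewrite !tE; case: i j => [[|[|[|[|[|i]]]]] ?] [[|[|[|[|[|j]]]]] ?].
apply/eqP/setP => a; apply/imsetP/imsetP => -[i _ ->].
  by exists (t i); rewrite ?ffunE.
by exists (t i); rewrite // ffunE tpermK.
Qed.

End Copies.

Lemma induces_copy_trans (U V T : finType) (F : sgraph U) (H : sgraph V)
    (G : sgraph T) (X : {set T}) :
  giso F H -> induces_copy H G X -> induces_copy F G X.
Proof.
case/induces_copyP=> f [fI fX fA] /induces_copyP[g [gI gX gA]].
apply/induces_copyP; exists [ffun u => g (f u)]; split=> [u v|| u v].
- by rewrite !ffunE => /gI/fI.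
- rewrite -gX -fX -imset_comp; apply: eq_imset => u; exact: ffunE.
- by rewrite !ffunE gA fA.
Qed.

Section Isomorphism.
Variable k : nat.
Implicit Types F H : sgraph 'I_k.

Lemma giso_refl F : giso F F.
Proof.
apply/induces_copyP; exists [ffun u => u]; split=> [u v||u v]; rewrite ?ffunE //.
by apply/setP => u; rewrite in_setT; apply/imsetP; exists u; rewrite ?ffunE.
Qed.

Lemma giso_sym F H : giso F H = giso H F.
Proof.
suff sub F' H' : giso F' H' -> giso H' F' by apply/idP/idP; apply: sub.
case/induces_copyP=> f [fI _ fA].
apply/induces_copyP; exists (finfun (invF fI)); split=> [u v||u v].
- by rewrite !ffunE => /(congr1 f); rewrite !f_invF.
- apply/setP => u; rewrite in_setT; apply/imsetP; exists (f u); rewrite // ffunE.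
  by rewrite invF_f.
- by rewrite !ffunE -fA !f_invF.
Qed.

Lemma giso_equivalence : {in [set: sgraph 'I_k] & &,
  equivalence_rel (fun F H : sgraph 'I_k => giso F H)}.
Proof.
move=> F H K _ _ _; split; first exact: giso_refl.
move=> FH; apply/idP/idP; apply: induces_copy_trans => //.
by rewrite giso_sym.
Qed.

End Isomorphism.

Section InducibilityY.
Variable R : realType.
Local Notation p := (inducibilityY R).

(** [gamma] is the indicator of the isomorphism class of Y. The transversal meets this class in a
    single graph [H0], and the induced copies of [H0] are those of Y. *)
Lemma Lambda_inducibilityY (T : finType) (G : sgraph T) :
  Lambda p G = (ncopies graphY G)%:R.
Proof.
rewrite /Lambda /=; set X := iso_reps 5.
pose B := [set H in [set: sgraph 'I_5] | giso graphY H].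
have /and3P[_ _ /forall_inP XP] :=
  transversalP (equivalence_partitionP (@giso_equivalence 5)).
have /cards1P[H0 XB] : #|X :&: B| == 1%N by apply: XP; apply/imsetP; exists graphY.
have giso0 : giso graphY H0.
  by have := set11 H0; rewrite -XB !inE => /andP[].
rewrite (bigD1 H0) /=; last by have := set11 H0; rewrite -XB !inE => /andP[].
rewrite giso_sym giso0 mul1r big1 ?addr0 => [|H /andP[HX HH0]]; last first.
  have : H \notin X :&: B by rewrite XB inE.
  by rewrite inE HX /= !inE giso_sym /= => /negbTE->; rewrite mul0r.
congr _%:R; apply: eq_card => Y; rewrite !inE.
by apply/idP/idP; apply: induces_copy_trans; rewrite // giso_sym.
Qed.

Lemma lambda_inducibilityY (T : finType) (G : sgraph T) :
  lambda p G = #|embY (adj G)|%:R / (2 * 'C(#|T|, 5)%:R).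
Proof.
rewrite /lambda Lambda_inducibilityY card_embY natrM /= invfM.
by rewrite mulrACA divff ?pnatr_eq0 // mul1r.
Qed.

Lemma admissible_inducibilityY (T : finType) (G : sgraph T) : admissible p G.
Proof. by []. Qed.

End InducibilityY.

(** * Counting maps *)

Local Close Scope ring_scope.

Lemma card_exists (U I : finType) (P : I -> pred U) :
  #|[set x | [exists i, P i x]]| <= \sum_i #|[set x | P i x]|.
Proof.
rewrite -sum1_card.
under [leqRHS]eq_bigr => i _ do rewrite -sum1_card big_mkcond.
rewrite exchange_big big_mkcond; apply: leq_sum => x _.
rewrite inE; case: existsP => // -[i Pi].
by rewrite (bigD1 i) //= inE Pi.
Qed.

Lemma card_fiber (U I : finType) (A : {set U}) (f : U -> I) :
  #|A| = \sum_i #|[set x in A | f x == i]|.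
Proof.
rewrite -sum1_card (partition_big f xpredT) //=; apply: eq_bigr => i _.
by rewrite -sum1_card; apply: eq_bigl => x; rewrite inE.
Qed.

Section FunctionCounts.
Variables (k : nat) (T : finType).
Local Notation fT := {ffun 'I_k -> T}.

Lemma card_fixed (S : {set 'I_k}) (y : 'I_k -> T) :
  #|[set x : fT | [forall i in S, x i == y i]]| = #|T| ^ (k - #|S|).
Proof.
pose F i := if i \in S then pred1 (y i) else predT.
have -> : #|[set x : fT | [forall i in S, x i == y i]]| = #|family F|.
  apply: eq_card => x; rewrite inE; apply/forall_inP/familyP => H i.
    by rewrite /F; case: ifP => // /H.
  by move=> iS; have := H i; rewrite /F iS.
rewrite card_family foldrE big_map big_enum /= (bigID (mem S)) /=.
rewrite big1 => [|i iS]; last by rewrite /F iS card1.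
rewrite mul1n (eq_bigr (fun=> #|T|)) => [|i /negbTE iS]; last by rewrite /F iS.
rewrite prod_nat_const; congr (_ ^ _).
by rewrite -[X in X - _]card_ord -(cardC S) addKn.
Qed.

Lemma card_fixed_le (A : {set fT}) (s : seq ('I_k * T)) :
  uniq [seq p.1 | p <- s] ->
  (forall x, x \in A -> {in s, forall p, x p.1 = p.2}) ->
  #|A| <= #|T| ^ (k - size s).
Proof.
move=> U AP; case: (set_0Vmem A) => [->|[x0 x0A]]; first by rewrite cards0.
pose S := [set i in [seq p.1 | p <- s]].
have <- : #|S| = size s by rewrite cardsE (card_uniqP U) size_map.
rewrite -(card_fixed S x0); apply/subset_leq_card/subsetP => x xA.
rewrite inE; apply/forall_inP => i; rewrite inE => /mapP[p ps ->].
by rewrite (AP x xA) // (AP x0 x0A).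
Qed.

Variable D : rel T.
Local Notation deg a := #|[set b | D a b]|.

Lemma card_rel_pair (i j : 'I_k) : i != j ->
  #|[set x : fT | D (x i) (x j)]| <= (\sum_a deg a) * #|T| ^ (k - 2).
Proof.
move=> ij; rewrite (card_fiber _ (fun x : fT => x i)) big_distrl /=.
apply: leq_sum => a _; rewrite (card_fiber _ (fun x : fT => x j)).
rewrite -sum1_card big_distrl [leqRHS]big_mkcond /=; apply: leq_sum => b _.
rewrite mul1n inE; case: ifP => Dab; last first.
  rewrite leqn0 cards_eq0; apply/eqP/setP => x; rewrite !inE.
  by apply/negP => /andP[/andP[H /eqP ia] /eqP jb]; rewrite ia jb Dab in H.
apply: (@card_fixed_le _ [:: (i, a); (j, b)]); first by rewrite /= inE ij.
move=> x; rewrite !inE => /andP[/andP[_ /eqP xi] /eqP xj] p.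
by rewrite !inE => /orP[] /eqP ->.
Qed.

Variable d : nat.
Hypothesis degD : forall a, deg a <= d.

(** The coordinate [m] is free, so the degree bound applies to it once the value at [l] is known;
    [l] may be one of the fixed coordinates, whence the three cases. *)
Lemma card_rel_fixed (i j l m : 'I_k) (u v : T) : i != j -> l != m ->
    m != i -> m != j ->
  #|[set x : fT | [&& x i == u, x j == v & D (x l) (x m)]]|
    <= d * #|T| ^ (k - 3).
Proof.
move=> ij lm mi mj; set A := [set x | _].
have AP x : x \in A -> [/\ x i = u, x j = v & D (x l) (x m)].
  by rewrite inE => /and3P[/eqP ? /eqP ?].
have main a (B : {set fT}) (s : seq ('I_k * T)) : uniq (m :: [seq p.1 | p <- s]) ->
    (forall x, x \in B -> D a (x m) /\ {in s, forall p, x p.1 = p.2}) ->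
    #|B| <= d * #|T| ^ (k - (size s).+1).
  move=> U BP; rewrite (card_fiber _ (fun x : fT => x m)).
  apply: (@leq_trans (deg a * #|T| ^ (k - (size s).+1))); last by rewrite leq_mul.
  rewrite -sum1_card big_distrl [leqRHS]big_mkcond /=; apply: leq_sum => b _.
  rewrite mul1n inE; case: ifP => Dab; last first.
    rewrite leqn0 cards_eq0; apply/eqP/setP => x; rewrite !inE.
    by apply/negP => /andP[/BP[H _] /eqP xm]; rewrite -xm H in Dab.
  apply: (@card_fixed_le _ ((m, b) :: s)) => // x.
  rewrite inE => /andP[/BP[_ H] /eqP xm] p; rewrite inE => /orP[/eqP->//|].
  exact: H.
have [li|li] := eqVneq l i.
  apply: (main u A [:: (i, u); (j, v)]); first by rewrite /= !inE negb_or mi mj ij.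
  move=> x /AP[xi xj xD]; rewrite -xi -li; split=> // p.
  by rewrite !inE => /orP[] /eqP->; rewrite // li.
have [lj|lj] := eqVneq l j.
  apply: (main v A [:: (i, u); (j, v)]); first by rewrite /= !inE negb_or mi mj ij.
  move=> x /AP[xi xj xD]; rewrite -xj -lj; split=> // p.
  by rewrite !inE => /orP[] /eqP->; rewrite // lj.
(* Four distinct indices exist, so [k - 4] is not truncated and the choice of the value at [l]
   restores the exponent [k - 3]. *)
have k4 : 3 < k.
  rewrite -[k]card_ord; apply: leq_trans (max_card [in [:: i; j; l; m]]).
  rewrite (card_uniqP _) //= !inE !negb_or ij (eq_sym i l) li (eq_sym i m) mi.
  by rewrite (eq_sym j l) lj (eq_sym j m) mj lm.
rewrite (card_fiber _ (fun x : fT => x l)).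
apply: (@leq_trans (\sum_(a : T) d * #|T| ^ (k - 4))).
  apply: leq_sum => a _; apply: (main a _ [:: (i, u); (j, v); (l, a)]).
    by rewrite /= !inE !negb_or mi mj eq_sym lm ij (eq_sym i l) li eq_sym lj.
  move=> x; rewrite inE => /andP[/AP[xi xj xD] /eqP xl]; rewrite -xl; split=> // p.
  by rewrite !inE => /or3P[] /eqP->.
rewrite sum_nat_const mulnCA leq_mul2l -expnS.
by apply/orP; right; apply: eq_leq; congr (_ ^ _); lia.
Qed.

End FunctionCounts.

(** * Blow-ups of the five-cycle *)

Local Open Scope ring_scope.

Lemma adj5_sym i j : adj5 i j = adj5 j i.
Proof. by case: i j => [|[|[|[|[|i]]]]] [|[|[|[|[|j]]]]]. Qed.

Lemma adj5_irr i : adj5 i i = false.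
Proof. by case: i => [|[|[|[|[|i]]]]]. Qed.

Definition rel5 : rel 'I_5 := fun i j => adj5 i j.

Section BlowupPolynomial.
Variable R : realFieldType.

(** The limit density of embeddings of Y in a blow-up of [C5] with part weights [a]. Patterns are
    counted, not embeddings, since both leaves may lie in one part. *)
Definition blowup_poly (a : 'I_5 -> R) : R := forks a rel5.

Lemma blowup_polyE a :
  blowup_poly a = \sum_(x : {ffun 'I_5 -> 'I_5} | patternY rel5 x) \prod_i a (x i).
Proof. by apply: forksE => *; rewrite /rel5 1?adj5_sym ?adj5_irr. Qed.

Lemma blowup_polyZ c a : blowup_poly (fun i => c * a i) = c ^+ 5 * blowup_poly a.
Proof.
rewrite !blowup_polyE mulr_sumr; apply: eq_bigr => x _.
by rewrite big_split /= prodr_const card_ord.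
Qed.

Lemma sum5E (a : 'I_5 -> R) : \sum_i a i =
  a (inord 0) + a (inord 1) + a (inord 2) + a (inord 3) + a (inord 4).
Proof.
have -> : \sum_i a i = \sum_(i < 5) a (inord i).
  by apply: eq_bigr => i _; rewrite inord_val.
by rewrite -(big_mkord xpredT (fun k => a (inord k))) !big_nat_recr ?big_nil //= add0r.
Qed.

(** An induced path on four vertices misses only one vertex of the cycle. Hence a single pattern of
    large weight bounds four of the five parts from below. *)
Lemma path_C5_cover : all (fun a => all (fun b => all (fun c => all (fun d =>
    path4 adj5 a b c d ==>
    has (fun q => all (fun i => (i == q) || (i \in [:: a; b; c; d])) (iota 0 5))
      (iota 0 5)) (iota 0 5)) (iota 0 5)) (iota 0 5)) (iota 0 5).
Proof. by vm_compute. Qed.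

Lemma patternY_cover (x : {ffun 'I_5 -> 'I_5}) : patternY rel5 x ->
  exists q, forall i, i != q -> exists k, x k = i.
Proof.
rewrite patternY_fork; last 2 first.
- by move=> *; apply: adj5_sym.
- by move=> *; apply: adj5_irr.
move=> xF; have iota5 (i : 'I_5) : val i \in iota 0 5 by rewrite mem_iota ltn_ord.
have xP : path4 adj5 (x (inord 0)) (x (inord 1)) (x (inord 2)) (x (inord 3)).
  by move: xF; rewrite /fork /rel5 /path4 => /and5P[-> -> -> _ /and5P[-> -> _ ->]].
have /implyP/(_ xP)/hasP[q] := allP (allP (allP (allP path_C5_cover _ (iota5 (x (inord 0))))
  _ (iota5 (x (inord 1)))) _ (iota5 (x (inord 2)))) _ (iota5 (x (inord 3))).
rewrite mem_iota => q5 /allP qP; exists (Ordinal q5) => i iq.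
have := qP i (iota5 i); rewrite -[_ == q]/(i == Ordinal q5) (negbTE iq) !inE /=.
by case/or4P=> /eqP/val_inj ->; eexists.
Qed.

Lemma bads_ge0 (T : finType) (w : T -> R) (e : rel T) :
  (forall a, 0 <= w a) -> 0 <= bads w e.
Proof. by move=> w0; do 6![apply: wsum_ge0 => // ?]; apply: ler0n. Qed.

Lemma wdeg5 (a : 'I_5 -> R) (k : nat) : (k < 5)%N ->
  wdeg a rel5 (inord k) = a (inord (nth 0%N [:: 1; 2; 3; 4; 0]%N k)) +
    a (inord (nth 0%N [:: 4; 0; 1; 2; 3]%N k)).
Proof.
rewrite /wdeg big_mkcond sum5E /rel5.
by case: k => [|[|[|[|[|k]]]]] // _; rewrite !inordK //=; ring.
Qed.

(** The degree condition at part 0 is absent. The other four conditions and the total weight form an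
    invertible linear system with solution 1/5 everywhere. *)
Lemma cycle_bounds (a0 a1 a2 a3 a4 eta : R) : a0 + a1 + a2 + a3 + a4 = 1 ->
  `|10%:R * (a2 + a0) - 4%:R| <= 10%:R * eta ->
  `|10%:R * (a3 + a1) - 4%:R| <= 10%:R * eta ->
  `|10%:R * (a4 + a2) - 4%:R| <= 10%:R * eta ->
  `|10%:R * (a0 + a3) - 4%:R| <= 10%:R * eta ->
  [/\ `|a0 - 5^-1| <= 8%:R * eta, `|a1 - 5^-1| <= 8%:R * eta,
      `|a2 - 5^-1| <= 8%:R * eta, `|a3 - 5^-1| <= 8%:R * eta &
      `|a4 - 5^-1| <= 8%:R * eta].
Proof.
rewrite !ler_norml => ? /andP[? ?] /andP[? ?] /andP[? ?] /andP[? ?].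
by split; apply/andP; split; lra.
Qed.

(** A pattern of weight at least [m] gives weight at least [m] to each of the parts it meets, which
    are all parts but possibly one. At these the degree term of [main_inequality] keeps a factor at
    least [m ^ 4], so their degrees are within [eta] of 2/5, and [cycle_bounds] applies. *)
Lemma balance (a : 'I_5 -> R) (m eta : R) :
  (forall i, 0 <= a i) -> \sum_i a i = 1 -> m * 1000%:R * 1000%:R = 1 ->
  0 <= eta -> eta <= 1 ->
  1536%:R - 480%:R * 1000%:R * blowup_poly a <= m ^+ 4 * (10%:R * eta) ^+ 2 ->
  forall i, `|a i - 5^-1| <= 8%:R * eta.
Proof.
move=> a0 a1 mE eta0 eta1 H.
have m0 : 0 < m by lra.
have m1 : m <= 1 by lra.
have polyE := blowup_polyE a.
have [x xP xm] : exists2 x : {ffun 'I_5 -> 'I_5}, patternY rel5 x &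
    m <= \prod_i a (x i).
  case: (pickP (fun x => patternY rel5 x && (m <= \prod_i a (x i)))) => [x /andP[]|N].
    by exists x.
  (* Without such a pattern each of the 5^5 maps contributes at most [m]. The value of [m] makes
     480000 * 3125 * m = 1500, well below 1536. *)
  suff : blowup_poly a <= 3125%:R * m.
    have : m ^+ 4 * (10%:R * eta) ^+ 2 <= m * 100%:R.
      apply: ler_pM; [by rewrite exprn_ge0 // ltW|exact: sqr_ge0| |by nra].
      by rewrite exprS ler_piMr ?exprn_ile1 // ltW.
    lra.
  rewrite polyE; apply: (@le_trans _ _ (\sum_(x : {ffun 'I_5 -> 'I_5}) m)).
    rewrite big_mkcond; apply: ler_sum => x _; case: ifP => xP; last exact: ltW.
    by have := N x; rewrite xP /= => /negbT; rewrite -ltNge => /ltW.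
  rewrite sumr_const cardT -cardE card_ffun !card_ord mulr_natl.
  by rewrite (_ : (5 ^ 5)%N = 3125%N).
have le1 i : a i <= 1 by rewrite -a1 (bigD1 i) //= lerDl sumr_ge0.
have am k : m <= a (x k).
  apply: (le_trans xm); rewrite (bigD1 k) //= ler_piMr //.
  by apply: prodr_ile1 => j _; rewrite a0 le1.
have [q qP] := patternY_cover xP.
have deg i : i != q -> `|10%:R * wdeg a rel5 i - 4%:R| <= 10%:R * eta.
  move=> /qP[k xk]; have mi : m <= a i by rewrite -xk.
  have := @main_inequality R _ a a0 rel5 (fun _ _ => adj5_sym _ _) (fun _ => adj5_irr _) i.
  have := @bads_ge0 _ a rel5 a0.
  rewrite a1 !mulr1 expr1n mulr1 -/(blowup_poly a) => b0 MI.
  have {MI} : a i ^+ 4 * (10%:R * wdeg a rel5 i - 4%:R) ^+ 2 <=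
    m ^+ 4 * (10%:R * eta) ^+ 2 by lra.
  have : m ^+ 4 * (10%:R * wdeg a rel5 i - 4%:R) ^+ 2 <=
    a i ^+ 4 * (10%:R * wdeg a rel5 i - 4%:R) ^+ 2.
    by rewrite ler_wpM2r ?sqr_ge0 // lerXn2r // nnegrE // ltW.
  move=> /le_trans/[apply]; rewrite ler_pM2l ?exprn_gt0 //.
  by rewrite -[in X in X -> _]real_normK ?num_real // ler_pXn2r // nnegrE mulr_ge0.
have A k : (k < 5)%N -> inord k != q ->
   `|10%:R * (a (inord (nth 0%N [:: 1; 2; 3; 4; 0]%N k)) +
    a (inord (nth 0%N [:: 4; 0; 1; 2; 3]%N k))) - 4%:R| <= 10%:R * eta.
  by move=> k5 /deg; rewrite wdeg5.
have neq k l : (k < 5)%N -> (l < 5)%N -> (inord k != inord l :> 'I_5) = (k != l).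
  by move=> k5 l5; rewrite -val_eqE /= !inordK.
have {A} := (A 0 isT, A 1 isT, A 2 isT, A 3 isT, A 4 isT)%N.
move: a1; rewrite sum5E /= => a1 [[[[A0 A1] A2] A3] A4].
have main (P : 'I_5 -> Prop) :
    [/\ P (inord 0), P (inord 1), P (inord 2), P (inord 3) & P (inord 4)] ->
    forall i, P i.
  move=> [P0 P1 P2 P3 P4] i; rewrite -(inord_val i).
  by case: i => [[|[|[|[|[|i]]]]] ?].
have : q \in [seq inord k | k <- iota 0 5].
  by apply/mapP; exists (val q); rewrite ?mem_iota ?inord_val ?ltn_ord.
clear -a1 A0 A1 A2 A3 A4 neq main.
(* The exceptional part [q] is rotated to position 0 of [cycle_bounds]. *)
rewrite !inE => /or4P[/eqP qE|/eqP qE|/eqP qE|/orP[] /eqP qE];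
  rewrite qE {qE} in A0 A1 A2 A3 A4; apply: main.
- rewrite neq //= in A1; rewrite neq //= in A2; rewrite neq //= in A3.
  rewrite neq //= in A4.
  by have [] := cycle_bounds a1 (A1 isT) (A2 isT) (A3 isT) (A4 isT).
- rewrite neq //= in A0; rewrite neq //= in A2; rewrite neq //= in A3.
  rewrite neq //= in A4.
  by have [|] := cycle_bounds _ (A2 isT) (A3 isT) (A4 isT) (A0 isT); first lra.
- rewrite neq //= in A0; rewrite neq //= in A1; rewrite neq //= in A3.
  rewrite neq //= in A4.
  by have [|] := cycle_bounds _ (A3 isT) (A4 isT) (A0 isT) (A1 isT); first lra.
- rewrite neq //= in A0; rewrite neq //= in A1; rewrite neq //= in A2.
  rewrite neq //= in A4.
  by have [|] := cycle_bounds _ (A4 isT) (A0 isT) (A1 isT) (A2 isT); first lra.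
- rewrite neq //= in A0; rewrite neq //= in A1; rewrite neq //= in A2.
  rewrite neq //= in A3.
  by have [|] := cycle_bounds _ (A0 isT) (A1 isT) (A2 isT) (A3 isT); first lra.
Qed.

End BlowupPolynomial.

Section Blowups.
Variables (R : realFieldType) (T : finType) (F : T -> 'I_5).

Definition rel_of_map : rel T := fun x y => adj5 (F x) (F y).
Definition fiber_size (i : 'I_5) : nat := #|[set x | F x == i]|.

Lemma wsum_map (G : 'I_5 -> R) : weighted_sum (fun _ : T => 1) (fun x => G (F x)) =
  weighted_sum (fun i => (fiber_size i)%:R) G.
Proof.
rewrite /weighted_sum (partition_big F xpredT) //=; apply: eq_bigr => i _.
rewrite (eq_bigr (fun=> G i)) => [|x /eqP ->]; last by rewrite mul1r.
by rewrite sumr_const mulr_natl; congr (_ *+ _); apply: eq_card => x; rewrite inE.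
Qed.

Lemma forks_blowup : forks (fun _ : T => 1) rel_of_map =
  blowup_poly (fun i => (fiber_size i)%:R) :> R.
Proof.
rewrite /blowup_poly /forks.
pose G5 a b c d f : R := (fork rel5 a b c d f)%:R.
rewrite -wsum_map; apply: eq_wsum => a.
rewrite -(wsum_map (fun b => weighted_sum _ (fun c => weighted_sum _ (fun d =>
  weighted_sum _ (fun f => G5 (F a) b c d f))))).
apply: eq_wsum => b.
rewrite -(wsum_map (fun c => weighted_sum _ (fun d => weighted_sum _ (fun f =>
  G5 (F a) (F b) c d f)))).
apply: eq_wsum => c.
rewrite -(wsum_map (fun d => weighted_sum _ (fun f => G5 (F a) (F b) (F c) d f))).
apply: eq_wsum => d.
by rewrite -(wsum_map (fun f => G5 (F a) (F b) (F c) (F d) f)).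
Qed.

Variable e : rel T.
Definition mismatch : rel T := fun x y => e x y != rel_of_map x y.

(** An embedding in [e] either is a pattern of the blow-up relation or sends one of the 25 ordered
    pairs of positions to a mismatch. *)
Lemma card_embY_le :
  (#|embY e|%:R : R) <= blowup_poly (fun i => (fiber_size i)%:R) +
    (25 * (\sum_x #|[set y | mismatch x y]|) * #|T| ^ 3)%:R.
Proof.
rewrite -forks_blowup forksE; last 2 first.
- by move=> *; apply: adj5_sym.
- by move=> *; apply: adj5_irr.
have -> : \sum_(x : {ffun 'I_5 -> T} | patternY rel_of_map x) \prod_(i < 5) 1 =
    #|[set x : {ffun 'I_5 -> T} | patternY rel_of_map x]|%:R :> R.
  rewrite -sum1_card natr_sum; apply: eq_big => x; rewrite ?inE // => _.
  by rewrite big1.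
rewrite -natrD ler_nat.
pose A (p : 'I_5 * 'I_5) := [pred x : {ffun 'I_5 -> T} |
  (p.1 != p.2) && mismatch (x p.1) (x p.2)].
apply: (@leq_trans #|[set x : {ffun 'I_5 -> T} | patternY rel_of_map x] :|:
   [set x | [exists p, A p x]]|).
  apply/subset_leq_card/subsetP => x; rewrite !inE => /andP[_ /'forall_forallP xP].
  case: (boolP [exists p, A p x]) => [_|/existsPn N]; first by rewrite orbT.
  rewrite orbF; apply/'forall_forallP => i j; have := N (i, j); rewrite /= negb_and.
  case/orP=> [|/negPn/eqP <-]; last exact: xP.
  by move/negPn/eqP <-; rewrite /rel_of_map adj5_irr; case: i => [[|[|[|[|[|i]]]]] ?].
rewrite (leq_trans (leq_card_setU _ _)) // leq_add2l.
apply: leq_trans (card_exists A) _.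
apply: (@leq_trans (\sum_(p : 'I_5 * 'I_5)
    (\sum_x #|[set y | mismatch x y]|) * #|T| ^ 3)).
  apply: leq_sum => -[i j] _ /=; case: eqVneq => [->|ij] /=.
    by rewrite [X in (X <= _)%N]eq_card0 // => x; rewrite !inE.
  exact: (@card_rel_pair 5 T mismatch i j ij).
by rewrite sum_nat_const card_prod !card_ord mulnA.
Qed.

End Blowups.

(** * Cloning a vertex *)

Local Close Scope ring_scope.

Section VertexDegrees.
Variables (T : finType) (e : rel T).

Definition degY (v : T) : nat := #|[set x in embY e | v \in codom x]|.

Lemma sum_degY : \sum_v degY v = 5 * #|embY e|.
Proof.
under eq_bigr => v _ do rewrite /degY -sum1_card big_mkcond.
rewrite exchange_big mulnC -sum_nat_const [RHS]big_mkcond; apply: eq_bigr => x _.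
case: ifP => xP; last first.
  by rewrite big1 // => v _; rewrite inE xP.
rewrite -[RHS](card_ord 5) -(card_codom (f := x)); last first.
  by apply/injectiveP; move: xP; rewrite inE => /andP[].
rewrite -sum1_card [RHS]big_mkcond; apply: eq_bigr => v _.
by rewrite inE xP.
Qed.

Lemma card_two_points (u v : T) : u != v ->
  #|[set x in embY e | (u \in codom x) && (v \in codom x)]| <= 25 * #|T| ^ 3.
Proof.
move=> uv; pose A (p : 'I_5 * 'I_5) := [pred x : {ffun 'I_5 -> T} |
  (x p.1 == u) && (x p.2 == v)].
apply: (@leq_trans #|[set x | [exists p, A p x]]|).
  apply/subset_leq_card/subsetP => x; rewrite !inE.
  case/and3P=> _ /codomP[i ui] /codomP[j vj]; apply/existsP; exists (i, j).
  by rewrite /= ui vj !eqxx.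
apply: leq_trans (card_exists A) _.
apply: (@leq_trans (\sum_(p : 'I_5 * 'I_5) #|T| ^ 3)); last first.
  by rewrite sum_nat_const card_prod card_ord.
apply: leq_sum => -[i j] _ /=; case: (eqVneq i j) => [<-|ij].
  rewrite [X in X <= _]eq_card0 // => x; rewrite !inE.
  by apply/negP => /andP[/eqP ui /eqP vi]; rewrite -ui -vi eqxx in uv.
apply: (@card_fixed_le _ _ _ [:: (i, u); (j, v)]); first by rewrite /= inE ij.
by move=> x; rewrite !inE => /andP[/eqP ui /eqP vj] p; rewrite !inE => /orP[] /eqP->.
Qed.

Variables u v : T.
Hypothesis uv : u != v.

Definition clone_map (x : T) : T := if x == v then u else x.
Definition clone_rel : rel T := fun x y => e (clone_map x) (clone_map y).

(** Embeddings avoiding [v] survive, and those that also use [u] gain a second version in which [v]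
    replaces [u]. What is lost is counted by [degY v]; embeddings through both vertices go into the
    error term. *)
Lemma card_embY_clone :
  #|embY e| + degY u <= #|embY clone_rel| + degY v + 25 * #|T| ^ 3.
Proof.
pose B := [set x in embY e | (u \in codom x) && (v \in codom x)].
apply: (@leq_trans (#|embY clone_rel| + degY v + #|B|)); last first.
  by rewrite leq_add2l card_two_points.
pose A1 := [set x in embY e | v \notin codom x].
pose A2 := [set x in embY e | (u \in codom x) && (v \notin codom x)].
have E1 : #|embY e| = degY v + #|A1|.
  rewrite -(cardsID [set x : {ffun 'I_5 -> T} | v \in codom x]).
  by congr (_ + _); apply: eq_card => x; rewrite !inE // andbC.
have E2 : degY u = #|B| + #|A2|.
  rewrite /degY -(cardsID [set x : {ffun 'I_5 -> T} | v \in codom x]).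
  congr (_ + _); apply: eq_card => x; rewrite !inE.
    by rewrite andbA.
  by rewrite andbC -andbA.
suff : #|A1| + #|A2| <= #|embY clone_rel| by rewrite E1 E2; lia.
pose f (x : {ffun 'I_5 -> T}) : {ffun 'I_5 -> T} := [ffun i => tperm u v (x i)].
have fI : injective f.
  by move=> x y /ffunP xy; apply/ffunP => i; have := xy i; rewrite !ffunE => /perm_inj.
rewrite -(card_imset (mem A2) fI) -cardsUI [X in _ + X](_ : _ = 0) ?addn0; last first.
  apply/eqP; rewrite cards_eq0; apply/eqP/setP => x; rewrite in_setI in_set0.
  apply/negP => /andP[]; rewrite inE => /andP[_ vx] /imsetP[y].
  rewrite inE => /and3P[_ /codomP[i ui] _] xE; move/negP: vx; apply; apply/codomP.
  by exists i; rewrite xE ffunE -ui tpermL.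
have emb (x y : {ffun 'I_5 -> T}) : x \in embY e ->
    (forall i, clone_map (y i) = x i) -> y \in embY clone_rel.
  rewrite !inE => /andP[/injectiveP xI /'forall_forallP xP] yx; apply/andP; split.
    by apply/injectiveP => i j yij; apply: xI; rewrite -!yx yij.
  by apply/'forall_forallP => i j; rewrite /clone_rel !yx.
apply/subset_leq_card/subsetP => x; rewrite in_setU => /orP[].
  rewrite inE => /andP[xe vx]; apply: (emb x x xe) => i; rewrite /clone_map.
  by case: eqP => // vi; rewrite -vi codom_f in vx.
case/imsetP=> y; rewrite inE => /and3P[ye _ vy] ->; apply: (emb y _ ye) => i.
rewrite ffunE /clone_map; case: tpermP => [->|vi|/eqP yu /eqP yv].
- by rewrite eqxx.
- by rewrite -vi codom_f in vy.
- by rewrite (negbTE yv).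
Qed.

End VertexDegrees.

(** * Editing graphs *)

Section Editing.
Variable T : finType.
Implicit Types G H : sgraph T.

Lemma adj_mkgraph (r : rel T) : symmetric r -> irreflexive r ->
  forall a b, adj (mkgraph r) a b = r a b.
Proof.
move=> rs ri a b; rewrite mkgraphE rs orbb; case: eqVneq => //= ->.
by rewrite ri.
Qed.

Lemma edgeP G (s : {set T}) : reflect (exists a b, s = [set a; b] /\ adj G a b)
  (s \in edges G).
Proof.
apply: (iffP idP) => [sG|[a [b [-> //]]]].
have /subsetP/(_ s sG) := edges_card2 G; rewrite inE => /cards2P[a [b [_ sE]]].
by exists a, b; rewrite /adj -sE.
Qed.

Lemma sgraph_adj_inj G H : (forall a b, adj G a b = adj H a b) -> G = H.
Proof.
move=> GH; apply: val_inj; apply/setP => s /=.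
by apply/edgeP/edgeP => -[a [b [-> ab]]]; exists a, b; split; rewrite ?GH // -GH.
Qed.

Lemma edit_changes_le (S : {set {set T}}) G H :
  (forall a b, adj G a b != adj H a b -> [set a; b] \in S) ->
  edit_changes G H <= #|S|.
Proof.
move=> HS; apply/subset_leq_card/subsetP => s; rewrite !inE.
case/orP=> /andP[sN /edgeP[a [b [sE ab]]]]; rewrite sE in sN *; apply: HS.
  by rewrite ab /adj (negbTE sN).
by rewrite ab /adj (negbTE sN).
Qed.

Lemma edit_changes_trans G H K :
  edit_changes G K <= edit_changes G H + edit_changes H K.
Proof.
apply: leq_trans (leq_card_setU _ _); apply/subset_leq_card/subsetP => s.
by rewrite !inE; case: (s \in G); case: (s \in H); case: (s \in K).
Qed.

Lemma edit_changes0 G : edit_changes G G = 0.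
Proof. by rewrite /edit_changes !setDv setU0 cards0. Qed.

Lemma edit_changes_max G H : edit_changes G H <= #|T| ^ 2.
Proof.
apply: (@leq_trans #|[set [set p.1; p.2] | p : T * T]|).
  by apply: edit_changes_le => a b _; apply/imsetP; exists (a, b).
by rewrite (leq_trans (leq_imset_card _ _)) // card_prod mulnn.
Qed.

Lemma eq_embY (e e' : rel T) : e =2 e' -> embY e = embY e'.
Proof.
move=> E; apply/setP => x; rewrite !inE; congr (_ && _).
by apply: eq_forallb => i; apply: eq_forallb => j; rewrite E.
Qed.

Lemma clone_step G (u v : T) : u != v -> exists2 H,
  #|embY (adj G)| + degY (adj G) u <=
    #|embY (adj H)| + degY (adj G) v + 25 * #|T| ^ 3 &
  edit_changes G H <= #|T|.
Proof.
move=> uv; pose r := clone_rel (adj G) u v.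
have rA : forall a b, adj (mkgraph r) a b = r a b.
  by apply: adj_mkgraph => [a b|a]; rewrite /r /clone_rel ?adj_irr // adj_sym.
exists (mkgraph r); first by rewrite (eq_embY rA) card_embY_clone.
apply: (@leq_trans #|[set [set v; w] | w : T]|); last first.
  exact: leq_trans (leq_imset_card _ _) (max_card _).
apply: edit_changes_le => a b; rewrite rA /r /clone_rel /clone_map.
case: (eqVneq a v) => [->|av]; first by move=> _; apply/imsetP; exists b.
case: (eqVneq b v) => [->|bv]; last by rewrite eqxx.
by move=> _; apply/imsetP; exists a; rewrite // setUC.
Qed.

End Editing.

(** * Bases and mismatches *)

Local Open Scope ring_scope.

Lemma part4_lt (T : Type) (e : T -> T -> bool) a b c d x : (part4 e a b c d x < 5)%N.
Proof.
by rewrite /part4; case: (flag4 _ _ _ _ _ _) => [|[] [|[] [|[] [|[] [|? ?]]]]].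
Qed.

Section Bases.
Variables (R : realFieldType) (T : finType) (e : rel T).
Hypothesis esym : forall a b, e a b = e b a.
Hypothesis eirr : forall a, e a a = false.

Definition path_base (b : T * T * T * T) : bool := path4 e b.1.1.1 b.1.1.2 b.1.2 b.2.
Definition base_map (b : T * T * T * T) (x : T) : 'I_5 :=
  inord (part4 e b.1.1.1 b.1.1.2 b.1.2 b.2 x).
Definition mdeg (F : T -> 'I_5) (v : T) : nat := #|[set y | mismatch F e v y]|.

Lemma badE a b c d x y : bad e a b c d x y =
  path_base (a, b, c, d) && mismatch (base_map (a, b, c, d)) e x y.
Proof.
by rewrite /bad /path_base /mismatch /rel_of_map /base_map !inordK ?part4_lt.
Qed.

Variables (w : T -> R) (s : R) (v : T).
Hypotheses (s0 : 0 <= s) (wE : forall a, w a = 1 + s *+ (a == v)).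

Let w1 a : 1 <= w a. Proof. by rewrite wE lerDl mulrn_wge0. Qed.
Let w0 a : 0 <= w a. Proof. exact: le_trans ler01 (w1 a). Qed.

Lemma sum_le_wsum (F : T -> R) : (forall a, 0 <= F a) -> \sum_a F a <= weighted_sum w F.
Proof. by move=> F0; apply: ler_sum => a _; rewrite ler_peMl. Qed.

(** Only the terms with fifth vertex [v] are kept, where its weight is at least [s]; all other
    weights are at least 1. *)
Lemma bads_ge : s * \sum_(b | path_base b) (mdeg (base_map b) v)%:R <= bads w e.
Proof.
have -> : \sum_(b | path_base b) (mdeg (base_map b) v)%:R =
  \sum_a \sum_b \sum_c \sum_d if path_base (a, b, c, d) then
    (mdeg (base_map (a, b, c, d)) v)%:R else 0 :> R.
  rewrite big_mkcond !pair_bigA /=; apply: eq_bigr => -[[[a b] c] d] _ //.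
rewrite mulr_sumr /bads /weighted_sum6.
do 4![apply: (le_trans _ (sum_le_wsum _));
  [apply: ler_sum => ? _; rewrite ?mulr_sumr
  |by move=> ?; do ?[apply: ler0n | apply: wsum_ge0 => // ?]]].
apply: le_trans (wsum_ge_term w0 v _); last first.
  by move=> ?; apply: wsum_ge0 => // ?; apply: ler0n.
apply: ler_pM => //; first by case: ifP.
  by rewrite wE eqxx lerDr.
apply: le_trans (sum_le_wsum _); last by move=> ?; apply: ler0n.
case: ifP => pb; last by apply: sumr_ge0 => ? _; apply: ler0n.
rewrite /mdeg -sum1_card natr_sum big_mkcond; apply: ler_sum => y _.
by rewrite badE pb inE; case: mismatch.
Qed.

Lemma forks_bads_le : 480%:R * 1000%:R * (#|T|%:R + s) *
    (#|embY e|%:R + s * (degY e v)%:R) +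
    s * \sum_(b | path_base b) (mdeg (base_map b) v)%:R <=
  1536%:R * (#|T|%:R + s) ^+ 6.
Proof.
have W : \sum_a w a = #|T|%:R + s.
  rewrite (eq_bigr _ (fun a _ => wE a)) big_split /= sumr_const; congr (_ + _).
  by rewrite (bigD1 v) //= eqxx big1 ?addr0 // => a /negbTE ->.
have := main_inequality w0 esym eirr v; rewrite W.
have := forks_ge esym eirr s0 wE; have := bads_ge.
have : 0 <= w v ^+ 4 * (10 * wdeg w e v - 4 * (#|T|%:R + s)) ^+ 2.
  by apply: mulr_ge0; [exact: exprn_ge0 | exact: sqr_ge0].
have W0 : 0 <= 480%:R * 1000%:R * (#|T|%:R + s) :> R.
  apply: mulr_ge0; first exact: mulr_ge0 (ler0n _ _) (ler0n _ _).
  exact: addr_ge0 (ler0n _ _) s0.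
move=> ? ? /(ler_wpM2l W0) ? ?; rewrite /degY; lra.
Qed.

End Bases.

(** * Mismatches at a single vertex *)

Section VertexMismatch.
Variables (R : realFieldType) (T : finType) (e : rel T).
Hypothesis esym : forall a b, e a b = e b a.
Hypothesis eirr : forall a, e a a = false.
Local Notation n := (#|T|%:R : R).

Lemma card_embY_ub : 625%:R * #|embY e|%:R <= 2%:R * n ^+ 5.
Proof.
have [n0|n0] := posnP #|T|.
  rewrite (_ : #|embY e| = 0%N) ?n0 ?mulr0 ?exprn_ge0 ?mulr_ge0 //.
  apply/eqP; rewrite -leqn0 (leq_trans (max_card _)) // card_ffun card_ord n0.
  by [].
have /card_gt0P[v _] := n0.
have := @forks_bads_le R T e esym eirr (fun a => 1 + 0 *+ (a == v)) 0 v (lexx _) (fun=> erefl).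
rewrite !mul0r !addr0 exprS => H; have n1 : 0 < n by rewrite ltr0n.
rewrite -(ler_pM2l n1); lra.
Qed.

(** The added weight is [t * n]. As 2/125 is 5 times 2/625, the fork side is 1536 (1 + t)(1 + 5t) up
    to terms in [eps]; it agrees with 1536 (1 + t)^6 in the constant and linear terms. The remainder
    is of order t^2, because [eps] is, and dividing by [t] leaves a bound of order [t]. *)
Lemma base_mismatch_le (eps t : R) (v : T) : 0 < t -> t <= 1 -> 100%:R * eps <= t ^+ 2 ->
  0 <= eps ->
  (2 / 625 - eps) * n ^+ 5 <= #|embY e|%:R ->
  (2 / 125 - 10 * eps) * n ^+ 4 <= (degY e v)%:R ->
  \sum_(b | path_base e b) (mdeg e (base_map e b) v)%:R <= 200%:R * 1000%:R * t * n ^+ 5.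
Proof.
move=> t0 t1 epst eps0 He Hv.
have n0 : 0 < n by rewrite ltr0n; apply/card_gt0P; exists v.
have := @forks_bads_le R T e esym eirr (fun a => 1 + (t * n) *+ (a == v)) (t * n) v
  (mulr_ge0 (ltW t0) (ltW n0)) (fun=> erefl).
set B := \sum_(b | _) _; set E := #|embY e|%:R in He *; set Ev := (degY e v)%:R in Hv *.
have H1 : (2 / 625 - eps) * n ^+ 5 + t * n * ((2 / 125 - 10 * eps) * n ^+ 4) <=
  E + t * n * Ev by rewrite lerD // ler_wpM2l // mulr_ge0 ?ltW.
have c0 : 0 <= 480%:R * 1000%:R * (n + t * n).
  apply: mulr_ge0; first exact: mulr_ge0 (ler0n _ _) (ler0n _ _).
  by apply: addr_ge0; [exact: ltW | apply: mulr_ge0; exact: ltW].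
move: H1 => /(ler_wpM2l c0) H1 H2.
have {H1 H2}H : t * n * B <= n ^+ 6 * (1536%:R * (1 + t) ^+ 6 -
   480%:R * 1000%:R * (1 + t) * ((2 / 625 - eps) + t * (2 / 125 - 10 * eps))).
  have -> : n ^+ 6 * (1536%:R * (1 + t) ^+ 6 -
   480%:R * 1000%:R * (1 + t) * ((2 / 625 - eps) + t * (2 / 125 - 10 * eps))) =
    1536%:R * (n + t * n) ^+ 6 - 480%:R * 1000%:R * (n + t * n) *
    ((2 / 625 - eps) * n ^+ 5 + t * n * ((2 / 125 - 10 * eps) * n ^+ 4)) by field.
  lra.
have : 1536%:R * (1 + t) ^+ 6 -
   480%:R * 1000%:R * (1 + t) * ((2 / 625 - eps) + t * (2 / 125 - 10 * eps)) <=
   200%:R * 1000%:R * t ^+ 2.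
  have t2 : 0 <= t ^+ 2 by rewrite sqr_ge0.
  have t0' := ltW t0.
  have hk k : t ^+ (k + 2) <= t ^+ 2 by rewrite exprD ler_piMl ?exprn_ile1.
  have := (hk 1%N, hk 2%N, hk 3%N, hk 4%N).
  rewrite /= => -[[[h3 h4] h5] h6].
  have he1 : eps * t <= eps by rewrite ler_piMr.
  have he2 : eps * t ^+ 2 <= eps by rewrite ler_piMr ?exprn_ile1.
  have -> : 1536%:R * (1 + t) ^+ 6 -
   480%:R * 1000%:R * (1 + t) * ((2 / 625 - eps) + t * (2 / 125 - 10 * eps)) =
   1536%:R * (10%:R * t ^+ 2 + 20%:R * t ^+ 3 + 15%:R * t ^+ 4 + 6%:R * t ^+ 5 + t ^+ 6)
   + 480%:R * 1000%:R * (eps + 11%:R * (eps * t) + 10%:R * (eps * t ^+ 2)) by field.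
  lra.
have n6 : 0 <= n ^+ 6 by rewrite exprn_ge0 ?ltW.
move=> /(ler_wpM2l n6)/(le_trans H).
have -> : n ^+ 6 * (200%:R * 1000%:R * t ^+ 2) =
  t * n * (200%:R * 1000%:R * t * n ^+ 5) by ring.
by rewrite ler_pM2l ?mulr_gt0.
Qed.

End VertexMismatch.

Lemma exists_le_average (R : realFieldType) (I : finType) (P : pred I) (f : I -> R)
    (K : R) : (0 < #|P|)%N -> \sum_(i | P i) f i <= K ->
  exists2 i, P i & f i * #|P|%:R <= K.
Proof.
case/card_gt0P=> i0 Pi0 H; case: (arg_minP f Pi0) => i Pi imin.
exists i => //; apply: le_trans H; rewrite mulr_natr -sumr_const.
by rewrite (eq_bigl P) //; apply: ler_sum.
Qed.

(** * From path bases to one partition *)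

Section Structure.
Variables (R : realFieldType) (T : finType) (e : rel T).
Local Notation n := (#|T|%:R : R).
Local Notation m b v := ((mdeg e (base_map e b) v)%:R : R).

Variable tau : R.
Hypothesis n0 : 0 < n.
Hypothesis base_sum : forall v, \sum_(b | path_base e b) m b v <= tau * n ^+ 5.
Hypothesis many_bases : n ^+ 4 <= 400%:R * #|path_base e|%:R.
Hypothesis large_fibers : forall b, path_base e b ->
  \sum_v m b v <= 800%:R * tau * n ^+ 2 ->
  forall i, n <= 10%:R * (fiber_size (base_map e b) i)%:R.

(** A positive fraction, 1/400, of all quadruples are bases, so a bound of order n^6 on the sum
    gives one of order n^2 at some base. *)
Lemma average_base (f : T * T * T * T -> R) (K : R) : (forall b, 0 <= f b) ->
  \sum_(b | path_base e b) f b <= K * n ^+ 6 ->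
  exists2 b, path_base e b & f b <= 400%:R * K * n ^+ 2.
Proof.
move=> f0 /exists_le_average; case.
  rewrite -(ltr0n R) -(pmulr_rgt0 _ (ltr0n R 400)).
  by apply: lt_le_trans many_bases; rewrite exprn_gt0.
move=> b bP fb; exists b => //; rewrite -(ler_pM2r (exprn_gt0 4 n0)).
apply: (@le_trans _ _ (f b * (400%:R * #|path_base e|%:R))).
  by rewrite ler_wpM2l.
have -> : 400%:R * K * n ^+ 2 * n ^+ 4 = 400%:R * (K * n ^+ 6) by ring.
by rewrite mulrCA ler_wpM2l.
Qed.

Lemma sum_base_mismatch :
  \sum_(b | path_base e b) \sum_v m b v <= tau * n ^+ 6.
Proof.
rewrite exchange_big /=; apply: le_trans (ler_sum _ (fun v _ => base_sum v)) _.
rewrite (_ : tau * n ^+ 6 = n * (tau * n ^+ 5)); last by ring.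
by rewrite sumr_const mulr_natl.
Qed.

Lemma exists_good_base : exists2 b, path_base e b &
  \sum_v m b v <= 400%:R * tau * n ^+ 2.
Proof.
by apply: (average_base (f := fun b => \sum_v m b v)) sum_base_mismatch => b;
  apply: sumr_ge0.
Qed.

(** The factor [n] puts the mismatch at [v] on the same scale as the total mismatch, so one
    averaging controls both. *)
Lemma exists_good_base_at v : exists2 b, path_base e b &
  \sum_u m b u + n * m b v <= 800%:R * tau * n ^+ 2.
Proof.
have [b||b bP bv] := @average_base (fun b => \sum_u m b u + n * m b v) (2%:R * tau).
- by apply: addr_ge0; [apply: sumr_ge0 | rewrite mulr_ge0].
- rewrite big_split /= -mulr_sumr.
  have := sum_base_mismatch; have := base_sum v => /(ler_wpM2l (ltW n0)).
  rewrite (_ : n * (tau * n ^+ 5) = tau * n ^+ 6); last by ring.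
  lra.
- exists b => //; apply: le_trans bv _; lra.
Qed.

(** Take a base [b] good at [v]. The part of [v] under [b] has at least n/10 vertices, so it
    contains some [u] with few mismatches under both [b] and [b0]. Then [v] and [u] have nearly the
    same neighbours, and those of [u] nearly follow its part under [b0]; that part is [c]. The bound
    12800 is 800 for [v] plus 10 * (800 + 400) for [u]. *)
Lemma exists_twin_part (b0 : T * T * T * T) :
  \sum_v m b0 v <= 400%:R * tau * n ^+ 2 -> forall v, exists c : 'I_5,
  #|[set y | e v y != adj5 c (base_map e b0 y)]|%:R <= 12800%:R * tau * n.
Proof.
move=> b0M v; have [b bP bv] := exists_good_base_at v.
have M0 : 0 <= \sum_u m b u by apply: sumr_ge0.
have bvn : m b v <= 800%:R * tau * n.
  by rewrite -(ler_pM2l n0); apply: le_trans (_ : _ <= 800%:R * tau * n ^+ 2) _; lra.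
have nm0 : 0 <= n * m b v by rewrite mulr_ge0.
have bM : \sum_u m b u <= 800%:R * tau * n ^+ 2 by lra.
have := large_fibers bP bM (base_map e b v).
set U := fiber_size _ _ => Un.
have [||u uU uM] := @exists_le_average R T [pred u | base_map e b u == base_map e b v]
  (fun u => m b u + m b0 u) (1200%:R * tau * n ^+ 2).
- by apply/card_gt0P; exists v; rewrite inE.
- apply: (@le_trans _ _ (\sum_u (m b u + m b0 u))).
    by rewrite big_mkcond; apply: ler_sum => u _; case: ifP; rewrite ?addr_ge0.
  rewrite big_split /=; lra.
exists (base_map e b0 u).
have um : m b u + m b0 u <= 12000%:R * tau * n.
  rewrite -(ler_pM2r n0); apply: (@le_trans _ _ ((m b u + m b0 u) * (10%:R * U%:R))).
    by rewrite ler_wpM2l ?addr_ge0.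
  have -> : U = #|[pred u | base_map e b u == base_map e b v]|.
    by apply: eq_card => y; rewrite !inE.
  lra.
apply: (@le_trans _ _ (m b v + (m b u + m b0 u))); last lra.
rewrite -!natrD ler_nat.
apply: leq_trans (leq_add (leqnn _) (leq_card_setU _ _)).
apply: leq_trans (leq_card_setU _ _).
apply/subset_leq_card/subsetP => y; rewrite !inE /mismatch /rel_of_map (eqP uU).
apply: contraR; rewrite !negb_or !negbK => /and3P[/eqP-> /eqP<- /eqP->] //.
Qed.

(** Vertices with many mismatches under [b0] move to the part given by [exists_twin_part]. Each
    vertex then has at most [eta * n] mismatches against the old parts, and at most [eta * n]
    further ones come from moved neighbours or non-neighbours. *)
Lemma exists_partition (eta : R) : 0 < eta -> eta <= 1 / 32%:R ->
  400%:R * tau <= eta ^+ 2 ->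
  exists F : T -> 'I_5, forall v, (mdeg e F v)%:R <= 2%:R * eta * n.
Proof.
move=> eta0 eta1 taueta; have [b0 b0P b0M] := exists_good_base.
have /fin_all_exists[c cP] := exists_twin_part b0M.
pose F0 := base_map e b0.
pose F v := if m b0 v <= eta * n then F0 v else c v.
exists F => v.
have etan0 : 0 < eta * n by rewrite mulr_gt0.
(* By Markov's inequality: each moved vertex has more than [eta * n] mismatches, and the total is at
   most [eta ^ 2 * n ^ 2]. *)
have Z : #|[set y | F y != F0 y]|%:R <= eta * n.
  rewrite -(ler_pM2r etan0) mulr_natl -sumr_const.
  apply: (@le_trans _ _ (\sum_v m b0 v)).
    rewrite big_mkcond; apply: ler_sum => y _; rewrite inE /F.
    by case: (leP (m b0 y) (eta * n)) => [_|/ltW]; rewrite ?eqxx //; case: ifP.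
  have : 400%:R * tau * n ^+ 2 <= eta ^+ 2 * n ^+ 2 by rewrite ler_wpM2r ?exprn_ge0.
  lra.
(* For a moved vertex, 12800 tau = 32 * 400 tau <= 32 eta^2 <= eta, which is where the bound 1/32 on
   [eta] enters. *)
have V : #|[set y | e v y != adj5 (F v) (F0 y)]|%:R <= eta * n.
  rewrite /F; case: ifP => // _; apply: (le_trans (cP v)).
  apply: (ler_wpM2r (ltW n0)).
  have : eta * eta <= eta * (1 / 32%:R) by rewrite ler_wpM2l ?(ltW eta0).
  lra.
apply: (@le_trans _ _ (#|[set y | e v y != adj5 (F v) (F0 y)]|%:R +
  #|[set y | F y != F0 y]|%:R)); last lra.
rewrite -natrD ler_nat; apply: leq_trans (leq_card_setU _ _).
apply/subset_leq_card/subsetP => y; rewrite !inE /mismatch /rel_of_map.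
by case: (eqVneq (F y) (F0 y)) => [->|]; rewrite ?orbF ?orbT.
Qed.

End Structure.

(** * Flipping a mismatched pair *)

Local Close Scope ring_scope.

Fixpoint words (n : nat) : seq (seq nat) :=
  if n is n'.+1 then [seq k :: s | k <- iota 0 5, s <- words n'] else [:: [::]].

Definition flip_pattern (i j : nat) (s : seq nat) : bool :=
  foldr (fun p b =>
    if adj5 (nth 0 s p.1) (nth 0 s p.2) (+) adjY p.1 p.2 then
      if (p == (i, j)) || (p == (j, i)) then b else false
    else b) true pairs5.

Definition flip_table : seq (seq (seq (nat * nat))) :=
  mkseq (fun i => mkseq (fun j =>
    [seq (nth 0 s i, nth 0 s j) | s <- words 5 & flip_pattern i j s]) 5) 5.

(* Counts the maps from Y to C5 compatible with adjacency except possibly at one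
   ordered pair, which has adjacency [r] in Y and is mapped to (x, y). *)
Definition flip_count (r : bool) (x y : nat) : nat :=
  sumn [seq sumn [seq if (i != j) && (adjY i j == r)
    then count_mem (x, y) (nth [::] (nth [::] flip_table i) j) else 0
    | j <- iota 0 5] | i <- iota 0 5].

(** Enumeration over all pairs of parts. The additive gap of 4 is what correcting a pair gains; the
    upper bound 4 limits the loss caused by parts of slightly different sizes. *)
Lemma flip_count_gain : all (fun x => all (fun y =>
    (flip_count (~~ adj5 x y) x y + 4 <= flip_count (adj5 x y) x y) &&
    (flip_count (~~ adj5 x y) x y <= 4)) (iota 0 5)) (iota 0 5).
Proof. by vm_cast_no_check (erefl true). Qed.

Definition word (c : {ffun 'I_5 -> 'I_5}) : seq nat := [seq val (c k) | k <- enum 'I_5].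

Lemma nth_word c (k : 'I_5) : nth 0 (word c) k = c k.
Proof. by rewrite (nth_map k) ?size_enum_ord // nth_ord_enum. Qed.

Lemma perm_words : perm_eq [seq word c | c : {ffun 'I_5 -> 'I_5}] (words 5).
Proof.
have wordI : injective word.
  by move=> c d cd; apply/ffunP => k; apply: val_inj; rewrite /= -!nth_word cd.
have U : uniq [seq word c | c : {ffun 'I_5 -> 'I_5}].
  by rewrite map_inj_uniq ?enum_uniq.
have memw m (s : seq nat) : size s = m -> all (fun k => k < 5) s -> s \in words m.
  elim: s m => [|k s IHs] [|m] // [sm] /andP[k5 s5].
  by apply/allpairsPdep; exists k, s; rewrite mem_iota k5 IHs.
have S : {subset [seq word c | c : {ffun 'I_5 -> 'I_5}] <= words 5}.
  move=> _ /mapP[c _ ->]; apply: memw; first by rewrite size_map size_enum_ord.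
  by apply/allP => _ /mapP[k _ ->]; apply: ltn_ord.
have sz : size (words 5) <= size [seq word c | c : {ffun 'I_5 -> 'I_5}].
  by rewrite size_map -cardE card_ffun !card_ord; vm_compute.
clear memw; move: (words 5) S sz => W S sz.
have [E1 E2] := uniq_min_size U S sz.
by apply: uniq_perm => //; rewrite -(eq_uniq E1 E2).
Qed.

Definition flip_ffun (i j : 'I_5) (c : {ffun 'I_5 -> 'I_5}) : bool :=
  [forall k : 'I_5, forall l : 'I_5, [|| k == l, (k == i) && (l == j), (k == j) && (l == i) |
     adj5 (c k) (c l) == adjY k l]].

Lemma flip_patternP (i j : 'I_5) c : flip_pattern i j (word c) = flip_ffun i j c.
Proof.
have -> : flip_pattern i j (word c) =
    all (fun p => (p == (val i, val j)) || (p == (val j, val i)) ||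
      (adj5 (nth 0 (word c) p.1) (nth 0 (word c) p.2) == adjY p.1 p.2)) pairs5.
  rewrite /flip_pattern; elim: pairs5 => //= p s ->.
  by case: (adj5 _ _); case: (adjY _ _); case: (_ || _).
apply/allP/'forall_forallP => H.
  have lt (k l : 'I_5) : k < l -> [|| (k == i) && (l == j), (k == j) && (l == i) |
      adj5 (c k) (c l) == adjY k l].
    move=> kl; have := H (val k, val l); rewrite !nth_word !xpair_eqE /= -orbA; apply.
    by case: k l kl => [[|[|[|[|[|k]]]]] ?] [[|[|[|[|[|l]]]]] ?].
  move=> k l; case: (ltngtP k l) => [/lt->|/lt|/val_inj->]; rewrite ?orbT ?eqxx //.
  have -> : adjY l k = adjY k l.
    by case: k l => [[|[|[|[|[|k]]]]] ?] [[|[|[|[|[|l]]]]] ?].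
  rewrite [adj5 (c l) _]adj5_sym => /or3P[/andP[-> ->]|/andP[-> ->]|->];
    by rewrite ?orbT.
move=> [a b] abP; have /andP[ab b5] : (a < b) && (b < 5).
  exact: (allP (isT : all (fun p => (p.1 < p.2) && (p.2 < 5)) pairs5) _ abP).
have a5 := ltn_trans ab b5.
have := H (Ordinal a5) (Ordinal b5); rewrite -!nth_word !xpair_eqE -!(inj_eq val_inj) /=.
by rewrite (ltn_eqF ab) /= -orbA.
Qed.

Lemma flip_countE (r : bool) (x y : 'I_5) : flip_count r x y =
  \sum_(p : 'I_5 * 'I_5 | (p.1 != p.2) && (adjY p.1 p.2 == r))
    #|[set c : {ffun 'I_5 -> 'I_5} | [&& c p.1 == x, c p.2 == y & flip_ffun p.1 p.2 c]]|.
Proof.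
have sumE (f : nat -> nat) : sumn [seq f k | k <- iota 0 5] = \sum_(k < 5) f k.
  by rewrite sumnE big_map -[5]subn0 -/(index_iota 0 5) big_mkord.
rewrite /flip_count sumE [RHS]big_mkcond -(pair_bigA _ (fun i j : 'I_5 =>
   if (i != j) && (adjY i j == r) then #|[set c : {ffun 'I_5 -> 'I_5} |
       [&& c i == x, c j == y & flip_ffun i j c]]| else 0)).
apply: eq_bigr => i _; rewrite sumE; apply: eq_bigr => j _.
rewrite -(inj_eq val_inj); case: ifP => // _.
rewrite /flip_table !nth_mkseq ?ltn_ord // count_map count_filter.
rewrite -(seq.permP perm_words) count_map -sum1_count big_enum_cond -sum1dep_card.
apply: eq_bigl => c; rewrite /= !nth_word xpair_eqE flip_patternP.
by rewrite -!(inj_eq val_inj) andbA.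
Qed.

Lemma adjY_sym i j : adjY i j = adjY j i.
Proof. by case: i j => [|[|[|[|[|i]]]]] [|[|[|[|[|j]]]]]. Qed.

(** * Maps with a prescribed colouring *)

Section FiberBounds.
Variables (T : finType) (F : T -> 'I_5) (u v : T) (i j : 'I_5).
Hypothesis ij : i != j.

Lemma card_colored (c : {ffun 'I_5 -> 'I_5}) : c i = F u -> c j = F v ->
  #|[set x : {ffun 'I_5 -> T} |
      [&& x i == u, x j == v & [ffun k => F (x k)] == c]]| =
  \prod_(k | (k != i) && (k != j)) fiber_size F (c k).
Proof.
move=> ci cj.
pose P k := if k == i then pred1 u else if k == j then pred1 v
            else [pred y | F y == c k].
have -> : #|[set x : {ffun 'I_5 -> T} |
    [&& x i == u, x j == v & [ffun k => F (x k)] == c]]| = #|family P|.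
  apply: eq_card => x; rewrite inE; apply/and3P/familyP => [[/eqP xi /eqP xj /eqP xc] k|H].
    rewrite /P; case: eqP => [->|_]; first by rewrite inE xi.
    by case: eqP => [->|_]; rewrite inE ?xj // -xc ffunE.
  have := (H i, H j); rewrite /P eqxx eq_sym (negbTE ij) eqxx !inE => -[xi xj].
  split=> //; apply/eqP/ffunP => k; rewrite ffunE; have := H k; rewrite /P.
  case: eqP => [->|_]; first by rewrite (eqP xi).
  by case: eqP => [->|_]; rewrite ?(eqP xj) // inE => /eqP.
rewrite card_family foldrE big_map big_enum /= (bigID [pred k | (k != i) && (k != j)]) /=.
rewrite [X in _ * X]big1 ?muln1 => [|k].
  apply: eq_bigr => k /andP[/negbTE ki /negbTE kj]; rewrite /P ki kj.
  by rewrite /fiber_size cardsE.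
rewrite negb_and !negbK /P => /orP[] /eqP->; rewrite ?eqxx ?card1 //.
by case: ifP => _; rewrite ?eqxx card1.
Qed.

Variables (lo hi : nat) (P : pred {ffun 'I_5 -> 'I_5}).
Hypothesis fiber_lo : forall k, lo <= fiber_size F k.
Hypothesis fiber_hi : forall k, fiber_size F k <= hi.

Let Q := [set x : {ffun 'I_5 -> T} |
  [&& x i == u, x j == v & P [ffun k => F (x k)]]].
Let N := #|[set c : {ffun 'I_5 -> 'I_5} | [&& c i == F u, c j == F v & P c]]|.

Lemma card_others : #|[pred k : 'I_5 | (k != i) && (k != j)]| = 3.
Proof.
have : #|[pred k | (k != i) && (k != j)]| + #|[set i; j]| = #|'I_5|.
  rewrite -(cardC [pred k | (k != i) && (k != j)]); congr (_ + _).
  by apply: eq_card => k; rewrite !inE negb_and !negbK.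
by rewrite cards2 ij card_ord => /eqP; rewrite -[5]/(3 + 2) eqn_add2r => /eqP.
Qed.

Lemma card_colorings : N * lo ^ 3 <= #|Q| <= N * hi ^ 3.
Proof.
have E : #|Q| = \sum_(c : {ffun 'I_5 -> 'I_5} | [&& c i == F u, c j == F v & P c])
    \prod_(k | (k != i) && (k != j)) fiber_size F (c k).
  rewrite (card_fiber _ (fun x : {ffun 'I_5 -> T} => [ffun k => F (x k)])).
  rewrite [RHS]big_mkcond; apply: eq_bigr => c _; case: ifP => [|/negP cN].
    case/and3P=> /eqP ci /eqP cj Pc; rewrite -(card_colored ci cj).
    apply: eq_card => x; rewrite !inE; case: ([ffun k => F (x k)] =P c) => [->|_].
      by rewrite Pc !andbT.
    by rewrite !andbF.
  apply/eqP; rewrite cards_eq0; apply/eqP/setP => x; rewrite !inE.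
  apply/negP => /andP[/and3P[/eqP xi /eqP xj xP] /eqP xc]; case: cN.
  by rewrite -xc xP !ffunE xi xj !eqxx.
have pw m : m ^ 3 = \prod_(k : 'I_5 | (k != i) && (k != j)) m.
  by rewrite prod_nat_const card_others.
rewrite E /N -sum1dep_card !big_distrl /= !pw; apply/andP; split;
  by apply: leq_sum => c _; rewrite mul1n; apply: leq_prod.
Qed.

End FiberBounds.

Section Flip.
Variables (T : finType) (F : T -> 'I_5) (D : rel T) (d : nat) (u v : T).
Hypothesis Dsym : symmetric D.
Hypothesis degD : forall a, #|[set b | D a b]| <= d.
Hypothesis uv : u != v.

(** The second index of [q] is kept away from [i] and [j] so that the degree bound applies to a free
    coordinate. As [D] is symmetric, every pair of positions other than {i, j} can be oriented this
    way. *)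
Definition flip_bad (i j : 'I_5) : {set {ffun 'I_5 -> T}} :=
  [set x : {ffun 'I_5 -> T} | [exists q : 'I_5 * 'I_5, [&& q.1 != q.2, q.2 != i, q.2 != j,
     x i == u, x j == v & D (x q.1) (x q.2)]]].

Lemma card_flip_bad (i j : 'I_5) : i != j -> #|flip_bad i j| <= 25 * (d * #|T| ^ 2).
Proof.
move=> ij; apply: leq_trans (card_exists _) _.
apply: (@leq_trans (\sum_(q : 'I_5 * 'I_5) d * #|T| ^ 2)); last first.
  by rewrite sum_nat_const card_prod card_ord.
apply: leq_sum => -[k l] _ /=.
case: (eqVneq k l) => [_|kl]; first by rewrite [X in X <= _]eq_card0 // => x; rewrite !inE.
case: (eqVneq l i) => [_|li]; first by rewrite [X in X <= _]eq_card0 // => x; rewrite !inE.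
case: (eqVneq l j) => [_|lj]; first by rewrite [X in X <= _]eq_card0 // => x; rewrite !inE.
exact: (@card_rel_fixed 5 T D d degD i j k l u v).
Qed.

Lemma flip_badPn (i j : 'I_5) (x : {ffun 'I_5 -> T}) : i != j ->
  x i = u -> x j = v -> x \notin flip_bad i j -> forall k l, k != l ->
  [|| (k == i) && (l == j), (k == j) && (l == i) | ~~ D (x k) (x l)].
Proof.
move=> ij xi xj; rewrite inE => /existsPn N k l kl.
have := N (k, l); rewrite /= kl xi xj !eqxx /=.
have := N (l, k); rewrite /= eq_sym kl xi xj !eqxx /= Dsym.
case: (D _ _); rewrite ?orbT // !andbT !negb_and !negbK orbF.
by move=> /orP[] /eqP ki /orP[] /eqP lj; move: kl; rewrite ki lj ?eqxx ?orbT.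
Qed.

Section Graph.
Variable g : rel T.
Hypothesis gsym : symmetric g.
Hypothesis girr : irreflexive g.
Hypothesis gF : forall x y, ~~ D x y -> (x != y) && (g x y == adj5 (F x) (F y)).

Definition emb_at (i j : 'I_5) := [set x in embY g | (x i == u) && (x j == v)].
Definition flip_colorings (i j : 'I_5) := [set x : {ffun 'I_5 -> T} |
  [&& x i == u, x j == v & flip_ffun i j [ffun k => F (x k)]]].

Lemma emb_at_sub (i j : 'I_5) : i != j -> emb_at i j \subset flip_colorings i j :|: flip_bad i j.
Proof.
move=> ij; apply/subsetP => x; rewrite !in_setU orbC.
case: (boolP (x \in flip_bad i j)) => //= xb; rewrite !inE.
case/andP=> /andP[_ /'forall_forallP xY] /andP[/eqP xi /eqP xj]; rewrite xi xj !eqxx /=.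
apply/'forall_forallP => k l; case: (eqVneq k l) => //= kl.
have := flip_badPn ij xi xj xb kl => /or3P[->|->|/gF/andP[_ /eqP E]]; rewrite ?orbT //.
by rewrite !ffunE -E (eqP (xY k l)) eqxx !orbT.
Qed.

(** Injectivity is part of [gF]: pairs outside [D] are distinct, and the exceptional pair of
    positions goes to [u] and [v], which differ. *)
Lemma flip_colorings_sub (i j : 'I_5) : i != j -> g u v = adjY i j ->
  flip_colorings i j \subset emb_at i j :|: flip_bad i j.
Proof.
move=> ij guv; apply/subsetP => x; rewrite !in_setU orbC.
case: (boolP (x \in flip_bad i j)) => //= xb; rewrite !inE.
case/and3P=> /eqP xi /eqP xj /'forall_forallP xc; rewrite xi xj !eqxx !andbT.
have B := flip_badPn ij xi xj xb.
apply/andP; split.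
  apply/injectiveP => k l xkl; apply/eqP/negPn/negP => kl.
  case/or3P: (B _ _ kl) => [/andP[/eqP ki /eqP lj]|/andP[/eqP kj /eqP li]|/gF/andP[]].
  - by case/eqP: uv; rewrite -xi -xj -ki -lj xkl.
  - by case/eqP: uv; rewrite -xi -xj -kj -li xkl.
  - by rewrite xkl eqxx.
apply/'forall_forallP => k l; case: (eqVneq k l) => [->|kl].
  by rewrite girr; case: l => [[|[|[|[|[|l]]]]] ?].
case: (boolP ((k == i) && (l == j))) => [/andP[/eqP-> /eqP->]|N1].
  by rewrite xi xj guv.
case: (boolP ((k == j) && (l == i))) => [/andP[/eqP-> /eqP->]|N2].
  by rewrite xi xj gsym guv adjY_sym.
have := B _ _ kl; rewrite (negbTE N1) (negbTE N2) /= => /gF/andP[_ /eqP->].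
by have := xc k l; rewrite (negbTE kl) (negbTE N1) (negbTE N2) !ffunE.
Qed.

Lemma emb_at0 (i j : 'I_5) : g u v != adjY i j -> #|emb_at i j| = 0.
Proof.
move=> guv; apply: eq_card0 => x; rewrite !inE; apply/negP.
case/andP=> /andP[_ /'forall_forallP xY] /andP[/eqP xi /eqP xj].
by have := xY i j; rewrite xi xj (negbTE guv).
Qed.

(** Up to [flip_bad], embeddings with [i], [j] at [u], [v] are the maps with an admissible
    colouring, if the adjacency of [i], [j] in Y is [r]; otherwise there are none. The error is the
    bound for [flip_bad] over the 25 pairs of positions. *)
Lemma card_emb_at (r : bool) : g u v = r ->
  let N := \sum_(p : 'I_5 * 'I_5) #|emb_at p.1 p.2| in
  forall lo hi, (forall k, lo <= fiber_size F k <= hi) ->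
  flip_count r (F u) (F v) * lo ^ 3 <= N + 25 * (25 * (d * #|T| ^ 2)) /\
  N <= flip_count r (F u) (F v) * hi ^ 3 + 25 * (25 * (d * #|T| ^ 2)).
Proof.
move=> guv N lo hi fib; set B := 25 * (d * _).
have flo k : lo <= fiber_size F k by have /andP[] := fib k.
have fhi k : fiber_size F k <= hi by have /andP[] := fib k.
have -> : 25 * B = \sum_(p : 'I_5 * 'I_5) B by rewrite sum_nat_const card_prod card_ord.
rewrite flip_countE !big_distrl /= /N.
split; [rewrite [X in X <= _]big_mkcond | rewrite [X in _ <= X + _]big_mkcond];
  rewrite -big_split /=; apply: leq_sum => -[i j] _ /=; case: ifP => [/andP[ij /eqP rij]|/negbT].
- have /andP[le _] := @card_colorings T F u v i j ij lo hi (flip_ffun i j) flo fhi.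
  apply: (leq_trans le); apply: leq_trans (_ : #|emb_at i j :|: flip_bad i j| <= _).
    by apply: subset_leq_card; apply: flip_colorings_sub; rewrite ?guv ?rij.
  by rewrite (leq_trans (leq_card_setU _ _)) // leq_add2l card_flip_bad.
- by [].
- have /andP[_ le] := @card_colorings T F u v i j ij lo hi (flip_ffun i j) flo fhi.
  apply: leq_trans (leq_add le (leqnn _)).
  apply: leq_trans (_ : #|flip_colorings i j :|: flip_bad i j| <= _).
    exact: subset_leq_card (emb_at_sub ij).
  by rewrite (leq_trans (leq_card_setU _ _)) // leq_add2l card_flip_bad.
rewrite negb_and negbK => /orP[/eqP->|rij].
  rewrite [X in X <= _]eq_card0 // => x; rewrite !inE; apply/negP.
  by case/and3P=> _ /eqP xj /eqP xi; case/eqP: uv; rewrite -xj -xi.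
by rewrite emb_at0 // guv eq_sym.
Qed.

(** The first summand is the same before and after flipping the pair [u], [v], so only the second
    has to be compared. *)
Lemma card_embY_split : #|embY g| =
  #|[set x in embY g | ~~ ((u \in codom x) && (v \in codom x))]| +
  \sum_(p : 'I_5 * 'I_5) #|emb_at p.1 p.2|.
Proof.
rewrite -(cardsID [set x : {ffun 'I_5 -> T} | (u \in codom x) && (v \in codom x)]).
rewrite addnC; congr (_ + _).
  by apply: eq_card => x; rewrite !inE andbC.
rewrite -sum1_card; under [RHS]eq_bigr => p _ do rewrite -sum1_card big_mkcond.
rewrite exchange_big big_mkcond; apply: eq_bigr => x _ /=.
rewrite in_setI; case: (boolP (x \in embY g)) => [xg|xN] /=; last first.
  by rewrite big1 // => p _; rewrite inE (negbTE xN).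
under [RHS]eq_bigr => p _ do rewrite inE xg.
have xI : injective x by apply/injectiveP; move: xg; rewrite inE => /andP[].
rewrite inE; case: ifP => [/andP[/codomP[i ui] /codomP[j vj]]|uvN].
  rewrite (bigD1 (i, j)) //= ui vj !eqxx big1 // => -[k l] /=.
  rewrite !(inj_eq xI) xpair_eqE negb_and.
  by case: (k == i); case: (l == j).
rewrite big1 // => -[k l] _ /=; case: ifP => // /andP[/eqP xk /eqP xl].
by rewrite -xk -xl !codom_f in uvN.
Qed.

End Graph.
End Flip.

Section FlipGain.
Variables (T : finType) (F : T -> 'I_5) (e : rel T) (d lo hi : nat) (u v : T).
Hypothesis esym : symmetric e.
Hypothesis eirr : irreflexive e.
Hypothesis mdegF : forall a, mdeg e F a <= d.
Hypothesis fibers : forall k, lo <= fiber_size F k <= hi.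
Hypothesis uv : mismatch F e u v.

Definition flip_rel : rel T := fun x y =>
  e x y (+) (((x == u) && (y == v)) || ((x == v) && (y == u))).

Lemma mismatch_neq : u != v.
Proof.
apply: contraL uv => /eqP->.
by rewrite /mismatch /rel_of_map eirr adj5_irr eqxx.
Qed.

Lemma flip_sym : symmetric flip_rel.
Proof. by move=> x y; rewrite /flip_rel esym orbC ![_ && (y == _)]andbC. Qed.

Lemma flip_irr : irreflexive flip_rel.
Proof.
move=> x; rewrite /flip_rel eirr; case: (eqVneq x u) => [->|] /=.
  by rewrite (negbTE mismatch_neq).
by rewrite andbF.
Qed.

Lemma card_embY_flip :
  #|embY e| + flip_count (adj5 (F u) (F v)) (F u) (F v) * lo ^ 3 <=
  #|embY flip_rel| + flip_count (~~ adj5 (F u) (F v)) (F u) (F v) * hi ^ 3 +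
    1250 * (d.+1 * #|T| ^ 2).
Proof.
(* Equal pairs are added so that the complement of [D] also yields distinctness; this turns [d] into
   [d.+1]. The error 625 occurs once for each of the two graphs, hence 1250. *)
pose D : rel T := fun x y => mismatch F e x y || (x == y).
have Dsym : symmetric D.
  move=> x y; rewrite /D /mismatch /rel_of_map (esym x) [adj5 (F x) _]adj5_sym.
  by congr (_ || _); apply: eq_sym.
have degD a : #|[set b | D a b]| <= d.+1.
  apply: (@leq_trans #|a |: [set b | mismatch F e a b]|).
    apply/subset_leq_card/subsetP => b; rewrite !inE /D orbC eq_sym.
    by [].
  by rewrite (leq_trans (leq_card_setU _ _)) // cards1 add1n ltnS mdegF.
have eF x y : ~~ D x y -> (x != y) && (e x y == adj5 (F x) (F y)).
  by rewrite negb_or /mismatch negbK andbC.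
have fF x y : ~~ D x y -> (x != y) && (flip_rel x y == adj5 (F x) (F y)).
  move=> Dxy; have /andP[-> /eqP <-] /= := eF x y Dxy.
  rewrite /flip_rel; case: andP => [[/eqP xu /eqP yv]|_] /=.
    by rewrite /D xu yv uv in Dxy.
  case: andP => [[/eqP xv /eqP yu]|_] /=; last by rewrite addbF.
  by rewrite Dsym /D xv yu uv in Dxy.
have euv : e u v = ~~ adj5 (F u) (F v).
  by move: uv; rewrite /mismatch /rel_of_map; case: (e u v); case: (adj5 _ _).
have fuv : flip_rel u v = adj5 (F u) (F v).
  by rewrite /flip_rel !eqxx /= addbT euv negbK.
have [_ Ee] := card_emb_at Dsym degD mismatch_neq esym eirr eF euv fibers.
have [Ef _] := card_emb_at Dsym degD mismatch_neq flip_sym flip_irr fF fuv fibers.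
rewrite (card_embY_split u v e) (card_embY_split u v flip_rel).
have -> : #|[set x in embY flip_rel | ~~ ((u \in codom x) && (v \in codom x))]| =
    #|[set x in embY e | ~~ ((u \in codom x) && (v \in codom x))]|.
  apply: eq_card => x; rewrite !inE; case: (boolP (_ && (v \in _))) => xuv /=.
    by rewrite !andbF.
  rewrite !andbT; congr (_ && _).
  apply: eq_forallb => i; apply: eq_forallb => j; congr (_ == _).
  rewrite /flip_rel; case: andP => [[/eqP xu /eqP xv]|_] /=.
    by rewrite -xu -xv !codom_f in xuv.
  case: andP => [[/eqP xv /eqP xu]|_] /=; last by rewrite addbF.
  by rewrite -xu -xv !codom_f in xuv.
lia.
Qed.

End FlipGain.

Local Open Scope ring_scope.

Lemma exists_max_degY (T : finType) (e : rel T) : (0 < #|T|)%N ->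
  exists u, (5 * #|embY e| <= #|T| * degY e u)%N.
Proof.
case/card_gt0P=> v0 _; case: (arg_maxnP (P := predT) (degY e) (isT : predT v0)) => u _ umax.
by exists u; rewrite -sum_degY -sum_nat_const; apply: leq_sum => v _; apply: umax.
Qed.

(** The first four vertices of an embedding of Y form an induced path, and the fifth is any
    vertex. *)
Lemma card_embY_bases (T : finType) (e : rel T) :
  (forall a b, e a b = e b a) -> (forall a, e a a = false) ->
  (#|embY e| <= #|path_base e| * #|T|)%N.
Proof.
move=> esym eirr.
pose f (x : {ffun 'I_5 -> T}) := ((x (inord 0), x (inord 1), x (inord 2), x (inord 3)),
   x (inord 4)).
have fI : injective f.
  move=> x y [E0 E1 E2 E3 E4]; apply/ffunP => k; rewrite -(inord_val k).
  by case: k => [[|[|[|[|[|k]]]]] ?].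
rewrite -(card_imset _ fI) -cardsT -[#|path_base e|]cardsE -cardsX.
apply/subset_leq_card/subsetP => _ /imsetP[x xe ->].
suff xP : path_base e (f x).1 by rewrite in_setX in_setT andbT inE.
move: xe; rewrite inE => /andP[_]; rewrite patternY_fork // /path_base /path4 /=.
by case/and5P=> -> -> -> _ /and5P[-> -> _ ->].
Qed.

Section BlowupGraphs.
Variable T : finType.
Implicit Types (G H : sgraph T) (F : T -> 'I_5).

Lemma adj_blowup F a b : adj (blowup C5 F) a b = rel_of_map F a b.
Proof.
rewrite adj_mkgraph ?C5E // => [x y|x]; first exact: adj_sym.
by rewrite C5E adj5_irr.
Qed.

Lemma is_blowupP G : reflect (exists F, forall a b, adj G a b = rel_of_map F a b)
  (is_blowup C5 G).
Proof.
apply: (iffP existsP) => [[F /eqP->]|[F GF]].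
  by exists F => a b; apply: adj_blowup.
exists (finfun F); apply/eqP/sgraph_adj_inj => a b.
by rewrite adj_blowup GF /rel_of_map !ffunE.
Qed.

Lemma flip_step G F (d lo hi : nat) u v : (forall a, mdeg (adj G) F a <= d)%N ->
  (forall k, lo <= fiber_size F k <= hi)%N -> mismatch F (adj G) u v ->
  exists2 H, (#|embY (adj G)| + 8 * lo ^ 3 <= #|embY (adj H)| + 4 * hi ^ 3 +
    1250 * (d.+1 * #|T| ^ 2))%N & (edit_changes G H <= 1)%N.
Proof.
move=> md fib uv.
have Gs : symmetric (adj G) by move=> a b; apply: adj_sym.
have Gi : irreflexive (adj G) by move=> a; apply: adj_irr.
have rA := adj_mkgraph (flip_sym u v Gs) (flip_irr Gi uv).
exists (mkgraph (flip_rel (adj G) u v)).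
  rewrite (eq_embY rA); have := card_embY_flip Gs Gi md fib uv.
  have i5 (k : 'I_5) : val k \in iota 0 5 by rewrite mem_iota ltn_ord.
  have /andP[] := allP (allP flip_count_gain _ (i5 (F u))) _ (i5 (F v)).
  set NW := flip_count (~~ _) _ _; set NR := flip_count _ _ _ => N1 N2 N3.
  have lohi : (lo <= hi)%N by have /andP[/leq_trans] := fib ord0; apply.
  have p3 : (lo ^ 3 <= hi ^ 3)%N by rewrite leq_exp2r.
  (* As [lo <= hi], the gain (NW + 4) lo^3 - NW hi^3 is least at the largest possible value
     [NW = 4]. *)
  have : ((NW + 4) * lo ^ 3 <= NR * lo ^ 3)%N by rewrite leq_mul2r N1 orbT.
  nia.
rewrite -(cards1 [set u; v]); apply: edit_changes_le => a b; rewrite rA inE /flip_rel.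
case: andP => [[/eqP-> /eqP->]|_] //=; case: andP => [[/eqP-> /eqP->] _|_] //=.
  by rewrite setUC.
by rewrite addbF eqxx.
Qed.

End BlowupGraphs.

(** * The balanced blow-up *)

Section Balanced.
Variable R : realFieldType.

(** The ten directed induced paths on four vertices: in the cycle both leaves are forced to the same
    vertex. With weights 1/5 this gives 10 / 3125 = 2/625. *)
Lemma count_forks_C5 : count (fun s => fork adj5 (nth 0 s 0) (nth 0 s 1) (nth 0 s 2)
  (nth 0 s 3) (nth 0 s 4)) (words 5) = 10%N.
Proof. by vm_cast_no_check (erefl 10%N). Qed.

Lemma blowup_poly_cst (c : R) : blowup_poly (fun=> c) = 10%:R * c ^+ 5.
Proof.
rewrite blowup_polyE (eq_bigr (fun _ : {ffun 'I_5 -> 'I_5} => c ^+ 5)) => [|x _]; last first.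
  by rewrite /= prodr_const card_ord.
rewrite sumr_const -[LHS]mulr_natl; congr (_%:R * _).
rewrite -count_forks_C5 -(seq.permP perm_words) count_map -sum1_count.
rewrite big_enum_cond -sum1_card; apply: eq_bigl => x.
rewrite -[_ \in _]/(patternY rel5 x) patternY_fork /=; last 2 first.
- by move=> *; apply: adj5_sym.
- by move=> *; apply: adj5_irr.
have nE k : (k < 5)%N -> nth 0%N (word x) k = x (inord k).
  by move=> k5; rewrite -[in LHS](inordK k5) nth_word.
by rewrite !nE.
Qed.

Lemma le_blowup_poly (a b : 'I_5 -> R) : (forall i, 0 <= a i) ->
  (forall i, a i <= b i) -> blowup_poly a <= blowup_poly b.
Proof.
move=> a0 ab; rewrite !blowup_polyE; apply: ler_sum => x _.
by apply: ler_prod => i _; rewrite a0 ab.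
Qed.

Lemma card_embY_blowup (T : finType) (F : T -> 'I_5) :
  #|embY (adj (blowup C5 F))|%:R <= blowup_poly (fun i => (fiber_size F i)%:R) :> R /\
  blowup_poly (fun i => (fiber_size F i)%:R) <=
    #|embY (adj (blowup C5 F))|%:R + #|T|%:R ^+ 4 :> R.
Proof.
rewrite (eq_embY (adj_blowup F)) -forks_blowup.
by apply: forks1_le => // *; [apply: adj5_sym|apply: adj5_irr].
Qed.

Lemma balanced_blowup (T : finType) : (5 <= #|T|)%N -> exists H : sgraph T,
  is_blowup C5 H /\
  2%:R * (#|T|%:R : R) ^+ 5 <= 625%:R * #|embY (adj H)|%:R + 625%:R * 2%:R * #|T|%:R ^+ 4.
Proof.
move=> n5; pose F (x : T) : 'I_5 := inord (enum_rank x %% 5).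
exists (blowup C5 F); split; first by apply/is_blowupP; exists F => *; apply: adj_blowup.
set n := #|T|%:R; pose q := (#|T| %/ 5)%:R : R.
have fib i : q <= (fiber_size F i)%:R.
  rewrite ler_nat -[(_ %/ _)%N]card_ord /fiber_size.
  have lt (k : 'I_(#|T| %/ 5)) : (k * 5 + i < #|T|)%N.
    have := ltn_ord k; have := ltn_ord i; have := leq_divM #|T| 5.
    by lia.
  pose g k := enum_val (Ordinal (lt k)) : T.
  have gI : injective g by move=> k l /enum_val_inj/(congr1 val) /= /eqP;
    rewrite eqn_add2r eqn_pmul2r // => /eqP/val_inj.
  apply: leq_trans (_ : #|[set g k | k : 'I_(#|T| %/ 5)]| <= _)%N.
    by rewrite card_imset.
  apply/subset_leq_card/subsetP => _ /imsetP[k _ ->]; rewrite inE /F enum_valK /=.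
  by rewrite modnMDl modn_small ?ltn_ord // inord_val.
have q0 : 0 <= q by [].
have := @le_blowup_poly (fun=> q) _ (fun=> q0) fib; rewrite blowup_poly_cst.
have [_] := card_embY_blowup F; rewrite -/n => H1 H2.
have nq : n <= 5%:R * (q + 1).
  by rewrite /q natr1 -natrM ler_nat mulnC ltnW // -ltn_divLR.
have qn : 5%:R * q <= n by rewrite -natrM ler_nat mulnC leq_divM.
(* Rounding error: with b = 5q, factor n^5 - b^5, using n - b <= 5 and b <= n. *)
have B : n ^+ 5 <= 3125%:R * q ^+ 5 + 25%:R * n ^+ 4.
  have n0 : 0 <= n by [].
  pose b := 5%:R * q; have b0 : 0 <= b by rewrite mulr_ge0.
  have hk k : (k <= 4)%N -> n ^+ (4 - k) * b ^+ k <= n ^+ 4.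
    move=> k4; rewrite -[in leRHS](subnK k4) exprD ler_wpM2l ?exprn_ge0 //.
    by rewrite lerXn2r.
  have := (hk 0 isT, hk 1 isT, hk 2 isT, hk 3 isT, hk 4 isT)%N.
  rewrite /= !subn0 ?subnn !expr0 ?expr1 mulr1 mul1r => -[[[[h0 h1] h2] h3] h4].
  have hs : n ^+ 4 + n ^+ (4 - 1) * b + n ^+ (4 - 2) * b ^+ 2 + n ^+ (4 - 3) * b ^+ 3 + b ^+ 4
    <= 5%:R * n ^+ 4 by lra.
  have : (n - b) * (n ^+ 4 + n ^+ (4 - 1) * b + n ^+ (4 - 2) * b ^+ 2 +
      n ^+ (4 - 3) * b ^+ 3 + b ^+ 4) <= 5%:R * (5%:R * n ^+ 4).
    apply: ler_pM => //; rewrite ?subr_ge0 // ?addr_ge0 ?mulr_ge0 ?exprn_ge0 //.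
    by rewrite /b; lra.
  have -> : (n - b) * (n ^+ 4 + n ^+ (4 - 1) * b + n ^+ (4 - 2) * b ^+ 2 +
      n ^+ (4 - 3) * b ^+ 3 + b ^+ 4) = n ^+ 5 - 3125%:R * q ^+ 5.
    by rewrite /b; ring.
  lra.
have n4 : 0 <= n ^+ 4 by rewrite exprn_ge0.
have := le_trans H2 H1; lra.
Qed.

End Balanced.

(** * The improvement step *)

Section Improvement.
Variable R : realFieldType.
Local Notation size_of T := (#|T|%:R : R).

(** Few mismatches make the blow-up polynomial at the relative part sizes nearly maximal, and
    [balance] then forces these sizes towards 1/5. *)
Lemma fibers_near (T : finType) (e : rel T) (F : T -> 'I_5) (m eta eps mu : R) :
  0 < size_of T -> m * 1000%:R * 1000%:R = 1 -> 0 <= eta -> eta <= 1 ->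
  (2 / 625 - eps) * size_of T ^+ 5 <= #|embY e|%:R ->
  \sum_v (mdeg e F v)%:R <= mu * size_of T ^+ 2 ->
  480%:R * 1000%:R * (eps + 25%:R * mu) <= m ^+ 4 * (10%:R * eta) ^+ 2 ->
  forall i, `|(fiber_size F i)%:R - size_of T / 5%:R| <= 8%:R * eta * size_of T.
Proof.
set n := size_of T => n0 mE eta0 eta1 He Hm Hk i.
pose a i : R := (fiber_size F i)%:R / n.
have aE j : (fiber_size F j)%:R = n * a j by rewrite mulrCA divff ?mulr1 ?gt_eqF.
have a0 j : 0 <= a j by rewrite divr_ge0 // ltW.
have a1 : \sum_j a j = 1.
  rewrite -mulr_suml -natr_sum; have := card_fiber [set: T] F.
  rewrite cardsT => /esym; rewrite (eq_bigr (fiber_size F)) => [->|j _].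
    by rewrite divff ?gt_eqF.
  by apply: eq_card => x; rewrite !inE.
have n5 : 0 < n ^+ 5 by rewrite exprn_gt0.
have P : 2 / 625 - eps - 25%:R * mu <= blowup_poly a.
  rewrite -(ler_pM2l n5) -blowup_polyZ.
  have -> : blowup_poly (fun j => n * a j) = blowup_poly (fun j => (fiber_size F j)%:R).
    by rewrite !blowup_polyE; apply: eq_bigr => x _; apply: eq_bigr => j _; rewrite aE.
  have := @card_embY_le R T F e; rewrite 2!natrM natrX natr_sum -/n.
  have : 25%:R * (\sum_v (mdeg e F v)%:R) * n ^+ 3 <= 25%:R * (mu * n ^+ 2) * n ^+ 3.
    apply: ler_wpM2r; first exact: exprn_ge0 (ltW n0).
    exact: ler_wpM2l.
  rewrite /mdeg; have -> : 25%:R * (mu * n ^+ 2) * n ^+ 3 = 25%:R * mu * n ^+ 5 by ring.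
  lra.
have Hb : 1536%:R - 480%:R * 1000%:R * blowup_poly a <= m ^+ 4 * (10%:R * eta) ^+ 2.
  lra.
have H := balance a0 a1 mE eta0 eta1 Hb i.
rewrite aE.
have -> : n * a i - n / 5%:R = n * (a i - 5^-1) by ring.
by rewrite normrM (gtr0_norm n0) mulrC; apply: ler_wpM2r => //; apply: ltW.
Qed.

Lemma exists_small (x : R) : 0 < x -> exists2 y, 0 < y & 1000%:R ^+ 3 * y <= x.
Proof.
move=> x0; have M0 : 0 < 1000%:R ^+ 3 :> R by rewrite exprn_gt0 ?ltr0n.
exists (x / 1000%:R ^+ 3); first by rewrite divr_gt0.
by rewrite mulrC divfK // gt_eqF.
Qed.

(* Successively smaller tolerances: [eta] for the mismatch degrees, [tau] for
   the average over all path bases, [t] for the weight added to a vertex, [eps]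
   for the distance to the maximum. *)
Lemma tolerances (kap : R) : 0 < kap -> kap <= 1 -> exists eta tau t eps : R, [/\
  [/\ 0 < eta, eta <= 1 / 32%:R, 2500%:R * eta <= 1 / 1000%:R &
    480%:R * 1000%:R * (eps + 25%:R * (2%:R * eta)) <= kap],
  [/\ 0 < tau, 400%:R * tau <= eta ^+ 2, 200%:R * 1000%:R * t = tau &
    480%:R * 1000%:R * (eps + 25%:R * (800%:R * tau)) <= kap],
  [/\ 0 < t, t <= 1 & 100%:R * eps <= t ^+ 2] &
  0 < eps /\ eps <= 1 / 2000%:R].
Proof.
have sq (x : R) : 0 < x -> x <= 1 -> 0 < x ^+ 2 /\ x ^+ 2 <= x.
  by move=> x0 x1; rewrite exprn_gt0 //; split=> //; rewrite expr2 ler_piMl ?(ltW x0).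
have num3 : 1000%:R ^+ 3 = 1000%:R * 1000%:R * 1000%:R :> R by ring.
move=> kap0 kap1; have [eta eta0] := exists_small kap0; rewrite num3 => etak.
have eta1 : eta <= 1 by clear - etak kap1 eta0; lra.
have [eta2 etas] := sq _ eta0 eta1.
have [tau tau0] := exists_small eta2; rewrite num3 => taue.
have tau_eta : tau <= eta by clear - taue etas tau0; lra.
have [t tE] : exists t, 200%:R * 1000%:R * t = tau.
  exists (tau / (200%:R * 1000%:R)); rewrite mulrC divfK //.
  by rewrite mulf_neq0 ?pnatr_eq0.
have t0 : 0 < t by clear - tau0 tE; lra.
have ttau : t <= tau by clear - t0 tE; lra.
have t1 : t <= 1 by exact: le_trans ttau (le_trans tau_eta eta1).
have [t2 ts] := sq _ t0 t1.
have [eps eps0] := exists_small t2; rewrite num3 => epst.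
have epst' : eps <= t ^+ 2 by clear - eps0 epst; lra.
have eps_eta : eps <= eta.
  exact: le_trans epst' (le_trans ts (le_trans ttau tau_eta)).
exists eta, tau, t, eps; split; split=> //.
- by clear - etak kap1 eta0; lra.
- by clear - etak kap1 eta0; lra.
- by clear - etak eta0 eps_eta; lra.
- by clear - taue tau0; lra.
- clear - etak eta0 eps_eta taue etas.
  have : 1000%:R * tau <= eta by lra.
  clear - etak eta0 eps_eta; lra.
- by clear - epst eps0; lra.
- by clear - eps_eta etak kap1 eta0; lra.
Qed.

(** The bound on [eps] leaves 2/625 - 1/2000 = 27/10000, which exceeds 1/400. *)
Lemma many_bases (T : finType) (G : sgraph T) (eps : R) : 0 < size_of T ->
  eps <= 1 / 2000%:R -> (2 / 625 - eps) * size_of T ^+ 5 <= #|embY (adj G)|%:R ->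
  size_of T ^+ 4 <= 400%:R * #|path_base (adj G)|%:R.
Proof.
set n := size_of T => n0 epsle He.
have := card_embY_bases (@adj_sym T G) (@adj_irr T G).
rewrite -(ler_nat R) natrM -/n => Hb; rewrite -(ler_pM2r n0) -exprSr.
have n5 : 0 < n ^+ 5 by rewrite exprn_gt0.
have : 1 / 400%:R * n ^+ 5 <= (2 / 625 - eps) * n ^+ 5 by rewrite ler_pM2r //; lra.
lra.
Qed.

End Improvement.

(** * Copies gained per edit *)

Section Gains.
Variable R : realFieldType.
Local Notation size_of T := (#|T|%:R : R).

(** The strict increase makes the iteration terminate, and the linear inequality adds up along
    it. *)
Definition gains (C : R) (T : finType) (G : sgraph T) : Prop :=
  exists H : sgraph T, (#|embY (adj G)| < #|embY (adj H)|)%N /\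
    (edit_changes G H)%:R * size_of T ^+ 3 <=
      C * (#|embY (adj H)|%:R - #|embY (adj G)|%:R).

Lemma gains_le C D (T : finType) (G : sgraph T) : C <= D -> gains C G -> gains D G.
Proof.
move=> CD [H [lt_GH le_GH]]; exists H; split=> //; apply: le_trans le_GH _.
by apply: ler_wpM2r => //; rewrite subr_ge0 ler_nat ltnW.
Qed.

Lemma gainsI (T : finType) (G H : sgraph T) (c k : R) : 0 < size_of T -> 0 < c ->
  0 < k -> (edit_changes G H)%:R <= k ->
  c * (size_of T ^+ 3 * k) <= #|embY (adj H)|%:R - #|embY (adj G)|%:R ->
  gains c^-1 G.
Proof.
move=> n0 c0 k0 ek gain; exists H; have n3 := exprn_gt0 3 n0.
have gain0 : 0 < #|embY (adj H)|%:R - #|embY (adj G)|%:R :> R.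
  by apply: lt_le_trans gain; rewrite !mulr_gt0.
split; first by rewrite -(ltr_nat R) -subr_gt0.
rewrite [leRHS]mulrC ler_pdivlMr // mulrC; apply: le_trans gain.
by rewrite ler_pM2l // [leRHS]mulrC ler_pM2r.
Qed.

(** Moving to the balanced blow-up costs at most n^2 edits and gains [eps * n ^ 5] up to 2 n^4,
    which is absorbed by half of the gain since [eps * n >= 25]. *)
Lemma gains_few_copies (T : finType) (G : sgraph T) (eps : R) :
  (5 <= #|T|)%N -> 0 < eps -> 25%:R <= eps * size_of T ->
  #|embY (adj G)|%:R < (2 / 625 - eps) * size_of T ^+ 5 ->
  gains (eps / 2%:R)^-1 G.
Proof.
move=> n5 eps0; have n0 : 0 < size_of T by rewrite ltr0n (leq_trans _ n5).
set n := size_of T in n0 * => epsn Elow; have [H [_ EH]] := balanced_blowup R n5.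
apply: (@gainsI _ _ H _ (n ^+ 2)) => //; rewrite -/n in EH *.
- by rewrite divr_gt0.
- by rewrite exprn_gt0.
- by rewrite -natrX ler_nat edit_changes_max.
have n4 : 0 < n ^+ 4 by rewrite exprn_gt0.
have : 25%:R * n ^+ 4 <= eps * n * n ^+ 4 by rewrite ler_pM2r.
have -> : eps / 2%:R * (n ^+ 3 * n ^+ 2) = (eps * n ^+ 5) / 2%:R by field.
have -> : eps * n * n ^+ 4 = eps * n ^+ 5 by ring.
clear - Elow EH n4; lra.
Qed.

(** The vertex [u] of largest degree is at least average, hence ahead of [v] by more than 5 eps n^4;
    the cloning error 25 n^3 uses up one eps n^4. At most [n] pairs change. *)
Lemma gains_low_degree (T : finType) (G : sgraph T) (eps : R) (v : T) :
  0 < eps -> 25%:R <= eps * size_of T ->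
  (2 / 625 - eps) * size_of T ^+ 5 <= #|embY (adj G)|%:R ->
  (degY (adj G) v)%:R < (2 / 125 - 10%:R * eps) * size_of T ^+ 4 ->
  gains (4%:R * eps)^-1 G.
Proof.
move=> eps0; have T0 : (0 < #|T|)%N by apply/card_gt0P; exists v.
have n0 : 0 < size_of T by rewrite ltr0n.
set n := size_of T in n0 * => epsn Ehigh vlow.
have n4 : 0 < n ^+ 4 by rewrite exprn_gt0.
have [u] := exists_max_degY (adj G) T0; rewrite -(ler_nat R) !natrM -/n => uhigh.
have {}uhigh : (2 / 125 - 5%:R * eps) * n ^+ 4 <= (degY (adj G) u)%:R.
  rewrite -(ler_pM2l n0); apply: le_trans uhigh.
  have -> : n * ((2 / 125 - 5%:R * eps) * n ^+ 4) = 5%:R * ((2 / 625 - eps) * n ^+ 5).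
    by field.
  by rewrite ler_pM2l.
have uv : u != v.
  apply: contraTneq vlow => <-; rewrite -leNgt; apply: le_trans uhigh.
  by rewrite ler_pM2r //; clear - eps0; lra.
have [H] := clone_step G uv; rewrite -(ler_nat R) 3!natrD (natrM _ 25) natrX -/n.
move=> gain edit; apply: (@gainsI _ _ H _ n) => //; rewrite -/n.
- by rewrite mulr_gt0.
- by rewrite ler_nat.
have n3 : 0 < n ^+ 3 by rewrite exprn_gt0.
have : 25%:R * n ^+ 3 <= eps * n * n ^+ 3 by rewrite ler_pM2r.
have -> : 4%:R * eps * (n ^+ 3 * n) = 4%:R * (eps * n ^+ 4) by ring.
have -> : eps * n * n ^+ 3 = eps * n ^+ 4 by ring.
clear - uhigh vlow gain n3; lra.
Qed.

Lemma gains_mismatch (T : finType) (G : sgraph T) (F : T -> 'I_5) (eta : R) (u v : T) :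
  0 < size_of T -> 1000%:R * 1000%:R <= size_of T ->
  0 < eta -> 2500%:R * eta <= 1 / 1000%:R ->
  (forall w, (mdeg (adj G) F w)%:R <= 2%:R * eta * size_of T) ->
  (forall i, 19%:R / 100%:R * size_of T <= (fiber_size F i)%:R <=
             21%:R / 100%:R * size_of T) ->
  mismatch F (adj G) u v -> gains (1 / 100%:R)^-1 G.
Proof.
set n := size_of T => n0 nlarge eta0 etaf Fdeg fib uv.
case: (arg_maxnP (P := predT) (mdeg (adj G) F) (isT : predT u)) => w _ wmax.
case: (arg_maxnP (P := predT) (fiber_size F) (isT : predT ord0)) => k _ kmax.
case: (arg_minnP (P := predT) (fiber_size F) (isT : predT ord0)) => l _ lmin.
have fiblk i : (fiber_size F l <= fiber_size F i <= fiber_size F k)%N.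
  by apply/andP; split; [exact: lmin|exact: kmax].
have [H] := flip_step (fun a => wmax a isT) fiblk uv.
rewrite -(ler_nat R) 3!natrD (natrM _ 8) (natrM _ 4) (natrM _ 1250) !natrX.
rewrite (natrM _ _ (_ ^ 2)) natrX -natr1 -/n => gain edit.
apply: (@gainsI _ _ H _ 1) => //; rewrite -/n ?divr_gt0 //.
  by rewrite (ler_nat R _ 1).
have /andP[lo _] := fib l; have /andP[_ hi] := fib k; have dw := Fdeg w.
have lo3 : (19%:R / 100%:R * n) ^+ 3 <= (fiber_size F l)%:R ^+ 3.
  by rewrite lerXn2r // nnegrE ?ler0n // mulr_ge0 ?(ltW n0) ?divr_ge0 ?ler0n.
have hi3 : (fiber_size F k)%:R ^+ 3 <= (21%:R / 100%:R * n) ^+ 3.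
  by rewrite lerXn2r // nnegrE ?ler0n // mulr_ge0 ?(ltW n0) ?divr_ge0 ?ler0n.
have d3 : ((mdeg (adj G) F w)%:R + 1) * n ^+ 2 <= (2%:R * eta * n + 1) * n ^+ 2.
  by rewrite ler_pM2r ?exprn_gt0 // lerD2r.
have n3 : 0 < n ^+ 3 by rewrite exprn_gt0.
have e3 : 2500%:R * eta * n ^+ 3 <= 1 / 1000%:R * n ^+ 3 by rewrite ler_pM2r.
have n2 : 1000%:R * 1000%:R * n ^+ 2 <= n ^+ 3.
  by rewrite (exprS n 2) ler_pM2r ?exprn_gt0.
have x1 : (19%:R / 100%:R * n) ^+ 3 = 6859%:R / (1000%:R * 1000%:R) * n ^+ 3 by field.
have x2 : (21%:R / 100%:R * n) ^+ 3 = 9261%:R / (1000%:R * 1000%:R) * n ^+ 3 by field.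
have x3 : (2%:R * eta * n + 1) * n ^+ 2 = 2%:R * (eta * n ^+ 3) + n ^+ 2 by ring.
(* Numerically, 8 * 0.19^3 - 4 * 0.21^3 > 0.0178, while the error is at most 0.001 + 0.00125, both
   in units of n^3; this leaves more than 1/100. *)
rewrite x1 in lo3; rewrite x2 in hi3; rewrite x3 in d3; rewrite -mulrA in e3.
rewrite mulr1; clear - n3 lo3 hi3 d3 e3 n2 gain.
lra.
Qed.

Lemma improvement : exists C n0 : R, [/\ 0 < C, 0 < n0 &
  forall (T : finType) (G : sgraph T), n0 <= size_of T ->
    is_blowup C5 G \/ gains C G].
Proof.
have [m m0 mE] : exists2 m : R, 0 < m & m * 1000%:R * 1000%:R = 1.
  exists (1000%:R * 1000%:R)^-1; first by rewrite invr_gt0 mulr_gt0.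
  by rewrite -mulrA mulVf // mulf_neq0 ?pnatr_eq0.
have m1 : m <= 1 by clear - m0 mE; lra.
(* [balance] is used with tolerance 1/800, so part sizes deviate from n/5 by at most 8/800 = 1/100
   of n; hence the bounds 19/100 and 21/100 below. *)
have [kap kapE] : exists kap, kap = m ^+ 4 * (10%:R * (1 / 800%:R)) ^+ 2 by eexists.
have sml : (0 < 10%:R * (1 / 800%:R) :> R) && (10%:R * (1 / 800%:R) <= 1 :> R).
  by apply/andP; split; lra.
have kap0 : 0 < kap by case/andP: sml => s0 _; rewrite kapE mulr_gt0 ?exprn_gt0.
have kap1 : kap <= 1.
  case/andP: sml => /ltW s0 s1; rewrite kapE.
  by apply: mulr_ile1; rewrite ?exprn_ge0 ?exprn_ile1 // ltW.
have [eta [tau [t [eps [[eta0 eta32 etaf etak] [tau0 tau_eta ttau tauk]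
  [t0 t1 epst] [eps0 eps1]]]]]] := tolerances kap0 kap1.
exists ((eps / 2%:R)^-1 + (4%:R * eps)^-1 + (1 / 100%:R)^-1).
exists (25%:R / eps + 1000%:R * 1000%:R).
have A1 : 0 < (eps / 2%:R)^-1 by rewrite invr_gt0 divr_gt0.
have A2 : 0 < (4%:R * eps)^-1 by rewrite invr_gt0 mulr_gt0.
have A3 : 0 < (1 / 100%:R : R)^-1 by rewrite invr_gt0 divr_gt0.
have A4 : 0 < 25%:R / eps by rewrite divr_gt0.
have A5 : 0 < 1000%:R * 1000%:R :> R by rewrite mulr_gt0.
split; [by rewrite !addr_gt0|by rewrite addr_gt0|move=> T G].
set n := size_of T => nlarge.
have epsn : 25%:R <= eps * n.
  rewrite mulrC -ler_pdivrMr //; apply: le_trans nlarge; rewrite lerDl; exact: ltW.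
have {}nlarge : 1000%:R * 1000%:R <= n.
  by apply: le_trans nlarge; rewrite lerDr; exact: ltW.
have n0 : 0 < n := lt_le_trans A5 nlarge.
case: (ltP #|embY (adj G)|%:R ((2 / 625 - eps) * n ^+ 5)) => [Elow|Ehigh].
  right; apply: gains_le (gains_few_copies _ eps0 epsn Elow).
    by rewrite -addrA lerDl; apply: ltW; exact: addr_gt0.
  rewrite -(ler_nat R); apply: le_trans nlarge.
  by rewrite -natrM ler_nat (leq_trans (isT : (5 <= 1000)%N)) // leq_pmulr.
case: (boolP [exists v, (degY (adj G) v)%:R < (2 / 125 - 10%:R * eps) * n ^+ 4])
  => [/existsP[v vlow]|/existsPn deg_high].
  right; apply: gains_le (gains_low_degree eps0 epsn Ehigh vlow).
  by rewrite addrAC lerDr; apply: ltW; exact: addr_gt0.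
have near F mu : \sum_v (mdeg (adj G) F v)%:R <= mu * n ^+ 2 ->
    480%:R * 1000%:R * (eps + 25%:R * mu) <= kap ->
    forall i, 19%:R / 100%:R * n <= (fiber_size F i)%:R <= 21%:R / 100%:R * n.
  move=> Fmu mu_small i; have e0 : 0 <= 1 / 800%:R :> R by rewrite divr_ge0.
  have e1 : 1 / 800%:R <= 1 :> R by rewrite ler_pdivrMr // mul1r (ler_nat R 1).
  rewrite kapE in mu_small.
  have := fibers_near n0 mE e0 e1 Ehigh Fmu mu_small i.
  rewrite -/n ler_norml => /andP[lo hi]; clear - lo hi n0.
  by apply/andP; split; lra.
have [F Fdeg] : exists F : T -> 'I_5, forall v, (mdeg (adj G) F v)%:R <= 2%:R * eta * n.
  apply: (@exists_partition R T (adj G) tau n0) => //.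
  - move=> v; rewrite -ttau.
    apply: (@base_mismatch_le R T (adj G) (@adj_sym T G) (@adj_irr T G) eps t v) => //.
      exact: ltW.
    by have := deg_high v; rewrite -leNgt.
  - exact: many_bases n0 eps1 Ehigh.
  - move=> b _ /near /(_ tauk) fib i; have /andP[lo _] := fib i; clear - lo n0; lra.
case: (boolP [exists u, exists v, mismatch F (adj G) u v]); last first.
  move/existsPn => N; left; apply/is_blowupP; exists F => a b.
  by have /existsPn/(_ b) := N a; rewrite negbK => /eqP.
case/existsP=> u /existsP[v uv]; right.
have Fsum : \sum_v (mdeg (adj G) F v)%:R <= 2%:R * eta * n ^+ 2.
  apply: (@le_trans _ _ (\sum_(v : T) 2%:R * eta * n)); first exact: ler_sum.
  rewrite sumr_const -[X in X <= _]mulr_natl -/n.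
  by have -> : n * (2%:R * eta * n) = 2%:R * eta * n ^+ 2 by ring.
apply: gains_le (gains_mismatch n0 nlarge eta0 etaf Fdeg (near F _ Fsum etak) uv).
by rewrite lerDr; apply: ltW; exact: addr_gt0.
Qed.

End Gains.

(** * Part sizes and the maximum of the blow-up polynomial *)

Section SizedBlowup.
Variable R : realFieldType.

Lemma fiber_size_tag (s : 'I_5 -> nat) i :
  fiber_size (@tag 'I_5 (fun i => 'I_(s i))) i = s i.
Proof.
rewrite /fiber_size; set X := [set _ | _]; transitivity #|[set: 'I_(s i)]|; last first.
  by rewrite cardsT card_ord.
have TI : injective (fun k : 'I_(s i) => Tagged (fun i => 'I_(s i)) k).
  by move=> k l /eqP; rewrite eq_Tagged => /eqP.
rewrite -(card_imset _ TI); apply: eq_card => -[j k].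
rewrite !inE /=; apply/eqP/imsetP => [E|[l _ /(congr1 tag)]] //.
by move: k; rewrite E => k; exists k; rewrite ?inE.
Qed.

Lemma card_sigma_ord (s : 'I_5 -> nat) :
  #|{: {i : 'I_5 & 'I_(s i)}}| = (\sum_i s i)%N.
Proof.
have := card_fiber [set: {i : 'I_5 & 'I_(s i)}] (@tag 'I_5 (fun i => 'I_(s i))).
rewrite cardsT => ->; apply: eq_bigr => i _; rewrite -[RHS]fiber_size_tag.
by apply: eq_card => x; rewrite !inE.
Qed.

Lemma blowup_poly_le (a : 'I_5 -> R) : (forall i, 0 <= a i) -> \sum_i a i = 1 ->
  blowup_poly a <= 2 / 625.
Proof.
move=> a0 a1.
have := @main_inequality R _ a a0 rel5 (fun _ _ => adj5_sym _ _) (fun _ => adj5_irr _) ord0.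
have := @bads_ge0 R _ a rel5 a0; have := exprn_ge0 4 (a0 ord0).
have := sqr_ge0 (10 * wdeg a rel5 ord0 - 4 * \sum_a0 a a0).
rewrite a1 expr1n !mulr1 -/(blowup_poly a) => p0 p1 b0 MI.
have := mulr_ge0 p1 p0; lra.
Qed.

(** The case [eta = 0] of [balance]. *)
Lemma blowup_poly_max (a : 'I_5 -> R) : (forall i, 0 <= a i) -> \sum_i a i = 1 ->
  2 / 625 <= blowup_poly a -> forall i, a i = 5^-1.
Proof.
move=> a0 a1 aM i; apply/eqP; rewrite -subr_eq0 -normr_le0.
have mE : (1000%:R * 1000%:R)^-1 * 1000%:R * 1000%:R = 1 :> R.
  by rewrite -mulrA mulVf // mulf_neq0 ?pnatr_eq0.
rewrite -[leRHS](mulr0 8%:R).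
by apply: (balance a0 a1 mE (lexx 0) ler01); rewrite mulr0 expr0n mulr0; lra.
Qed.

End SizedBlowup.

Section Stability.
Variable R : realFieldType.

(** Induction on the number of maps that are not yet embeddings: it drops at each gain. Edits
    satisfy the triangle inequality and the gains telescope. *)
Lemma stability : exists C n0 : R, [/\ 0 < C, 0 < n0 &
  forall (T : finType) (G : sgraph T), n0 <= #|T|%:R ->
    exists2 H : sgraph T, is_blowup C5 H & (edit_changes G H)%:R * #|T|%:R ^+ 3 <=
      C * (#|embY (adj H)|%:R - #|embY (adj G)|%:R)].
Proof.
have [C [n0 [C0 n00 step]]] := improvement R; exists C, n0; split=> // T G Tn.
have [k] := ubnP (#|{: {ffun 'I_5 -> T}}| - #|embY (adj G)|)%N.
elim: k => // k IH in G *; rewrite ltnS => le_k.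
have [G_blowup|[H [lt_GH le_GH]]] := step T G Tn.
  by exists G => //; rewrite edit_changes0 mul0r subrr mulr0.
have [|K K_blowup le_HK] := IH H.
  apply: leq_trans le_k; apply: ltn_sub2l => //.
  exact: leq_trans lt_GH (max_card _).
exists K => //; have T3 : 0 <= #|T|%:R ^+ 3 :> R by rewrite exprn_ge0.
apply: (@le_trans _ _ ((edit_changes G H + edit_changes H K)%:R * #|T|%:R ^+ 3)).
  by apply: ler_wpM2r => //; rewrite ler_nat edit_changes_trans.
rewrite natrD mulrDl; apply: le_trans (lerD le_GH le_HK) _.
by rewrite -mulrDr addrC subrKA.
Qed.

Lemma fact5_bin5 (n : nat) :
  n%:R ^+ 5 - 10%:R * n%:R ^+ 4 <= 120%:R * 'C(n, 5)%:R :> R /\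
  120%:R * 'C(n, 5)%:R <= n%:R ^+ 5 :> R.
Proof.
rewrite -natrM mulnC (bin_ffact n 5).
case: n => [|[|[|[|n]]]]; try by rewrite ffact_small //; split; lra.
rewrite !ffactnS ffactn0 /= !natrM; have : 0 <= n%:R :> R by [].
have -> : n.+4%:R = n%:R + 4%:R :> R by rewrite -addn4 natrD.
have -> : n.+3%:R = n%:R + 3%:R :> R by rewrite -addn3 natrD.
have -> : n.+2%:R = n%:R + 2%:R :> R by rewrite -addn2 natrD.
have -> : n.+1%:R = n%:R + 1 :> R by rewrite -addn1 natrD.
move: (n%:R : R) => x x0; have x2 := exprn_ge0 2 x0; have x3 := exprn_ge0 3 x0.
have x4 := exprn_ge0 4 x0.
split.
- have -> : (x + 4%:R) * ((x + 3%:R) * ((x + 2%:R) * ((x + 1) * (x * 1)))) =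
    x ^+ 5 + 10%:R * x ^+ 4 + 35%:R * x ^+ 3 + 50%:R * x ^+ 2 + 24%:R * x by ring.
  have -> : (x + 4%:R) ^+ 5 - 10%:R * (x + 4%:R) ^+ 4 = x ^+ 5 + 10%:R * x ^+ 4 -
    320%:R * x ^+ 2 - 1280%:R * x - 1536%:R by ring.
  lra.
- have -> : (x + 4%:R) * ((x + 3%:R) * ((x + 2%:R) * ((x + 1) * (x * 1)))) =
    x ^+ 5 + 10%:R * x ^+ 4 + 35%:R * x ^+ 3 + 50%:R * x ^+ 2 + 24%:R * x by ring.
  have -> : (x + 4%:R) ^+ 5 = x ^+ 5 + 20%:R * x ^+ 4 + 160%:R * x ^+ 3 +
    640%:R * x ^+ 2 + 1280%:R * x + 1024%:R by ring.
  lra.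
Qed.

End Stability.

(** The factor 60 is 5! divided by the two automorphisms of Y. The order 20 makes the falling
    factorial at least n^5 / 2, and the general bound on embeddings then yields the constant 4. *)
Lemma lambda_near (R : realType) (T : finType) (G : sgraph T) : (20 <= #|T|)%N ->
  0 <= lambda (inducibilityY R) G - 60%:R * (#|embY (adj G)|%:R / #|T|%:R ^+ 5)
    <= 4%:R / #|T|%:R.
Proof.
move=> T20; rewrite lambda_inducibilityY.
have ub := card_embY_ub R (@adj_sym T G) (@adj_irr T G).
have [lo hi] := fact5_bin5 R #|T|; have : 20%:R <= #|T|%:R :> R by rewrite ler_nat.
have : 0 <= #|embY (adj G)|%:R :> R by [].
move: lo hi ub; move: (#|T|%:R : R) ('C(_, _)%:R : R) (#|embY _|%:R : R) => n c x.
move=> lo hi ub x0 n20; have n0 : 0 < n by lra.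
have n4 : 0 < n ^+ 4 by rewrite exprn_gt0.
have n5 : n ^+ 5 = n * n ^+ 4 by rewrite exprS.
have n54 : 20%:R * n ^+ 4 <= n ^+ 5 by rewrite n5 ler_pM2r.
have c0 : 0 < c by clear - lo n54 n4; lra.
have n50 : 0 < n ^+ 5 by clear - n54 n4; lra.
have -> : x / (2%:R * c) - 60%:R * (x / n ^+ 5) =
    x * (n ^+ 5 - 120%:R * c) / (2%:R * c * n ^+ 5).
  by field; rewrite !gt_eqF.
apply/andP; split.
  by rewrite divr_ge0 ?mulr_ge0 ?subr_ge0 // ltW.
have -> : 4%:R / n = 4%:R * (2%:R * c * n ^+ 4) / (2%:R * c * n ^+ 5).
  by rewrite n5; field; rewrite !gt_eqF.
rewrite ler_pM2r ?invr_gt0 ?mulr_gt0 //.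
apply: (@le_trans _ _ (x * (10%:R * n ^+ 4))).
  by apply: ler_wpM2l => //; clear - lo; lra.
rewrite mulrA mulrA ler_pM2r //; clear - ub lo n54 n4; lra.
Qed.

(** * Conclusion *)

From mathcomp Require Import all_classical all_reals all_analysis.
Import Order.TTheory GRing.Theory Num.Theory.
Import numFieldNormedType.Exports.
Local Open Scope classical_set_scope.
Local Open Scope ring_scope.

Section Conclusion.
Variable R : realType.
Local Notation p := (inducibilityY R).

Lemma le_lambda_max (n : nat) (G : sgraph 'I_n) : lambda p G <= lambda_max p n.
Proof.
rewrite /lambda_max; case: pickP => [G0 G0P|/(_ G)]; last first.
  by move/asboolP; case; exact: admissible_inducibilityY.
case: arg_maxP => // H _; apply; exact/asboolP/admissible_inducibilityY.
Qed.

Lemma lambda_max_attained (n : nat) : exists G : sgraph 'I_n, lambda_max p n = lambda p G.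
Proof.
rewrite /lambda_max; case: pickP => [G0 G0P|/(_ (mkgraph (fun _ _ => false)))].
  by case: arg_maxP => // H _ _; exists H.
by move/asboolP; case; exact: admissible_inducibilityY.
Qed.

Lemma min_changes_le (T : finType) (m : nat) (B : sgraph 'I_m) (G H : sgraph T) :
  is_blowup B H -> (min_changes B G <= edit_changes G H)%N.
Proof.
by move=> BH; rewrite /min_changes -leEnat -minEnat; apply: bigmin_le_cond.
Qed.

Lemma perfectly_stable_C5 : perfectly_stable p C5.
Proof.
(* The same number serves as the stability constant and as the least admissible order. *)
have [C [n0 [C0 n00 stab]]] := stability R; exists (C + n0 + 20%:R).
  by rewrite !addr_gt0.
move=> n G Cn _; have := stab 'I_n G; rewrite card_ord => -[|H H_blowup].
  by apply: le_trans Cn; lra.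
have lm := le_lambda_max H; have := min_changes_le G H_blowup.
rewrite /delta_edit card_ord -(ler_nat R).
have n20 : 20%:R <= n%:R :> R by apply: le_trans Cn; lra.
have b2 : 2%:R * 'C(n, 2)%:R = n%:R * (n%:R - 1) :> R.
  have n1 : (0 < n)%N by rewrite -(ltr_nat R); lra.
  by rewrite -natrM -mul_bin_diag bin1 natrM -subn1 natrB.
have [] := fact5_bin5 R n; rewrite !lambda_inducibilityY card_ord in lm *.
move: lm b2; move: (lambda_max _ _) ('C(n, 5)%:R : R) ('C(n, 2)%:R : R).
move: (#|embY (adj H)|%:R : R) (#|embY (adj G)|%:R : R) => eH eG.
have : 0 <= (edit_changes G H)%:R :> R by [].
move: (min_changes _ _)%:R (edit_changes _ _)%:R (n%:R : R) n20 Cn => /= d k x x20 Cx k0.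
move=> l c b lm b2 xc cx dk kgain.
have x0 : 0 < x by lra.
have x4 : 0 < x ^+ 4 by rewrite exprn_gt0.
have x5 : 20%:R * x ^+ 4 <= x ^+ 5 by rewrite (exprS x 4) ler_pM2r.
have c0 : 0 < c by clear - xc x4 x5; lra.
have bx : x ^+ 2 <= 4%:R * b.
  have := mulr_ge0 (ltW x0) (_ : 0 <= x - 2%:R); rewrite subr_ge0 => H2.
  have {}H2 := H2 (le_trans _ x20); rewrite expr2.
  have := H2 (ler_nat R 2 20); clear - b2; lra.
have b0 : 0 < b by rewrite -(pmulr_rgt0 _ (ltr0n R 4)) (lt_le_trans _ bx) ?exprn_gt0.
pose D := eH / (2%:R * c) - eG / (2%:R * c).
have eD : eH - eG = 2%:R * c * D by rewrite /D; field; rewrite gt_eqF.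
have D0 : 0 <= D.
  rewrite /D -mulrBl divr_ge0 ?mulr_ge0 ?(ltW c0) //.
  rewrite -(pmulr_rge0 _ C0); apply: le_trans kgain.
  by rewrite mulr_ge0 ?exprn_ge0 // ltW.
apply: (@le_trans _ _ (C * D)); last first.
  apply: ler_pM => //; [exact: ltW|by clear - n00; lra|by rewrite /D lerD2r].
have x3 : 0 < x ^+ 3 by rewrite exprn_gt0.
rewrite ler_pdivrMr //; apply: le_trans dk _; rewrite -(ler_pM2r x3).
apply: le_trans kgain _; rewrite eD.
have -> : C * D * b * x ^+ 3 = C * D * (b * x ^+ 3) by ring.
have -> : C * (2%:R * c * D) = C * D * (2%:R * c) by ring.
apply: ler_wpM2l; first by rewrite mulr_ge0 // ltW.
have : x ^+ 2 * x ^+ 3 <= 4%:R * b * x ^+ 3 by rewrite ler_pM2r.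
(* Here 2 c <= x^5 / 60, while b x^3 >= x^5 / 4. *)
rewrite -exprD -mulrA => bx3; have := exprn_gt0 5 x0; clear - cx bx3; lra.
Qed.

Lemma cvg_le_inv (u : nat -> R) (l K : R) (N : nat) :
  (forall n, (N <= n)%N -> `|u n - l| <= K / n%:R) -> u n @[n --> \oo] --> l.
Proof.
move=> uK; apply/cvgrPdist_le => eps eps0.
near=> n; rewrite distrC; apply: le_trans (uK n _) _; first by near: n; exists N.
have n0 : 0 < n%:R :> R by rewrite ltr0n; near: n; exists 1%N.
rewrite ler_pdivrMr // mulrC -ler_pdivrMr //.
near: n; exact: nbhs_infty_ger.
Unshelve. all: by end_near.
Qed.

Lemma cvg_lambda_max : lambda_max p n @[n --> \oo] --> (24 / 125 : R).
Proof.
apply: (@cvg_le_inv _ _ 120%:R 20) => n n20.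
have n5 : (5 <= n)%N by exact: leq_trans n20.
have [G lG] := lambda_max_attained n; have := @lambda_near R 'I_n G.
rewrite card_ord => /(_ n20) /andP[_ loG].
have ubG := card_embY_ub R (@adj_sym _ G) (@adj_irr _ G).
have [] := @balanced_blowup R 'I_n; first by rewrite card_ord.
move=> H [_ lbH]; have := @lambda_near R 'I_n H.
rewrite card_ord => /(_ n20) /andP[loH _]; have lmH := le_lambda_max H.
rewrite !card_ord in ubG lbH; have n0 : 0 < n%:R :> R by rewrite ltr0n (leq_trans _ n5).
have n50 : 0 < n%:R ^+ 5 :> R by rewrite exprn_gt0.
have {}ubG : #|embY (adj G)|%:R / n%:R ^+ 5 <= 2 / 625 :> R.
  by rewrite ler_pdivrMr //; clear - ubG; lra.
have {}lbH : 2 / 625 - 2%:R / n%:R <= #|embY (adj H)|%:R / n%:R ^+ 5 :> R.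
  rewrite ler_pdivlMr // mulrBl.
  have -> : 2%:R / n%:R * n%:R ^+ 5 = 2%:R * n%:R ^+ 4 :> R by field; rewrite gt_eqF.
  clear - lbH; lra.
rewrite ler_norml -lG in loG *; clear - loG loH lmH ubG lbH n0.
have in0 : 0 < n%:R^-1 :> R by rewrite invr_gt0.
by apply/andP; split; lra.
Qed.

End Conclusion.

(** * Limit densities of blow-ups *)

Section BlowupLimit.
Variable R : realType.
Local Notation p := (inducibilityY R).

Lemma cvg_blowup_poly (b : nat -> 'I_5 -> R) (a : 'I_5 -> R) :
  (forall i, b n i @[n --> \oo] --> a i) ->
  blowup_poly (b n) @[n --> \oo] --> blowup_poly a.
Proof.
move=> ba; under eq_fun do rewrite blowup_polyE; rewrite blowup_polyE.
apply: cvg_big => [|x _]; first exact: add_continuous.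
by apply: cvg_big => [|i _]; [exact: mul_continuous|exact: ba].
Qed.

(** The order of the blow-up is [N n], which is only within a constant of [n]; the densities are
    therefore compared with the polynomial at the relative sizes [s n i / N n], which converge to
    [a]. *)
Lemma is_lambda_blowup_C5 (a : 'rV[R]_5) : simplex a ->
  is_lambda_blowup p C5 a (60%:R * blowup_poly (a 0)).
Proof.
move=> [a0 a1] s [K sK]; pose N n := (\sum_i s n i)%N.
have K0 : 0 <= K by apply: le_trans (sK 0%N ord0).
have N_near n : `|(N n)%:R - n%:R| <= 5%:R * K.
  have -> : (N n)%:R - n%:R = \sum_i ((s n i)%:R - a 0 i * n%:R).
    by rewrite sumrB -mulr_suml a1 mul1r natr_sum.
  apply: le_trans (ler_norm_sum _ _ _) _.
  apply: (@le_trans _ _ (\sum_(i < 5) K)); first by apply: ler_sum => i _; apply: sK.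
  by rewrite sumr_const card_ord -[leLHS]mulr_natl.
(* From here on [N n >= n - 5 K >= n / 2 + 20]. *)
have [M M20] : exists M : nat, 10%:R * K + 40%:R <= M%:R.
  have M0 : 0 <= 10%:R * K + 40%:R by rewrite addr_ge0 ?mulr_ge0.
  have /andP[_ lt_M] := truncn_itv M0.
  by exists (Num.truncn (10%:R * K + 40%:R)).+1; exact: ltW.
have N_large n : (M <= n)%N -> n%:R <= 2%:R * (N n)%:R :> R /\ 20%:R <= (N n)%:R :> R.
  rewrite -(ler_nat R) => Mn; have := N_near n; rewrite ler_norml => /andP[lo _].
  by split; lra.
have inv_N n : (M <= n)%N -> 0 < n%:R :> R /\ (N n)%:R^-1 <= 2%:R / n%:R :> R.
  move=> Mn; have [nN N20] := N_large n Mn.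
  have n0 : 0 < n%:R :> R by move: Mn; rewrite -(ler_nat R); lra.
  split=> //; rewrite ler_pdivlMr // mulrC ler_pdivrMr //; lra.
have parts i : (s n i)%:R / (N n)%:R @[n --> \oo] --> a 0 i.
  apply: (@cvg_le_inv _ _ _ (12%:R * K) M) => n Mn.
  have [nN N20] := N_large n Mn; have [n0 iN] := inv_N n Mn.
  have N0 : 0 < (N n)%:R :> R by lra.
  have -> : (s n i)%:R / (N n)%:R - a 0 i =
      (((s n i)%:R - a 0 i * n%:R) - a 0 i * ((N n)%:R - n%:R)) / (N n)%:R.
    by field; rewrite gt_eqF.
  have ai1 : a 0 i <= 1 by rewrite -a1 (bigD1 i) //= lerDl sumr_ge0.
  rewrite normrM (ger0_norm (_ : 0 <= (N n)%:R^-1)) ?invr_ge0 //.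
  have -> : 12%:R * K / n%:R = 6%:R * K * (2%:R / n%:R) by field; rewrite gt_eqF.
  apply: ler_pM => //; rewrite ?invr_ge0 //; apply: le_trans (ler_normB _ _) _.
  rewrite normrM (ger0_norm (a0 i)).
  have := ler_pM (a0 i) (normr_ge0 _) ai1 (N_near n); have := sK n i; lra.
have /cvg_blowup_poly polyN := parts.
rewrite [X in _ --> X](_ : _ = 0 + 60%:R * blowup_poly (a 0)); last by rewrite add0r.
rewrite (_ : (fun n => _) = fun n => (lambda p (sized_blowup C5 (s n)) -
  60%:R * blowup_poly (fun i => (s n i)%:R / (N n)%:R)) +
  60%:R * blowup_poly (fun i => (s n i)%:R / (N n)%:R)); last first.
  by apply/funext => n; rewrite subrK.
apply: cvgD; last by apply: cvgMr.
(* The error is 4 / N from [lambda_near] plus 60 / N from the patterns that are not injective, and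
   64 / N <= 128 / n. *)
apply: (@cvg_le_inv _ _ _ 128%:R M) => n Mn; rewrite subr0.
have [nN N20] := N_large n Mn; have [n0 iN] := inv_N n Mn.
have N0 : 0 < (N n)%:R :> R by lra.
have N50 : 0 < (N n)%:R ^+ 5 :> R by rewrite exprn_gt0.
rewrite /sized_blowup; have := @lambda_near R _ (blowup C5 (@tag _ (fun i => 'I_(s n i)))).
have [] := @card_embY_blowup R _ (@tag _ (fun i => 'I_(s n i))).
rewrite (_ : (fun i => (fiber_size _ i)%:R) = fun i => (N n)%:R * ((s n i)%:R / (N n)%:R)).
  rewrite blowup_polyZ card_sigma_ord -/(N n).
  move: (lambda _ _) (blowup_poly _) (#|embY _|%:R : R) => l q x xq qx.
  rewrite -(ler_nat R) => /(_ N20) /andP[lo hi].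
  have {}xq : x / (N n)%:R ^+ 5 <= q by rewrite ler_pdivrMr // mulrC.
  have {}qx : q - (N n)%:R^-1 <= x / (N n)%:R ^+ 5.
    rewrite ler_pdivlMr // mulrBl (_ : _^-1 * _ = (N n)%:R ^+ 4).
      by clear - qx; lra.
    by rewrite (exprS _ 4) mulKf // gt_eqF.
  have iN0 : 0 < (N n)%:R^-1 :> R by rewrite invr_gt0.
  by rewrite ler_norml; clear - xq qx lo hi iN iN0; apply/andP; split; lra.
by apply/funext => i; rewrite fiber_size_tag mulrC divfK // gt_eqF.
Qed.

(** Since the limit is required for every choice of part sizes, its uniqueness needs one actual
    choice; rounding down provides it. *)
Lemma lambda_blowup_C5 (a : 'rV[R]_5) : simplex a ->
  lambda_blowup p C5 a = 60%:R * blowup_poly (a 0).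
Proof.
move=> aS; apply: xget_unique; first exact: is_lambda_blowup_C5.
move=> l lP; pose s n i := Num.truncn (a 0 i * n%:R).
have sP : exists K : R, forall n i, `|(s n i)%:R - a 0 i * n%:R| <= K.
  exists 1 => n i; have := truncn_itv (mulr_ge0 (aS.1 i) (ler0n R n)).
  by rewrite -natr1 => /andP[lo hi]; rewrite distrC ler_norml; apply/andP; split; lra.
exact: (cvg_unique (@norm_hausdorff _ _) (lP s sP) (is_lambda_blowup_C5 aS sP)).
Qed.

Lemma maximisers_C5 : maximisers p C5 = [set const_mx (1 / 5)].
Proof.
pose c : 'rV[R]_5 := const_mx (1 / 5).
have cS : simplex c.
  split=> [i|]; first by rewrite mxE divr_ge0.
  rewrite (eq_bigr (fun=> 1 / 5)) => [|i _]; last by rewrite mxE.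
  by rewrite sumr_const card_ord -[LHS]mulr_natl; field.
have cP : blowup_poly (c 0) = 2 / 625.
  rewrite (_ : c 0 = fun=> 1 / 5) ?blowup_poly_cst; first by field.
  by apply/funext => i; rewrite mxE.
apply/seteqP; split=> a /=.
  move=> [aS /(_ c cS)]; rewrite !lambda_blowup_C5 // ler_pM2l // cP => aM.
  by apply/rowP => i; rewrite mxE mul1r (blowup_poly_max aS.1 aS.2 aM).
move=> ->; split=> // b bS; rewrite !lambda_blowup_C5 // ler_pM2l // cP.
exact: blowup_poly_le bS.1 bS.2.
Qed.

End BlowupLimit.

Theorem theorem1p9 (R : realType) :
  [/\ perfectly_stable (inducibilityY R) C5,
      lambda_max (inducibilityY R) n @[n --> \oo] --> (24 / 125 : R) &
      maximisers (inducibilityY R) C5 = [set const_mx (1 / 5)]].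
Proof.
split; [exact: perfectly_stable_C5|exact: cvg_lambda_max|exact: maximisers_C5].
Qed.
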